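(* There exists a universal constant $C>0$ such that the following holds. Let $n\ge 2$, $d\ge 2$, $r\in[d]$, and let $\mathcal{P}_{0,r}$ be any class of distributions $P$ on $\mathbb{R}^d$ for which $r\in\Theta(P)$ and $0<\mathbb{E}_P[W_k^2]<\infty$ for all $k\in[d]\setminus\{r\}$. Let $\bm X_1,\dots,\bm X_{2n}$ be i.i.d. from $P$, and let $\widehat s$ be either $\widehat s_{\mathrm{plug}}$ or $\widehat s_{\mathrm{adj}}$. Then $$\sup_{P\in\mathcal{P}_{0,r}}\ \sup_{t\in\mathbb{R}}\left|P\left(\frac{\sqrt n\,\bm\gamma_{\widehat s}^\top(\overline{\bm X}^{(1)}-\bm\mu)}{\sqrt{\bm\gamma_{\widehat s}^\top\widehat{\bm\Sigma}^{(1)}\bm\gamma_{\widehat s}}}\le t\right)-\Phi(t)\right|\ \le\ \min\Bigl\{1,\ C\max_{k\in[d]\setminus\{r\}}M_k\Bigr\}.$$ Consequently, let $\alpha\in(0,1)$. For any sequence of dimensions $(d_n)$, $d_n \geq 2$, and any sequence of such null classes $\mathcal{P}_{0,r}=\mathcal{P}_{0,r}^{(n)}$ of distributions on $\mathbb{R}^{d_n}$ with $\max_{k\in[d_n]\setminus\{r\}}M_k=o(1)$ as $n\to\infty$, the DA argmin test $\psi_r$ at level $\alpha$ satisfies $$\limsup_{n\to\infty}\ \sup_{P\in\mathcal{P}_{0,r}}P(\psi_r=1)\le\alpha .$$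
   Context: Notation: $[d]=\{1,\dots,d\}$; $\bm\mu=(\mu_1,\dots,\mu_d)^\top$ is the mean of $P$; $\Theta(P)=\arg\min_{k\in[d]}\mu_k$ is the set of all indices attaining the minimum; $\Phi$ is the standard normal cdf and $z_{1-\alpha}$ its $1-\alpha$ quantile; $a\vee b=\max(a,b)$; $\bm e_k$ is the $k$-th standard basis vector; $\bm\gamma_k=\bm e_r-\bm e_k$. ''sargmin'' denotes the smallest index attaining the minimum. For $\bm X\sim P$ and $k\ne r$, $W_k=\bm\gamma_k^\top(\bm X-\bm\mu)$, and $$M_k=\sup_{P\in\mathcal{P}_{0,r}}\mathbb{E}_P\left[\frac{W_k^2}{\mathbb{E}_P[W_k^2]}\min\left\{1,\frac{|W_k|}{n^{1/2}(\mathbb{E}_P[W_k^2])^{1/2}}\right\}\right].$$ Given $\bm X_1,\dots,\bm X_{2n}$, let $\overline{\bm X}^{(1)}$, $\widehat{\bm\Sigma}^{(1)}$ be the sample mean and sample covariance matrix of $\bm X_1,\dots,\bm X_n$, and $\overline{\bm X}^{(2)}$, $\widehat{\bm\Sigma}^{(2)}$ those of $\bm X_{n+1},\dots,\bm X_{2n}$ (covariances with normalization $1/(n-1)$). Selection rules, computed from the second half only, with $\kappa>0$ a fixed constant: $$\widehat s_{\mathrm{plug}}=\mathop{\mathrm{sargmin}}_{k\in[d]\setminus\{r\}}\overline X^{(2)}_k,\qquad \widehat s_{\mathrm{adj}}=\mathop{\mathrm{sargmin}}_{k\in[d]\setminus\{r\}}\frac{\overline X^{(2)}_k-\overline X^{(2)}_r}{\sqrt{\bm\gamma_k^\top\widehat{\bm\Sigma}^{(2)}\bm\gamma_k}\vee\kappa}.$$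 The DA argmin test $\psi_r$ of $H_0:r\in\Theta$ at level $\alpha$ equals $1$ (rejects) iff $\sqrt n\,\bm\gamma_{\widehat s}^\top\overline{\bm X}^{(1)}>z_{1-\alpha}\sqrt{\bm\gamma_{\widehat s}^\top\widehat{\bm\Sigma}^{(1)}\bm\gamma_{\widehat s}}$, and $0$ otherwise. The studentized ratio is set to $0$ when its denominator vanishes. *)

(* Defs.v *)
From HB Require Import structures.
From mathcomp Require Import all_boot all_order all_algebra.
From mathcomp Require Import all_classical all_reals all_analysis.

Set Implicit Arguments.
Unset Strict Implicit.
Unset Printing Implicit Defensive.

Import Order.TTheory GRing.Theory Num.Theory.
Import numFieldNormedType.Exports.

Local Open Scope classical_set_scope.
Local Open Scope ring_scope.

(* Written over MathComp-Analysis. A distribution on R^d is a probability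
   measure on [d.-tuple R], whose sigma-algebra is the product of the Borel
   sigma-algebras; vector and matrix algebra takes place in ['cV[R]_d]. *)

Section iid.
Local Open Scope ereal_scope.

Definition mutually_independent {dT dE : measure_display}
    {T : measurableType dT} {E : measurableType dE} {R : realType}
    (Pr : probability T R) (I : finType) (X : I -> T -> E) : Prop :=
  forall (J : {set I}) (A : I -> set E),
    (forall i, i \in J -> measurable (A i)) ->
    Pr (\big[setI/setT]_(i in J) (X i @^-1` A i)) =
      \prod_(i in J) Pr (X i @^-1` A i).

Record iid_sample {dE : measure_display} {E : measurableType dE}
    {R : realType} (m : nat) (P : probability E R) := IidSample {
  iid_display : measure_display;
  iid_space : measurableType iid_display;
  iid_prob : probability iid_space R;
  iid_obs : 'I_m -> iid_space -> E;
  iid_measurable : forall i, measurable_fun setT (iid_obs i);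
  iid_law : forall i A, measurable A -> iid_prob (iid_obs i @^-1` A) = P A;
  iid_indep : mutually_independent iid_prob iid_obs
}.

End iid.

Section normal.
Context {R : realType}.

Definition Phi (t : R) : \bar R := normal_prob 0 1 `]-oo, t].

Definition z_quantile (q : R) : R := inf [set t : R | (q%:E <= Phi t)%E].

End normal.

Section population.
Context {R : realType} {d : nat}.
Implicit Types (P : probability (d.-tuple R) R) (r k : 'I_d).

Definition vec (x : d.-tuple R) : 'cV[R]_d := \col_k tnth x k.

Definition dotv (u v : 'cV[R]_d) : R := (u^T *m v) 0 0.

Definition gammav r k : 'cV[R]_d := delta_mx r 0 - delta_mx k 0.

Definition mu P : 'cV[R]_d := \col_k fine ('E_P[fun x => tnth x k])%E.

Definition Theta P : {set 'I_d} :=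
  [set k : 'I_d | [forall j : 'I_d, mu P k 0 <= mu P j 0]]%SET.

Definition W P r k (x : d.-tuple R) : R := dotv (gammav r k) (vec x - mu P).

Definition EW2 P r k : \bar R := ('E_P[fun x => (W P r k x ^+ 2)%R])%E.

(* Integrability of the coordinates is what makes the mean of [P] exist. *)
Definition null_law r P : Prop :=
  [/\ forall k, P.-integrable setT (fun x => (tnth x k)%:E),
      r \in Theta P &
      forall k, k != r -> (0 < EW2 P r k < +oo)%E].

Definition Mk (n : nat) r (Pc : set (probability (d.-tuple R) R)) k : \bar R :=
  ereal_sup
    [set ('E_P[fun x =>
       (W P r k x ^+ 2 / fine (EW2 P r k) *
        Num.min 1 (`|W P r k x| /
                   (Num.sqrt n%:R * Num.sqrt (fine (EW2 P r k)))))%R])%E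
    | P in Pc].

(* The quantities [Mk] are suprema of nonnegative numbers, so starting the
   maximum at 0 only matters for an empty class, where [ereal_sup] is -oo. *)
Definition max_Mk (n : nat) r (Pc : set (probability (d.-tuple R) R)) :
    \bar R :=
  (\big[maxe/0]_(k < d | k != r) Mk n r Pc k)%E.

End population.

Section sample_statistics.
Context {R : realType} {d n : nat}.
Implicit Types (Y : 'I_n -> 'cV[R]_d) (r k : 'I_d).

Definition sample_mean Y : 'cV[R]_d := n%:R^-1 *: \sum_i Y i.

Definition sample_cov Y : 'M[R]_d :=
  (n.-1)%:R^-1 *:
    \sum_i (Y i - sample_mean Y) *m (Y i - sample_mean Y)^T.

Definition sample_sd Y r k : R :=
  Num.sqrt (dotv (gammav r k) (sample_cov Y *m gammav r k)).

(* When the denominator vanishes the ratio is 0, because 0^-1 = 0. *)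
Definition studentized (m : 'cV[R]_d) Y r k : R :=
  Num.sqrt n%:R * dotv (gammav r k) (sample_mean Y - m) / sample_sd Y r k.

End sample_statistics.

Section selection.
Context {R : realType} {d : nat}.

Definition is_sargmin (r : 'I_d) (f : 'I_d -> R) (k : 'I_d) : bool :=
  [&& k != r,
      [forall j : 'I_d, (j != r) ==> (f k <= f j)] &
      [forall j : 'I_d, (j != r) && (f j == f k) ==> (k <= j)%N]].

(* The default value [r] is used only when no index other than [r] exists. *)
Definition sargmin (r : 'I_d) (f : 'I_d -> R) : 'I_d :=
  odflt r [pick k | is_sargmin r f k].

Lemma sargminP (r : 'I_d) (f : 'I_d -> R) :
  (1 < d)%N -> is_sargmin r f (sargmin r f).
Proof.
move=> d1; rewrite /sargmin; case: pickP => //= no.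
have [k0 k0r] : exists k, k != r.
  case: d d1 r {f no} => [//|[//|e]] _ r.
  by exists (lift r ord0); rewrite eq_sym neq_lift.
case: (@arg_minP _ _ _ k0 (fun k => k != r) f k0r) => k kr kmin.
have pk : (k != r) && (f k == f k) by rewrite kr eqxx.
case: (@arg_minnP _ k (fun j => (j != r) && (f j == f k))
         (fun j : 'I_d => j : nat) pk) => j /andP[jr /eqP fj] jmin.
have := no j; rewrite /is_sargmin jr /= => /negP[]; apply/andP; split.
  by apply/forallP => i; apply/implyP => ir; rewrite fj; exact: kmin.
apply/forallP => i; apply/implyP => /andP[ir /eqP fi].
by apply: jmin; rewrite ir fi fj eqxx.
Qed.

Inductive selection_rule := plug | adj.

Definition select {n : nat} (kappa : R) (s : selection_rule) (r : 'I_d)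
    (Y : 'I_n -> 'cV[R]_d) : 'I_d :=
  match s with
  | plug => sargmin r (fun k => sample_mean Y k 0)
  | adj => sargmin r (fun k =>
      (sample_mean Y k 0 - sample_mean Y r 0) /
      Num.max (sample_sd Y r k) kappa)
  end.

End selection.

Section da_test.
Context {R : realType} {d n : nat} {P : probability (d.-tuple R) R}.
Variables (kappa : R) (s : selection_rule) (r : 'I_d).
Variable S : iid_sample (n + n) P.

Definition half1 (w : iid_space S) (i : 'I_n) : 'cV[R]_d :=
  vec (iid_obs (lshift n i) w).

Definition half2 (w : iid_space S) (i : 'I_n) : 'cV[R]_d :=
  vec (iid_obs (rshift n i) w).

Definition s_hat (w : iid_space S) : 'I_d := select kappa s r (half2 w).

Definition prob_studentized_le (t : R) : \bar R :=
  iid_prob S [set w | studentized (mu P) (half1 w) r (s_hat w) <= t].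

Definition psi (alpha : R) (w : iid_space S) : bool :=
  Num.sqrt n%:R * dotv (gammav r (s_hat w)) (sample_mean (half1 w)) >
  z_quantile (1 - alpha) * sample_sd (half1 w) r (s_hat w).

Definition prob_reject (alpha : R) : \bar R :=
  iid_prob S [set w | psi alpha w].

End da_test.

(* Main.v *)
Require Import Defs.
From HB Require Import structures.
From mathcomp Require Import all_boot all_order all_algebra.
From mathcomp Require Import all_classical all_reals all_analysis.
From mathcomp Require Import measurable_realfun.
From mathcomp Require Import ring lra.

Set Implicit Arguments.
Unset Strict Implicit.
Unset Printing Implicit Defensive.

Import Order.TTheory GRing.Theory Num.Theory.
Import numFieldNormedType.Exports.

Local Open Scope classical_set_scope.
Local Open Scope ring_scope.

(** Let T be the self-normalized sum (sum xi_i) / sqrt(sum xi_i^2) of centred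
    summands scaled to total variance 1 and truncated at 1, B the Lyapunov
    quantity sum E[xi_i^2 min(1, |xi_i|)], and f the Stein solution for the
    half-line ]-oo, x]. Expanding E[T f(T)] one summand at a time gives
    E[f'(T) * sum xi_i^2 / sum xi_i^2], and the ratio is 1: self-normalization
    removes the fluctuations of sum xi_i^2, which would be too large to be
    treated as an error term. The remaining error is O(B), except where a
    summand carries T across the jump of f' at x. Conditionally on xi_i this
    forces the statistic of the other summands into an interval of relative
    length O(|xi_i|), whose probability is bounded by the same expansion
    applied to a clamped identity instead of f. Second moments make these
    bounds uniform in x. Student's statistic is an increasing function of T,
    and the index is selected from the independent second half, so the law of
    the selected statistic is a mixture of the laws with a fixed index. *)

(** * Expectation of bounded random variables and independence of pairs *)

Section bounded_expectation.
Context {d : measure_display} {T : measurableType d} {R : realType}.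
Variable P : probability T R.
Implicit Types X Y : T -> R.

(** The normalizer [nrm] of T is frozen once the sum of squares falls below 1/2. Every variable in
    the Stein argument is then bounded, so integrability is automatic, and the ratio equal to 1 is
    lost only on an event of probability O(B). Truncation creates third moments, nonzero means, a
    loss of variance and a chance that it acts at all; the one quantity B bounds all four, which is
    why second moments suffice. Deleting a summand also changes the normalizer and displaces a value
    near x by an extra xi_i^2 |x|. A plain concentration bound would lose uniformity in x, so the
    one proved here decays like 1 / (1 + |x|) in the length of the interval. B is at least 1 / (3
    sqrt n), hence it absorbs the error of order 1 / sqrt n made in passing to Student's statistic;
    for B > 1/64 the final bounds exceed 1. The test needs one more estimate: when the sample
    deviation vanishes the studentized ratio is 0 by convention, while the test may still reject. *)

Definition bounded_measurable X : Prop :=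
  measurable_fun setT X /\ exists M, forall w, `|X w| <= M.

Local Notation bm := bounded_measurable.

Definition Ex X : R := (\int[P]_w X w)%R.

Lemma bm_measurable X : bm X -> measurable_fun setT X.
Proof. by case. Qed.

Lemma bm_integrable X : bm X -> P.-integrable setT (EFin \o X).
Proof.
move=> [mX [M XM]]; apply: (@le_integrable _ _ _ _ _ measurableT _ (cst M%:E)) => //.
- exact/measurable_EFinP.
- by move=> w _; rewrite /= lee_fin (le_trans (XM w))// ler_norm.
- by apply/integrableP; split => //; rewrite integral_cst//= probability_setT mule1 ltry.
Qed.

Lemma bm_cst c : bm (fun=> c).
Proof. by split => //; exists `|c|. Qed.

Lemma bmD X Y : bm X -> bm Y -> bm (fun w => X w + Y w).
Proof.
move=> [mX [M XM]] [mY [N YN]]; split; first exact: measurable_funD.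
exists (M + N) => w; exact: le_trans (ler_normD _ _) (lerD _ _).
Qed.

Lemma bmM X Y : bm X -> bm Y -> bm (fun w => X w * Y w).
Proof.
move=> [mX [M XM]] [mY [N YN]]; split; first exact: measurable_funM.
by exists (M * N) => w; rewrite normrM ler_pM.
Qed.

Lemma bmN X : bm X -> bm (fun w => - X w).
Proof.
move=> [mX [M XM]]; split; first exact: measurableT_comp.
by exists M => w; rewrite normrN.
Qed.

Lemma bmB X Y : bm X -> bm Y -> bm (fun w => X w - Y w).
Proof. by move=> bX bY; apply: bmD => //; exact: bmN. Qed.

Lemma bm_norm X : bm X -> bm (fun w => `|X w|).
Proof.
move=> [mX [M XM]]; split; first exact: measurableT_comp.
by exists M => w; rewrite normr_id.
Qed.

Lemma bmX X n : bm X -> bm (fun w => X w ^+ n).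
Proof.
move=> bX; elim: n => [|n IH]; first exact: bm_cst 1.
have -> : (fun w => X w ^+ n.+1) = (fun w => X w * X w ^+ n).
  by apply/funext => w; rewrite exprS.
exact: bmM.
Qed.

Lemma bm_sum (I : Type) (s : seq I) (p : pred I) (F : I -> T -> R) :
  (forall i, p i -> bm (F i)) -> bm (fun w => \sum_(i <- s | p i) F i w).
Proof.
move=> bF; elim: s => [|i s IH].
  have -> : (fun w => \sum_(i <- [::] | p i) F i w) = fun=> 0.
    by apply/funext => w; rewrite big_nil.
  exact: bm_cst.
have -> : (fun w => \sum_(j <- i :: s | p j) F j w) =
    if p i then (fun w => F i w + \sum_(j <- s | p j) F j w)
    else (fun w => \sum_(j <- s | p j) F j w).
  by apply/funext => w; rewrite big_cons; case: (p i).
by case: ifPn => // pi; apply: bmD => //; exact: bF.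
Qed.

Lemma bm_le X Y : measurable_fun setT X -> bm Y ->
  (forall w, `|X w| <= `|Y w|) -> bm X.
Proof.
move=> mX [_ [M YM]] XY; split => //.
by exists M => w; exact: le_trans (XY w) (YM w).
Qed.

Lemma bm_bool (b : T -> bool) : measurable_fun setT b -> bm (fun w => (b w)%:R).
Proof.
move=> mb; split.
  have -> : (fun w => (b w)%:R) = (fun w => if b w then 1 else 0 : R).
    by apply/funext => w; case: (b w).
  exact: measurable_fun_ifT.
by exists 1 => w; case: (b w); rewrite ?normr1 ?normr0.
Qed.

Lemma eq_Ex X Y : X =1 Y -> Ex X = Ex Y.
Proof. by move=> XY; apply: eq_Rintegral => w _. Qed.

Lemma ExD X Y : bm X -> bm Y -> Ex (fun w => X w + Y w) = Ex X + Ex Y.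
Proof. by move=> bX bY; apply: RintegralD => //; exact: bm_integrable. Qed.

Lemma ExB X Y : bm X -> bm Y -> Ex (fun w => X w - Y w) = Ex X - Ex Y.
Proof. by move=> bX bY; apply: RintegralB => //; exact: bm_integrable. Qed.

Lemma ExZ c X : bm X -> Ex (fun w => c * X w) = c * Ex X.
Proof. by move=> bX; apply: RintegralZl => //; exact: bm_integrable. Qed.

Lemma Ex_cst c : Ex (fun=> c) = c.
Proof. rewrite /Ex Rintegral_cst//. by rewrite /= probability_setT mulr1. Qed.

Lemma Ex_sum (I : Type) (s : seq I) (p : pred I) (F : I -> T -> R) :
  (forall i, p i -> bm (F i)) ->
  Ex (fun w => \sum_(i <- s | p i) F i w) = \sum_(i <- s | p i) Ex (F i).
Proof.
move=> bF; elim: s => [|i s IH].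
  by rewrite big_nil -[RHS](Ex_cst 0); apply: eq_Ex => w; rewrite big_nil.
rewrite big_cons; case: ifPn => pi.
  rewrite -IH -ExD; [|exact: bF|exact: bm_sum].
  by apply: eq_Ex => w; rewrite big_cons pi.
by rewrite -IH; apply: eq_Ex => w; rewrite big_cons (negbTE pi).
Qed.

Lemma le_Ex X Y : bm X -> bm Y -> (forall w, X w <= Y w) -> Ex X <= Ex Y.
Proof. by move=> bX bY XY; apply: le_Rintegral => //; exact: bm_integrable. Qed.

Lemma Ex_ge0 X : (forall w, 0 <= X w) -> 0 <= Ex X.
Proof. by move=> X0; exact: Rintegral_ge0. Qed.

Lemma le_norm_Ex X : bm X -> `|Ex X| <= Ex (fun w => `|X w|).
Proof. by move=> bX; apply: le_normr_Rintegral => //; exact: bm_integrable. Qed.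

Lemma measurable_bool_set (b : T -> bool) :
  measurable_fun setT b -> measurable [set w | b w].
Proof. by move=> /(_ measurableT [set true]); rewrite setTI; exact. Qed.

Lemma Ex_bool (b : T -> bool) : measurable_fun setT b ->
  Ex (fun w => (b w)%:R) = fine (P [set w | b w]).
Proof.
move=> mb; rewrite /Ex /Rintegral; congr fine.
rewrite -(setIT [set w | b w]) -integral_indic//; last exact: measurable_bool_set.
apply: eq_integral => w _; rewrite indicE; congr ((nat_of_bool _)%:R%:E).
by apply/idP/idP; rewrite inE.
Qed.

Lemma EFin_Ex X : bm X -> (\int[P]_w (X w)%:E)%E = (Ex X)%:E.
Proof.
by move=> bX; rewrite /Ex /Rintegral fineK//; apply: integrable_fin_num => //;
  exact: bm_integrable.
Qed.

Lemma measurable_boolR (b : T -> bool) :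
  measurable_fun setT (fun w => (b w)%:R : R) -> measurable_fun setT b.
Proof.
move=> mb.
have -> : b = (fun w => (b w)%:R == 1 :> R).
  by apply/funext => w; case: (b w); rewrite ?eqxx// eq_sym oner_eq0.
exact: measurable_fun_eqr.
Qed.

Lemma prob_boolE (b : T -> bool) : bm (fun w => (b w)%:R) ->
  P [set w | b w] = (Ex (fun w => (b w)%:R))%:E.
Proof.
move=> /bm_measurable/measurable_boolR mb.
by rewrite Ex_bool// fineK// fin_num_measure//; exact: measurable_bool_set.
Qed.

Lemma Ex_le1_bool (b : T -> bool) (Y : T -> R) : measurable_fun setT b -> bm Y ->
  (forall w, 0 <= Y w) -> (forall w, b w -> 1 <= Y w) ->
  Ex (fun w => (b w)%:R) <= Ex Y.
Proof.
move=> mb bY Y0 bY1; apply: le_Ex => //; first exact: bm_bool.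
by move=> w; case: (boolP (b w)) => // /bY1.
Qed.

End bounded_expectation.

Section pair_independence.
Context {R : realType} {d d1 d2 : measure_display} {T : measurableType d}
  {T1 : measurableType d1} {T2 : measurableType d2}.
Variable P : probability T R.

Definition independent_pair (X : T -> T1) (Z : T -> T2) : Prop :=
  forall A B, measurable A -> measurable B ->
  (P (X @^-1` A `&` Z @^-1` B) = P (X @^-1` A) * P (Z @^-1` B))%E.

(** Independence says that the law of the pair agrees with the product law on rectangles, hence
    everywhere by uniqueness of product measures. Tonelli and a change of variables in each marginal
    do the rest. *)
Lemma independent_tonelli (X : T -> T1) (Z : T -> T2) (f : T1 * T2 -> \bar R) :
  measurable_fun setT X -> measurable_fun setT Z -> independent_pair X Z ->
  measurable_fun setT f -> (forall z, 0 <= f z)%E ->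
  (\int[P]_w f (X w, Z w) = \int[P]_w \int[P]_v f (X w, Z v))%E.
Proof.
move=> mX mZ XZ mf f0.
pose X' : {mfun T >-> T1} := HB.pack X (isMeasurableFun.Build _ _ _ _ X mX).
pose Z' : {mfun T >-> T2} := HB.pack Z (isMeasurableFun.Build _ _ _ _ Z mZ).
have mXZ : measurable_fun setT (fun w => (X w, Z w)) by exact: measurable_fun_pair.
pose XZ' : {mfun T >-> (T1 * T2)%type} :=
  HB.pack (fun w => (X w, Z w)) (isMeasurableFun.Build _ _ _ _ _ mXZ).
rewrite -[LHS](@ge0_integral_distribution _ _ _ _ _ P XZ' f mf f0).
transitivity (\int[distribution P X' \x distribution P Z']_z f z)%E.
  apply: eq_measure_integral => A mA _; apply/esym.
  by apply: product_measure_unique => //= B C mB mC; exact: XZ.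
rewrite fubini_tonelli1// (@ge0_integral_distribution _ _ _ _ _ P X').
- apply: eq_integral => w _ /=.
  rewrite /fubini_F (@ge0_integral_distribution _ _ _ _ _ P Z')//.
  exact: (measurableT_comp mf).
- exact: measurable_fun_fubini_tonelli_F.
- by move=> x; exact: integral_ge0.
Qed.

End pair_independence.

Section pair_independence_real.
Context {R : realType} {d d2 : measure_display} {T : measurableType d}
  {T2 : measurableType d2}.
Variable P : probability T R.
Local Notation bm := bounded_measurable.
Local Notation Ex := (Ex P).

(** This is the form in which conditioning is used: a bound that holds for every frozen value of [X]
    may be integrated over [X]. *)
Lemma Ex_independent_le (X : T -> R) (Z : T -> T2) (H : R * T2 -> R) (k : R -> R) :
  measurable_fun setT X -> measurable_fun setT Z -> independent_pair P X Z ->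
  measurable_fun setT H -> (forall z, 0 <= H z) ->
  bm (fun w => H (X w, Z w)) -> (forall x, bm (fun w => H (x, Z w))) ->
  bm (fun w => k (X w)) ->
  (forall x, Ex (fun w => H (x, Z w)) <= k x) ->
  Ex (fun w => H (X w, Z w)) <= Ex (fun w => k (X w)).
Proof.
move=> mX mZ XZ mH H0 bH bHx bk Hk.
rewrite -lee_fin -!EFin_Ex//.
rewrite (independent_tonelli (f := fun z => (H z)%:E) mX mZ XZ)//; last first.
  exact/measurable_EFinP.
apply: ge0_le_integral => //.
- by move=> w _; apply: integral_ge0 => v _; rewrite lee_fin.
- pose Z' : {mfun T >-> T2} := HB.pack Z (isMeasurableFun.Build _ _ _ _ Z mZ).
  have -> : (fun w => \int[P]_v (H (X w, Z v))%:E)%E =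
      (fubini_F (distribution P Z') (fun z => (H z)%:E)) \o X.
    apply/funext => w; rewrite /= /fubini_F.
    rewrite (@ge0_integral_distribution _ _ _ _ _ P Z')//.
    by apply/measurable_EFinP; exact: (measurableT_comp mH).
    by move=> y; rewrite lee_fin.
  apply: (measurableT_comp _ mX); apply: measurable_fun_fubini_tonelli_F.
    exact/measurable_EFinP.
  by move=> z; rewrite lee_fin.
- by apply/measurable_EFinP; exact: bm_measurable.
- by move=> w _; rewrite EFin_Ex// lee_fin.
Qed.

Lemma Ex_independentM (X Y : T -> R) : bm X -> bm Y ->
  independent_pair P X Y -> Ex (fun w => X w * Y w) = Ex X * Ex Y.
Proof.
move=> bX bY XY.
have [[mX [M XM]] [mY [N YN]]] := (bX, bY).
(* Tonelli wants nonnegative integrands, so both factors are shifted by their bounds. The absolute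
   values make the identity valid for all shifts; for [M] and [N] they disappear, and expanding the
   product leaves the claim. *)
have ge0case (M' N' : R) : Ex (fun w => `|X w + M'| * `|Y w + N'|) =
    Ex (fun w => `|X w + M'|) * Ex (fun w => `|Y w + N'|).
  have bX' : bm (fun w => `|X w + M'|) by apply/bm_norm/bmD => //; exact: bm_cst.
  have bY' : bm (fun w => `|Y w + N'|) by apply/bm_norm/bmD => //; exact: bm_cst.
  apply: EFin_inj; rewrite EFinM -!EFin_Ex//; last exact: bmM.
  rewrite (independent_tonelli
    (f := fun z : R * R => (`|z.1 + M'| * `|z.2 + N'|)%:E) mX mY XY) //=.
  - transitivity (\int[P]_w ((`|X w + M'|)%:E * \int[P]_v (`|Y v + N'|)%:E))%E.
      apply: eq_integral => w _.
      under eq_integral do rewrite EFinM.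
      apply: ge0_integralZl => //.
      by apply/measurable_EFinP; exact: bm_measurable bY'.
    apply: ge0_integralZr => //.
      by apply/measurable_EFinP; exact: bm_measurable bX'.
    by apply: integral_ge0 => w _; rewrite lee_fin.
  - apply/measurable_EFinP; apply: measurable_funM;
      apply: measurableT_comp => //; apply: measurable_funD => //.
have := ge0case M N.
rewrite (@eq_Ex _ _ _ P (fun w => `|X w + M|) (fun w => X w + M)); last first.
  move=> w; rewrite ger0_norm// -lerBlDr sub0r.
  by have := XM w; rewrite ler_norml => /andP[].
rewrite (@eq_Ex _ _ _ P (fun w => `|Y w + N|) (fun w => Y w + N)); last first.
  move=> w; rewrite ger0_norm// -lerBlDr sub0r.
  by have := YN w; rewrite ler_norml => /andP[].
rewrite (@eq_Ex _ _ _ P _ (fun w => X w * Y w + (M * Y w + (N * X w + M * N)))); last first.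
  move=> w; rewrite !ger0_norm; first by ring.
    by rewrite -lerBlDr sub0r; have := YN w; rewrite ler_norml => /andP[].
  by rewrite -lerBlDr sub0r; have := XM w; rewrite ler_norml => /andP[].
have bN := @bm_cst _ T R.
rewrite (ExD P bX (bN M)) (ExD P bY (bN N)) !Ex_cst.
have bNX : bm (fun w => N * X w) by exact: bmM.
have bMY : bm (fun w => M * Y w) by exact: bmM.
rewrite ExD; [|exact: bmM|by apply: bmD => //; exact: bmD].
rewrite ExD//; last exact: bmD.
by rewrite ExD// !ExZ// Ex_cst; lra.
Qed.

End pair_independence_real.

(** * Independence of disjoint groups of observations *)

Section event_independence.
Context {R : realType} {d d2 : measure_display} {T : measurableType d}
  {T2 : measurableType d2}.
Variable P : probability T R.

(** As functions of [A] both sides are finite measures: the law of [Z] under [P] restricted to [F],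
    and [P F] times the law of [Z]. Measures that agree on a generating pi-system containing the
    whole space are equal. *)
Lemma independent_event_dynkin (Z : T -> T2) (G : set (set T2)) (F : set T) :
  measurable_fun setT Z -> measurable F ->
  @measurable _ T2 = <<s G >> -> setI_closed G -> G setT ->
  (forall A, G A -> (P (Z @^-1` A `&` F) = P (Z @^-1` A) * P F)%E) ->
  forall A, measurable A -> (P (Z @^-1` A `&` F) = P (Z @^-1` A) * P F)%E.
Proof.
move=> mZ mF mG GI GT GE A mA.
pose Z' : {mfun T >-> T2} := HB.pack Z (isMeasurableFun.Build _ _ _ _ Z mZ).
have PF0 : 0 <= fine (P F) by exact: fine_ge0.
pose m1 := pushforward (mrestr P mF) Z'.
pose m2 := mscale (NngNum PF0) (distribution P Z').
have m2E B : m2 B = (P (Z @^-1` B) * P F)%E.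
  by rewrite /m2 /mscale /= fineK ?fin_num_measure// muleC.
rewrite -m2E -[LHS]/(m1 A).
apply: (measure_unique G (fun=> setT)) => //.
- by rewrite bigcup_const//; exists 0%N.
- by move=> B GB; rewrite -[RHS]/(m2 B) m2E -GE.
- move=> _; rewrite -[X in (X < _)%E]/(P (setT `&` F)) setTI.
  by rewrite (le_lt_trans (probability_le1 _ _))// ltry.
Qed.

End event_independence.

(** * Boxes as a generating pi-system for tuples *)

Section tuple_boxes.
Context {dE : measure_display} {E : measurableType dE} {N : nat}.

Definition box (B : 'I_N -> set E) : set (N.-tuple E) :=
  [set t | forall i, B i (tnth t i)].

Definition boxes : set (set (N.-tuple E)) :=
  [set A | exists2 B : 'I_N -> set E, (forall i, measurable (B i)) & A = box B].

Lemma boxes_setI : setI_closed boxes.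
Proof.
move=> _ _ [B mB ->] [C mC ->]; exists (fun i => B i `&` C i).
  by move=> i; exact: measurableI.
apply/seteqP; split => [t [tB tC] i|t tBC]; first by split.
by split => i; have [] := tBC i.
Qed.

Lemma boxes_setT : boxes setT.
Proof. by exists (fun=> setT) => //; apply/seteqP; split. Qed.

(** A coordinate preimage is a box whose other sides are the whole space; conversely a box is a
    finite intersection of coordinate preimages. *)
Lemma boxes_generate : @measurable _ (N.-tuple E) = <<s boxes >>.
Proof.
apply/seteqP; split.
  apply: smallest_sub; first exact: smallest_sigma_algebra.
  rewrite -bigcup_seq => A [i _ [B mB]]; rewrite setTI => <-.
  apply: sub_sigma_algebra; exists (fun j => if j == i then B else setT).
    by move=> j; case: ifP.
  apply/seteqP; split => [t tB j|t /(_ i)]; last by rewrite eqxx.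
  by case: eqP => // ->.
apply: smallest_sub; first exact: sigma_algebra_measurable.
move=> _ [B mB ->].
have -> : box B = \bigcap_(i in [set: 'I_N]) ((fun t => tnth t i) @^-1` B i).
  by apply/seteqP; split => [t tB i _|t tB i]; [exact: tB|exact: tB i I].
apply: fin_bigcap_measurable; first exact: finite_finset.
by move=> i _; rewrite -[X in measurable X]setTI; exact: measurable_tnth.
Qed.

End tuple_boxes.

(** * Groups of observations as masked tuples *)

Section grouping.
Context {R : realType} {d dE : measure_display} {T : measurableType d}
  {E : measurableType dE} {N : nat}.
Variables (P : probability T R) (X : 'I_N -> T -> E) (x0 : E).
Hypothesis mX : forall i, measurable_fun setT (X i).
Hypothesis indX : mutually_independent P X.

(** Filling the positions outside [J] with the default [x0] lets groups of every size live in one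
    type, without reindexing. *)
Definition masked (J : {set 'I_N}) (w : T) : N.-tuple E :=
  [tuple if i \in J then X i w else x0 | i < N].

Lemma measurable_masked J : measurable_fun setT (masked J).
Proof.
apply/measurable_fun_tnthP => i; rewrite /comp.
rewrite (_ : (fun _ => _) = if i \in J then X i else cst x0).
  by case: ifP.
by apply/funext => w; rewrite tnth_mktuple; case: ifP.
Qed.

Let masked_box (J : {set 'I_N}) (B : 'I_N -> set E) : (forall i, i \notin J -> B i x0) ->
  masked J @^-1` box B = \big[setI/setT]_(i in J) (X i @^-1` B i).
Proof.
move=> B0; rewrite -bigcap_seq_cond; apply/seteqP; split => w.
  move=> wB i /= /andP[_ iJ].
  by have := wB i; rewrite tnth_mktuple iJ.
move=> wB i; rewrite tnth_mktuple; case: ifPn => [iJ|/B0//].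
by apply: wB => /=; rewrite mem_index_enum.
Qed.

Let masked_box0 (J : {set 'I_N}) (B : 'I_N -> set E) i : i \notin J -> ~ B i x0 -> masked J @^-1` box B = set0.
Proof.
move=> iJ Bi; apply/seteqP; split => w // /(_ i).
by rewrite tnth_mktuple (negbTE iJ).
Qed.

Let masked_boxes (J K : {set 'I_N}) (B C : 'I_N -> set E) : (forall i, i \in J -> i \notin K) ->
  (forall i, measurable (B i)) -> (forall i, measurable (C i)) ->
  (P (masked J @^-1` box B `&` masked K @^-1` box C) =
   P (masked J @^-1` box B) * P (masked K @^-1` box C))%E.
Proof.
move=> JK mB mC.
(* A side outside the group that excludes [x0] makes the preimage empty and both members 0;
   otherwise the masked positions impose nothing. *)
have [B0|/existsNP[i /not_implyP[iJ Bi]]] := pselect (forall i, i \notin J -> B i x0);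
  last by rewrite (masked_box0 iJ Bi) set0I measure0 mul0e.
have [C0|/existsNP[i /not_implyP[iK Ci]]] := pselect (forall i, i \notin K -> C i x0);
  last by rewrite (masked_box0 iK Ci) setI0 measure0 mule0.
rewrite !masked_box// !indX//.
(* Since [J] and [K] are disjoint, one family of sides carries both boxes, and the product over the
   union splits. *)
pose A i := if i \in J then B i else C i.
have AJ i : i \in J -> A i = B i by rewrite /A => ->.
have AK i : i \in K -> A i = C i.
  by rewrite /A => iK; case: ifPn => // /JK; rewrite iK.
rewrite (eq_bigr (fun i => X i @^-1` A i)); last by move=> i /AJ ->.
rewrite [X in _ `&` X](eq_bigr (fun i => X i @^-1` A i)); last by move=> i /AK ->.
rewrite [X in (_ = X * _)%E](eq_bigr (fun i => P (X i @^-1` A i))); last by move=> i /AJ ->.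
rewrite [X in (_ = _ * X)%E](eq_bigr (fun i => P (X i @^-1` A i))); last by move=> i /AK ->.
rewrite -big_setU; last exact: setIid.
rewrite indX; last by move=> i _; rewrite /A; case: ifP.
rewrite -bigU//; first by apply: eq_bigl => i; rewrite !inE.
by rewrite disjoint_subset; apply/fintype.subsetP => i /JK; rewrite inE.
Qed.

(** The product rule passes from boxes to all measurable sets one argument at a time, the other
    argument being held as a fixed event. *)
Lemma masked_independent (J K : {set 'I_N}) : (forall i, i \in J -> i \notin K) ->
  independent_pair P (masked J) (masked K).
Proof.
move=> JK A B mA mB.
have mpre L (C : set (N.-tuple E)) : measurable C -> measurable (masked L @^-1` C).
  by move=> mC; rewrite -[X in measurable X]setTI; exact: measurable_masked.
apply: (independent_event_dynkin (G := boxes)) => //.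
- exact: measurable_masked.
- exact: mpre.
- exact: boxes_generate.
- exact: boxes_setI.
- exact: boxes_setT.
move=> _ [C mC ->]; rewrite setIC muleC.
apply: (independent_event_dynkin (G := boxes)) => //.
- exact: measurable_masked.
- apply: mpre; rewrite boxes_generate; apply: sub_sigma_algebra; by exists C.
- exact: boxes_generate.
- exact: boxes_setI.
- exact: boxes_setT.
move=> _ [D mD ->].
by rewrite setIC muleC; exact: masked_boxes.
Qed.

Lemma independent_pair_masked {d1 d2 : measure_display} {T1 : measurableType d1}
    {T2 : measurableType d2} (J K : {set 'I_N})
    (F1 : N.-tuple E -> T1) (F2 : N.-tuple E -> T2) :
  (forall i, i \in J -> i \notin K) -> measurable_fun setT F1 -> measurable_fun setT F2 ->
  independent_pair P (F1 \o masked J) (F2 \o masked K).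
Proof.
move=> JK mF1 mF2 A B mA mB.
apply: (@masked_independent J K JK (F1 @^-1` A) (F2 @^-1` B)).
  by have := mF1 measurableT A mA; rewrite setTI.
by have := mF2 measurableT B mB; rewrite setTI.
Qed.

End grouping.

(** * The standard normal law *)

Section real_derivatives.
Context {R : realType}.

Lemma mvt_is_derive (f df : R -> R) (a b : R) : a < b ->
  (forall x : R, is_derive x 1 f (df x)) ->
  exists2 c, a < c < b & f b - f a = df c * (b - a).
Proof.
move=> ab fdf; have [|c] := @MVT R f df a b ab (fun x _ => fdf x).
  by apply: derivable_within_continuous => x _; have [] := fdf x.
by rewrite in_itv => cab fE; exists c.
Qed.

Lemma mvt_is_derive_between (f df : R -> R) (a b : R) :
  (forall x : R, is_derive x 1 f (df x)) ->
  exists c, [/\ `|c - a| <= `|b - a|, Num.min a b <= c, c <= Num.max a b &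
    f b - f a = df c * (b - a)].
Proof.
move=> fdf; have [ab|ba|->] := ltgtP a b; last first.
- by exists b; rewrite !subrr mulr0 lexx.
- have [c /andP[bc ca] fE] := mvt_is_derive ba fdf.
  exists c; split; [|exact: ltW|exact: ltW|lra].
  by rewrite !ler0_norm; lra.
- have [c /andP[ac cb] fE] := mvt_is_derive ab fdf.
  exists c; split; [|exact: ltW|exact: ltW|lra].
  by rewrite !ger0_norm; lra.
Qed.

End real_derivatives.

Section standard_normal.
Context {R : realType}.
Local Notation mu := lebesgue_measure.
Implicit Types u v x : R.

Definition npdf (u : R) : R := normal_pdf 0 1 u.
Definition ncdf (u : R) : R := fine (Phi u).

Lemma npdfE (u : R) : npdf u = normal_peak 1 * expR (- (u ^+ 2 / 2)).
Proof.
rewrite /npdf normal_pdfE ?oner_neq0// /normal_fun subr0 expr1n mulNr.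
by rewrite -mulr_natr mul1r.
Qed.

Lemma npdf_gt0 u : 0 < npdf u.
Proof. by rewrite npdfE mulr_gt0 ?expR_gt0// normal_peak_gt0// oner_neq0. Qed.

Lemma npdf_ge0 u : 0 <= npdf u.
Proof. exact/ltW/npdf_gt0. Qed.

Lemma npdfN u : npdf (- u) = npdf u.
Proof. by rewrite !npdfE sqrrN. Qed.

Lemma continuous_npdf : continuous npdf.
Proof. by apply: continuous_normal_pdf; exact: oner_neq0. Qed.

Lemma is_derive_npdf u : is_derive u 1 npdf (- u * npdf u).
Proof.
rewrite (_ : npdf = fun u => normal_peak 1 * expR (- (u ^+ 2 / 2))); last first.
  by apply/funext => v; rewrite npdfE.
apply: is_derive_eq; rewrite /GRing.scale /=.
by field.
Qed.

Lemma normal_peak_le1 : normal_peak 1 <= 1 :> R.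
Proof.
have p2 : 0 < pi *+ 2 :> R by rewrite mulrn_wgt0// pi_gt0.
rewrite /normal_peak expr1n mul1r invf_le1 ?sqrtr_gt0//.
rewrite -[leLHS]sqrtr1 ler_sqrt ?(ltW p2)//.
by have := pi_ge2 R; rewrite mulr2n; lra.
Qed.

Lemma normal_peak_ge : 1 <= normal_peak 1 * 3 :> R.
Proof.
have p2 : 0 < pi *+ 2 :> R by rewrite mulrn_wgt0// pi_gt0.
rewrite /normal_peak expr1n mul1r ler_pdivlMl ?mulr1 ?sqrtr_gt0//.
have -> : 3 = Num.sqrt (3 ^+ 2) :> R by rewrite sqrtr_sqr ger0_norm.
by rewrite ler_sqrt//; have := pihalf_lt2 R; rewrite -(mulr_natr pi); lra.
Qed.

Lemma npdf_le1 u : npdf u <= 1.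
Proof. exact: le_trans (normal_pdf_ub _ _ (oner_neq0 _)) normal_peak_le1. Qed.

Lemma npdf_le_inv_sqr u : npdf u * (1 + u ^+ 2 / 2) <= 1.
Proof.
rewrite npdfE expRN -mulrA; apply: (le_trans _ normal_peak_le1).
rewrite ler_piMr ?normal_peak_ge0// mulrC ler_pdivrMr ?expR_gt0// mul1r.
by rewrite expR_ge1Dx.
Qed.

Lemma PhiE u : Phi u = (ncdf u)%:E.
Proof. by rewrite /ncdf fineK// fin_num_measure. Qed.

Lemma ncdf_ge0 u : 0 <= ncdf u.
Proof. exact: fine_ge0. Qed.

Lemma ncdf_le1 u : ncdf u <= 1.
Proof. by rewrite -lee_fin -PhiE probability_le1. Qed.

Lemma is_derive_ncdf u : is_derive u 1 ncdf (npdf u).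
Proof.
have [||||dF F'] := @continuous_FTC1 R npdf -oo%O u (u + 1).
- by rewrite ltrDl.
- apply: integrableS (integrable_normal_pdf 0 1) => //.
- by rewrite ltNyr.
- exact: continuous_npdf.
apply: DeriveDef; first exact: dF.
by rewrite -derive1E.
Qed.

Lemma ncdf_nondecreasing u v : u <= v -> ncdf u <= ncdf v.
Proof.
rewrite le_eqVlt => /predU1P[->//|uv].
have [c _ E] := mvt_is_derive uv is_derive_ncdf.
by rewrite -subr_ge0 E mulr_ge0 ?npdf_ge0// subr_ge0 ltW.
Qed.

Lemma ncdf_lipschitz u v : `|ncdf u - ncdf v| <= `|u - v|.
Proof.
have [c [_ _ _ ->]] := mvt_is_derive_between v u is_derive_ncdf.
by rewrite normrM ler_piMl// ger0_norm ?npdf_ge0// npdf_le1.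
Qed.

Lemma ncdf_survival u :
  (\int[mu]_(x in `[u, +oo[) (npdf x)%:E)%E = (1 - ncdf u)%:E.
Proof.
have mn (A : set R) : measurable_fun A (EFin \o npdf).
  by apply: measurable_funTS; apply/measurable_EFinP; exact: measurable_normal_pdf.
rewrite -integral_itv_obnd_cbnd//.
have -> : (\int[mu]_(x in `]u, +oo[) (npdf x)%:E)%E = normal_prob 0 1 (~` `]-oo, u]).
  by rewrite setCitvl.
transitivity (1 - Phi u)%E; last by rewrite PhiE.
by rewrite probability_setC.
Qed.

Lemma ncdfN u : ncdf (- u) = 1 - ncdf u.
Proof.
apply: EFin_inj; rewrite -ncdf_survival -PhiE /Phi /normal_prob.
rewrite ge0_integration_by_substitutionNy.
- by apply: eq_integral => x _ /=; rewrite -/(npdf _) npdfN.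
- by apply: continuous_subspaceT; exact: continuous_npdf.
- by move=> x _; exact: npdf_ge0.
Qed.

Lemma cvg_npdfy : npdf x @[x --> +oo] --> (0 : R).
Proof.
apply: (@squeeze_cvgr _ _ _ _ (fun=> 0) (fun x => 2 * x^-1)).
- near=> x.
  have x0 : 0 < x by near: x; exact: nbhs_pinfty_gt.
  rewrite npdf_ge0 /= ler_pdivlMr//.
  have := npdf_le_inv_sqr x; have := npdf_gt0 x => p0.
  have : 0 <= (x - 1) ^+ 2 by exact: sqr_ge0.
  by nra.
- exact: cvg_cst.
- rewrite -(mulr0 2); apply: cvgMr.
  apply/gtr0_cvgV0; first exact: nbhs_pinfty_gt.
  exact: cvg_id.
Unshelve. all: by end_near. Qed.

(* Mills' inequality: on [u, +oo[ the density is at most x / u times itself,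
   and x * npdf x is the derivative of - npdf. *)
Lemma mills u : 0 <= u -> u * (1 - ncdf u) <= npdf u.
Proof.
move=> u0; rewrite -lee_fin EFinM -ncdf_survival -ge0_integralZl//.
- have <- : (\int[mu]_(x in `[u, +oo[) (x * npdf x)%:E)%E = (npdf u)%:E.
    rewrite (@ge0_continuous_FTC2y R _ (fun x => - npdf x) u 0).
    + by rewrite -EFinB sub0r opprK.
    + by move=> x ux; rewrite mulr_ge0 ?npdf_ge0// (le_trans u0).
    + apply: continuous_subspaceT => x; apply: cvgM; first exact: cvg_id.
      exact: continuous_npdf.
    + by rewrite -oppr0; apply: cvgN; exact: cvg_npdfy.
    + by move=> x _; apply: derivableN; have [] := is_derive_npdf x.
    + apply: cvgN; apply: cvg_at_right_filter; exact: continuous_npdf.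
    + move=> x _; rewrite derive1E deriveN; last by have [] := is_derive_npdf x.
      by have [_ ->] := is_derive_npdf x; rewrite mulNr opprK.
  apply: ge0_le_integral => //.
  + by move=> x _; rewrite mule_ge0// lee_fin// npdf_ge0.
  + apply: measurable_funTS; apply: measurable_funeM.
    by apply/measurable_EFinP; exact: measurable_normal_pdf.
  + apply: measurable_funTS; apply/measurable_EFinP; apply: measurable_funM => //.
    exact: measurable_normal_pdf.
  + move=> x; rewrite /= in_itv/= andbT => ux.
    by rewrite -EFinM lee_fin ler_wpM2r ?npdf_ge0.
- apply: measurable_funTS; apply/measurable_EFinP; exact: measurable_normal_pdf.
- by move=> x _; rewrite lee_fin npdf_ge0.
Qed.

End standard_normal.

(** * Stein's equation *)

Section stein_equation.
Context {R : realType}.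
Implicit Types a b u v x : R.

(** The general solution of f'(u) = u f(u) + b. Stein's solution uses b = 1 - [ncdf x] on the left
    of [x] and b = - [ncdf x] on the right. *)
Let branch a b u := (a + b * ncdf u) / npdf u.

Let is_derive_branch a b u : is_derive u 1 (branch a b) (u * branch a b u + b).
Proof.
pose c : R := (normal_peak 1)^-1.
have p0 : normal_peak 1 != 0 :> R by rewrite gt_eqF// normal_peak_gt0// oner_neq0.
have invE w : (npdf w)^-1 = c * expR (w ^+ 2 / 2).
  by rewrite npdfE invfM expRN [X in _ * X]invrK.
rewrite (_ : branch a b = fun w => (a + b * ncdf w) * (c * expR (w ^+ 2 / 2)));
  last by apply/funext => w; rewrite /branch invE.
have dN := is_derive_ncdf u.
apply: is_derive_eq; rewrite /GRing.scale /= npdfE expRN /c.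
have e0 : expR (u ^+ 2 / 2) != 0 :> R by rewrite gt_eqF// expR_gt0.
by field; rewrite e0 p0.
Qed.

(** By Mills' inequality the derivative of the ratio is nonpositive, so its value at 0 dominates;
    that value is at most sqrt(2 pi) <= 3. *)
Let mills_ratio_le u : 0 <= u -> (1 - ncdf u) / npdf u <= 3.
Proof.
have M0 : (1 - ncdf 0) / npdf 0 <= 3 :> R.
  rewrite ler_pdivrMr ?npdf_gt0// npdfE expr0n /= mul0r oppr0 expR0 mulr1.
  by have := @normal_peak_ge R; have := ncdf_ge0 (0 : R); lra.
rewrite le_eqVlt => /predU1P[<-//|u0].
have dM (w : R) : is_derive w 1 (fun w => (1 - ncdf w) / npdf w)
    (w * ((1 - ncdf w) / npdf w) - 1).
  have -> : (fun w => (1 - ncdf w) / npdf w) = branch 1 (-1).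
    by apply/funext => z; rewrite /branch mulN1r.
  by have := is_derive_branch 1 (-1) w; rewrite /branch mulN1r.
have [c /andP[c0 _] E] := mvt_is_derive u0 dM.
apply: le_trans M0; rewrite -subr_le0 E subr0 pmulr_lle0//.
by rewrite subr_le0 mulrA ler_pdivrMr ?npdf_gt0// mul1r mills// ltW.
Qed.

(** The product is even in [u], which reduces everything to the Mills ratio on the positive
    half-line. It dominates [stein x] for every [x], and this is where uniformity in [x] comes
    from. *)
Let mills_product_bounds u :
  [/\ 0 <= ncdf u * (1 - ncdf u) / npdf u, ncdf u * (1 - ncdf u) / npdf u <= 3 &
    `|u| * (ncdf u * (1 - ncdf u) / npdf u) <= 1].
Proof.
wlog u0 : u / 0 <= u.
  move=> H; have [/H//|/ltW u0] := leP 0 u.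
  have := H (- u); rewrite oppr_ge0 => /(_ u0).
  by rewrite npdfN ncdfN normrN subKr (mulrC (1 - _)).
have [n0 n1 p0] := And3 (ncdf_ge0 u) (ncdf_le1 u) (npdf_gt0 u).
have Q0 : 0 <= (1 - ncdf u) / npdf u by rewrite divr_ge0 ?(ltW p0)// subr_ge0.
rewrite -mulrA; split; first exact: mulr_ge0.
  by apply: le_trans (mills_ratio_le u0); rewrite ler_piMl.
rewrite ger0_norm// mulrCA.
have uQ : u * ((1 - ncdf u) / npdf u) <= 1.
  by rewrite mulrA ler_pdivrMr// mul1r mills.
by apply: le_trans uQ; rewrite ler_piMl// mulr_ge0.
Qed.

(** The bounded solution of Stein's equation f'(u) = u f(u) + 1{u <= x} - [ncdf x]. *)
Definition stein (x u : R) : R :=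
  if u <= x then ncdf u * (1 - ncdf x) / npdf u
  else ncdf x * (1 - ncdf u) / npdf u.

Let stein_left x u : u <= x -> stein x u = branch 0 (1 - ncdf x) u.
Proof. by move=> ux; rewrite /stein ux /branch add0r (mulrC (ncdf u)). Qed.

Let stein_right x u : x <= u -> stein x u = branch (ncdf x) (- ncdf x) u.
Proof.
move=> xu; rewrite /stein /branch.
by case: leP => [ux|_]; [have -> : u = x by lra|]; congr (_ / _); ring.
Qed.

Let stein_le_product x u : 0 <= stein x u <= ncdf u * (1 - ncdf u) / npdf u.
Proof.
have [nu0 nu1 p0] := And3 (ncdf_ge0 u) (ncdf_le1 u) (npdf_gt0 u).
have [nx0 nx1] := conj (ncdf_ge0 x) (ncdf_le1 x).
rewrite /stein; case: (leP u x) => [ux|/ltW xu].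
  have := ncdf_nondecreasing ux => nux.
  rewrite divr_ge0 ?mulr_ge0 ?subr_ge0 ?(ltW p0)//=.
  by rewrite ler_pM2r ?invr_gt0// ler_wpM2l// lerB.
have := ncdf_nondecreasing xu => nux.
rewrite divr_ge0 ?mulr_ge0 ?subr_ge0 ?(ltW p0)//=.
by rewrite ler_pM2r ?invr_gt0// ler_wpM2r// subr_ge0.
Qed.

Lemma stein_ge0 x u : 0 <= stein x u.
Proof. by have /andP[] := stein_le_product x u. Qed.

Lemma stein_le3 x u : stein x u <= 3.
Proof.
have /andP[_ h] := stein_le_product x u.
by have [_ h3 _] := mills_product_bounds u; exact: le_trans h h3.
Qed.

Lemma norm_mul_stein x u : `|u| * stein x u <= 1.
Proof.
have /andP[_ h] := stein_le_product x u.
have [_ _ h1] := mills_product_bounds u; apply: le_trans h1.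
by rewrite ler_wpM2l.
Qed.

(** The bounds are assumed only between [u] and [v] because each branch blows up on the wrong side
    of [x]. The slope s f(s) + b is at most 2 in absolute value; splitting s f(s) - u f(u) as (s -
    u) f(s) + u (f(s) - f(u)) gives the factor 3 + 2|u|. *)
Let branch_taylor a b u v : `|b| <= 1 ->
  (forall s, Num.min u v <= s -> s <= Num.max u v ->
    `|branch a b s| <= 3 /\ `|s * branch a b s| <= 1) ->
  `|branch a b v - branch a b u| <= 2 * `|v - u| /\
  `|branch a b v - branch a b u - (v - u) * (u * branch a b u + b)|
    <= (3 + 2 * `|u|) * `|v - u| ^+ 2.
Proof.
move=> b1 hs.
have lip s : Num.min u v <= s -> s <= Num.max u v ->
    `|branch a b s - branch a b u| <= 2 * `|s - u|.
  move=> us sv; have [t [_ ut ts ->]] := mvt_is_derive_between u s (is_derive_branch a b).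
  rewrite normrM ler_wpM2r//.
  have [] := hs t.
  - apply: le_trans ut; rewrite le_min us andbT.
    by rewrite ge_min lexx.
  - apply: (le_trans ts); rewrite ge_max sv andbT.
    by rewrite le_max lexx.
  move=> _ h; apply: (le_trans (ler_normD _ _)); lra.
split; first by apply: lip; rewrite ?ge_min ?le_max lexx ?orbT.
have [s [su us sv ->]] := mvt_is_derive_between u v (is_derive_branch a b).
rewrite [X in `|X|](_ : _ =
  ((s - u) * branch a b s + u * (branch a b s - branch a b u)) * (v - u)); last by ring.
rewrite normrM expr2 mulrA ler_wpM2r//.
apply: (le_trans (ler_normD _ _)); rewrite (normrM (s - u)) (normrM u) mulrDl lerD//.
  rewrite mulrC; apply: ler_pM => //.
  by have [] := hs s us sv.
rewrite -mulrA mulrCA ler_wpM2l//.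
apply: (le_trans (lip s us sv)); lra.
Qed.

Let stein_lipschitz_taylor_left x u v : u <= x -> v <= x ->
  `|stein x v - stein x u| <= 2 * `|v - u| /\
  `|stein x v - stein x u - (v - u) * (u * stein x u + ((u <= x)%R%:R - ncdf x))|
    <= (3 + 2 * `|u|) * `|v - u| ^+ 2.
Proof.
move=> ux vx; rewrite ux !stein_left//; apply: branch_taylor.
  by have := ncdf_ge0 x; have := ncdf_le1 x; rewrite ler_norml; lra.
move=> s _ sm; have sx : s <= x by apply: (le_trans sm); rewrite ge_max ux.
rewrite -stein_left// normrM !(ger0_norm (stein_ge0 _ _)).
by rewrite stein_le3 norm_mul_stein.
Qed.

Let stein_lipschitz_taylor_right x u v : x < u -> x < v ->
  `|stein x v - stein x u| <= 2 * `|v - u| /\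
  `|stein x v - stein x u - (v - u) * (u * stein x u + ((u <= x)%R%:R - ncdf x))|
    <= (3 + 2 * `|u|) * `|v - u| ^+ 2.
Proof.
move=> xu xv; rewrite (leNgt u x) xu /= sub0r.
rewrite (stein_right (ltW xu)) (stein_right (ltW xv)); apply: branch_taylor.
  by have := ncdf_ge0 x; have := ncdf_le1 x; rewrite ler_norml; lra.
move=> s ms _; have sx : x <= s by apply: le_trans ms; rewrite le_min !ltW.
rewrite -stein_right// normrM !(ger0_norm (stein_ge0 _ _)).
by rewrite stein_le3 norm_mul_stein.
Qed.

Lemma stein_lipschitz x u v : `|stein x v - stein x u| <= 2 * `|v - u|.
Proof.
wlog uv : u v / u <= v.
  by move=> H; have [/H//|/ltW/H] := leP u v; rewrite distrC (distrC u).
have [vx|xv] := leP v x.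
  by have [] := stein_lipschitz_taylor_left (le_trans uv vx) vx.
have [ux|xu] := leP u x; last by have [] := stein_lipschitz_taylor_right xu xv.
(* The segment crosses [x]: the one-sided bounds add up exactly at [x], where the two branches
   agree. *)
have [l1 _] := stein_lipschitz_taylor_left ux (lexx x).
have l2 : `|stein x v - stein x x| <= 2 * `|v - x|.
  rewrite (stein_right (ltW xv)) (stein_right (lexx x)).
  have [//||//] := @branch_taylor (ncdf x) (- ncdf x) x v.
    by have := ncdf_ge0 x; have := ncdf_le1 x; rewrite ler_norml; lra.
  move=> s ms _; have sx : x <= s by apply: le_trans ms; rewrite le_min lexx ltW.
  rewrite -stein_right// normrM !(ger0_norm (stein_ge0 _ _)).
  by rewrite stein_le3 norm_mul_stein.
have -> : stein x v - stein x u = (stein x v - stein x x) + (stein x x - stein x u) by ring.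
apply: (le_trans (ler_normD _ _)); apply: (le_trans (lerD l2 l1)).
by rewrite !ger0_norm; lra.
Qed.

(* The derivative of [stein x] jumps at [x]: the second error term accounts
   for the increments that step over the jump. *)
Lemma stein_taylor x u v :
  `|stein x v - stein x u - (v - u) * (u * stein x u + ((u <= x)%R%:R - ncdf x))|
    <= (3 + 2 * `|u|) * `|v - u| ^+ 2 +
       4 * `|v - u| * (`|u - x| <= `|v - u|)%R%:R.
Proof.
have nn : 0 <= (3 + 2 * `|u|) * `|v - u| ^+ 2 by rewrite mulr_ge0 ?addr_ge0 ?mulr_ge0.
have nn2 : 0 <= 4 * `|v - u| * (`|u - x| <= `|v - u|)%R%:R by rewrite !mulr_ge0.
(* When the segment may reach the jump, first-order bounds are enough: 2 |v - u| for the increment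
   and 2 |v - u| for the linear term. *)
have crude : `|u - x| <= `|v - u| ->
  `|stein x v - stein x u - (v - u) * (u * stein x u + ((u <= x)%R%:R - ncdf x))|
    <= (3 + 2 * `|u|) * `|v - u| ^+ 2 +
       4 * `|v - u| * (`|u - x| <= `|v - u|)%R%:R.
  move=> ->; rewrite mulr1; apply: ler_wpDl => //.
  apply: (le_trans (ler_normB _ _)); rewrite normrM.
  have h1 := stein_lipschitz x u v.
  have h2 : `|u * stein x u + ((u <= x)%R%:R - ncdf x)| <= 2.
    apply: (le_trans (ler_normD _ _)).
    have := norm_mul_stein x u; rewrite normrM (ger0_norm (stein_ge0 _ _)) => h.
    have : `|(u <= x)%R%:R - ncdf x| <= 1.
      have := ncdf_ge0 x; have := ncdf_le1 x; rewrite ler_norml.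
      by case: (u <= x) => /=; lra.
    by lra.
  have : `|v - u| * `|u * stein x u + ((u <= x)%R%:R - ncdf x)| <= `|v - u| * 2.
    by rewrite ler_wpM2l.
  by lra.
have [ux|xu] := boolP (u <= x); have [vx|xv] := boolP (v <= x).
- have [_] := stein_lipschitz_taylor_left ux vx; rewrite ux => h.
  by apply: (le_trans h); rewrite lerDl.
- rewrite -[true]ux; apply: crude; rewrite -ltNge in xv.
  by rewrite ler0_norm ?ger0_norm; lra.
- rewrite -(negbTE xu); apply: crude; rewrite -ltNge in xu.
  by rewrite ger0_norm ?ler0_norm; lra.
- rewrite -!ltNge in xu xv.
  have [_] := stein_lipschitz_taylor_right xu xv; rewrite (leNgt u) xu => h.
  by apply: (le_trans h); rewrite lerDl.
Qed.

Lemma measurable_stein x : measurable_fun setT (stein x).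
Proof.
apply: continuous_measurable_fun => u; apply/cvgrPdist_lt => e e0.
near=> v.
rewrite distrC (le_lt_trans (stein_lipschitz x u v))//.
rewrite -ltr_pdivlMl// distrC; near: v.
by apply: cvgr_dist_lt; [exact: cvg_id|rewrite mulr_gt0].
Unshelve. all: by end_near. Qed.

End stein_equation.

(** * Truncated normalizer and clamped test functions *)

Section normalizer.
Context {R : realType}.
Implicit Types u v q s x : R.

(* [V^-1/2] with the denominator truncated below, which makes it bounded and Lipschitz. *)
Definition nrm (v : R) : R := (Num.sqrt (Num.max v 2^-1))^-1.

Let max_ge v : 2^-1 <= Num.max v 2^-1.
Proof. by rewrite le_max lexx orbT. Qed.

Let max_gt0 v : 0 < Num.max v 2^-1.
Proof. by apply: lt_le_trans (max_ge v). Qed.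

Lemma nrm_gt0 v : 0 < nrm v.
Proof. by rewrite invr_gt0 sqrtr_gt0. Qed.

Lemma nrm_ge0 v : 0 <= nrm v.
Proof. exact/ltW/nrm_gt0. Qed.

Lemma nrm_sqr v : nrm v ^+ 2 = (Num.max v 2^-1)^-1.
Proof. by rewrite exprVn sqr_sqrtr// ltW. Qed.

Lemma mul_nrm_sqr v : 2^-1 <= v -> v * nrm v ^+ 2 = 1.
Proof.
move=> v2; rewrite nrm_sqr max_l// divff// gt_eqF//.
by apply: lt_le_trans v2.
Qed.

Lemma mul_nrm_sqr_le1 v : 0 <= v -> 0 <= v * nrm v ^+ 2 <= 1.
Proof.
move=> v0; rewrite mulr_ge0 ?sqr_ge0//= nrm_sqr ler_pdivrMr// mul1r.
by rewrite le_max lexx.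
Qed.

Lemma nrm_sqr_le2 v : nrm v ^+ 2 <= 2.
Proof. by rewrite nrm_sqr -[leRHS]invrK lef_pV2 ?posrE ?invr_gt0. Qed.

Lemma nrm_le v : nrm v <= 3 / 2.
Proof.
rewrite -(@ler_pXn2r _ 2) ?nnegrE ?nrm_ge0//.
by apply: le_trans (nrm_sqr_le2 v) _; lra.
Qed.

Lemma nrm_ge_half v : v <= 2 -> 2^-1 <= nrm v.
Proof.
move=> v2; rewrite -(@ler_pXn2r _ 2) ?nnegrE ?nrm_ge0//.
rewrite nrm_sqr exprVn lef_pV2 ?posrE ?exprn_gt0//.
by rewrite (@ge_max _ R); apply/andP; split; lra.
Qed.

Lemma nrm_nonincreasing u v : u <= v -> nrm v <= nrm u.
Proof.
move=> uv; rewrite lef_pV2 ?posrE ?sqrtr_gt0// ler_sqrt ?(ltW (max_gt0 v))//.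
by rewrite (@ge_max _ R) !le_max uv lexx orbT.
Qed.

(** With m = max(v, 1/2), the squared ratio is at most (m + q) / m <= 1 + 2q <= (1 + q)^2. *)
Lemma nrm_shift v q : 0 <= q -> nrm v <= nrm (v + q) * (1 + q).
Proof.
move=> q0; rewrite -(@ler_pXn2r _ 2) ?nnegrE ?nrm_ge0 ?mulr_ge0 ?nrm_ge0//; last by lra.
rewrite exprMn !nrm_sqr mulrC ler_pdivlMr// mulrC ler_pdivrMr//.
have : Num.max (v + q) 2^-1 <= Num.max v 2^-1 + q.
  rewrite (@ge_max _ R) lerD2r le_max lexx /=.
  by apply: le_trans (max_ge v) _; rewrite lerDl.
have := max_ge v; move: (Num.max _ _) (Num.max _ _) => m m'.
by nra.
Qed.

Lemma nrm_lipschitz u v : `|nrm u - nrm v| <= 2 * `|u - v|.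
Proof.
wlog uv : u v / u <= v.
  by move=> H; have [/H//|/ltW/H] := leP u v; rewrite distrC (distrC v).
rewrite ger0_norm ?subr_ge0 ?nrm_nonincreasing// ler0_norm ?subr_le0//.
have q0 : 0 <= v - u by rewrite subr_ge0.
have := nrm_shift u q0; rewrite subrKC => h.
by have := nrm_le v; have := nrm_ge0 v; nra.
Qed.

Lemma continuous_nrm : continuous nrm.
Proof.
move=> u; apply/cvgrPdist_lt => e e0; near=> v.
rewrite (le_lt_trans (nrm_lipschitz u v))// -ltr_pdivlMl//; near: v.
by apply: cvgr_dist_lt; [exact: cvg_id|rewrite mulr_gt0].
Unshelve. all: by end_near. Qed.

Lemma measurable_nrm : measurable_fun setT nrm.
Proof. by apply: continuous_measurable_fun; exact: continuous_nrm. Qed.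

(* Adding one summand [s] to [w] and [s ^+ 2] to [v] moves [w * nrm v] by
   [O(s)], up to a relative error [O(s ^+ 2)]. *)
Lemma self_normalized_increment (s w v x : R) : `|s| <= 1 ->
  `|(s + w) * nrm (s ^+ 2 + v) - x| <= `|s * nrm (s ^+ 2 + v)| ->
  `|w * nrm v - x| <= 6 * `|s| + s ^+ 2 * `|x|.
Proof.
move=> s1 h.
have g0 := nrm_ge0 (s ^+ 2 + v); have g1 := nrm_le (s ^+ 2 + v).
set g := nrm (s ^+ 2 + v) in h g0 g1 *.
have sg : `|s * g| <= 3 / 2 * `|s|.
  by rewrite normrM mulrC (ger0_norm g0) ler_wpM2r.
have wg : `|w * g - x| <= 3 * `|s|.
  have -> : w * g - x = ((s + w) * g - x) - s * g by ring.
  by apply: (le_trans (ler_normB _ _)); lra.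
have gv : 0 <= nrm v - g <= g * s ^+ 2.
  rewrite subr_ge0 nrm_nonincreasing ?lerDr ?sqr_ge0//=.
  have := nrm_shift v (sqr_ge0 s); rewrite (addrC v) -/g; lra.
have wv : `|w * nrm v - w * g| <= `|w * g| * s ^+ 2.
  rewrite -mulrBr !normrM -mulrA ler_wpM2l// (ger0_norm g0).
  by case/andP: gv => gv0; rewrite (ger0_norm gv0).
have wgx : `|w * g| <= 3 * `|s| + `|x|.
  by rewrite -[w * g](subrK x) (le_trans (ler_normD _ _))// lerD2r.
have -> : w * nrm v - x = (w * nrm v - w * g) + (w * g - x) by ring.
apply: (le_trans (ler_normD _ _)).
have s2 : s ^+ 2 <= 1 by rewrite -real_normK ?num_real// expr_le1.
have : `|w * g| * s ^+ 2 <= (3 * `|s| + `|x|) * s ^+ 2 by rewrite ler_wpM2r ?sqr_ge0.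
have : `|s| * s ^+ 2 <= `|s| * 1 by rewrite ler_wpM2l.
by lra.
Qed.

End normalizer.

Section clamp.
Context {R : realType}.
Implicit Types (x H h u v s eta : R).

Definition clamp x H u : R := Num.max (x - H) (Num.min (x + H) u).

(* Centred so as to vanish at 0: this is what yields the factor
   [1 / (1 + |x|)] from second moments alone. *)
Definition clamp0 x H u : R := clamp x H u - clamp x H 0.

Let clampP x H u : 0 <= H ->
  [\/ u <= x - H /\ clamp x H u = x - H,
      x + H <= u /\ clamp x H u = x + H |
      x - H <= u <= x + H /\ clamp x H u = u].
Proof.
move=> H0; rewrite /clamp; case: (leP (x + H) u) => [xu|ux].
  by constructor 2; split => //; rewrite max_r//; lra.
case: (leP u (x - H)) => [ux'|xu]; first by constructor 1.
by constructor 3; rewrite !ltW.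
Qed.

Lemma clamp0_lipschitz x H u v : 0 <= H -> `|clamp0 x H u - clamp0 x H v| <= `|u - v|.
Proof.
move=> H0; rewrite /clamp0 opprB addrA subrK.
wlog uv : u v / u <= v.
  by move=> K; have [/K//|/ltW/K] := leP u v; rewrite distrC (distrC v).
rewrite [leRHS]ler0_norm ?subr_le0// ler_norml.
by case: (clampP x u H0) => [[? ->]|[? ->]|[/andP[? ?] ->]];
  case: (clampP x v H0) => [[? ->]|[? ->]|[/andP[? ?] ->]]; lra.
Qed.

Lemma norm_clamp0_le x H u : 0 <= H -> `|clamp0 x H u| <= `|u|.
Proof.
move=> H0; have := clamp0_lipschitz x u 0 H0.
by rewrite /clamp0 subrr !subr0.
Qed.

Lemma clamp0_mul_ge0 x H u s : 0 <= H -> 0 <= s * (clamp0 x H u - clamp0 x H (u - s)).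
Proof.
move=> H0; rewrite /clamp0 opprB addrA subrK.
have [s0|s0] := leP 0 s.
  apply: mulr_ge0 => //.
  by case: (clampP x u H0) => [[? ->]|[? ->]|[/andP[? ?] ->]];
    case: (clampP x (u - s) H0) => [[? ->]|[? ->]|[/andP[? ?] ->]]; lra.
apply: mulr_le0; first exact: ltW.
by case: (clampP x u H0) => [[? ->]|[? ->]|[/andP[? ?] ->]];
  case: (clampP x (u - s) H0) => [[? ->]|[? ->]|[/andP[? ?] ->]]; lra.
Qed.

(** Within [h] of [x] the clamp is the identity with a margin [eta] to spare, so a step [s] moves it
    by at least min(|s|, eta) in its own direction. This turns closeness to [x] into a lower bound
    on the terms of the Stein expansion. *)
Lemma clamp0_mul_ge x h eta u s : 0 <= h -> 0 <= eta -> `|u - x| <= h ->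
  `|s| * Num.min `|s| eta <=
  s * (clamp0 x (h + eta) u - clamp0 x (h + eta) (u - s)).
Proof.
move=> h0 e0; rewrite ler_norml => /andP[ux xu].
have H0 : 0 <= h + eta by lra.
rewrite /clamp0 opprB addrA subrK.
have cu : clamp x (h + eta) u = u.
  by case: (clampP x u H0) => [[? ->]|[? ->]|[/andP[? ?] ->]]; lra.
rewrite cu.
have [s0|s0] := leP 0 s.
  rewrite ger0_norm// ler_wpM2l//.
  by case: (clampP x (u - s) H0) => [[? ->]|[? ->]|[/andP[? ?] ->]];
    rewrite ge_min; apply/orP; (left; lra) || (right; lra).
rewrite (ltr0_norm s0) -[leRHS]mulrNN ler_wpM2l ?oppr_ge0 ?(ltW s0)//.
by case: (clampP x (u - s) H0) => [[? ->]|[? ->]|[/andP[? ?] ->]];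
  rewrite ge_min; apply/orP; (left; lra) || (right; lra).
Qed.

(** For large |x| the window stays away from 0, so the centred clamp vanishes unless |u| is
    comparable to 1 + |x|. Then |u| (1 + |x|) <= 8 u^2, and a second moment pays for the decay in
    [x]. *)
Lemma mul_clamp0_le x H u : 0 <= H -> 4 * H <= 1 + `|x| ->
  u * clamp0 x H u <= 16 * H * (1 + u ^+ 2) / (1 + `|x|).
Proof.
move=> H0 Hx; have x1 : 0 < 1 + `|x| by rewrite ltr_pwDl.
rewrite ler_pdivlMr//.
have c2 : `|clamp0 x H u| <= 2 * H.
  rewrite /clamp0 ler_norml.
  by case: (clampP x u H0) => [[? ->]|[? ->]|[/andP[? ?] ->]];
    case: (clampP x 0 H0) => [[? ->]|[? ->]|[/andP[? ?] ->]]; lra.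
have u2 : `|u| ^+ 2 = u ^+ 2 by rewrite real_normK ?num_real.
have uc : u * clamp0 x H u <= `|u| * (2 * H).
  by apply: (le_trans (ler_norm _)); rewrite normrM ler_wpM2l.
have nu0 := normr_ge0 u.
have [x2|x2] := leP `|x| 1.
  have : u * clamp0 x H u * (1 + `|x|) <= `|u| * (2 * H) * (1 + `|x|).
    by rewrite ler_pM2r.
  have : `|u| * (2 * H) * (1 + `|x|) <= `|u| * (2 * H) * 2.
    by rewrite ler_wpM2l ?mulr_ge0//; lra.
  have : 0 <= H * (`|u| - 1) ^+ 2 by rewrite mulr_ge0 ?sqr_ge0.
  have : 0 <= H * u ^+ 2 by rewrite mulr_ge0 ?sqr_ge0.
  by rewrite -u2; lra.
have [c0|c0] := eqVneq (clamp0 x H u) 0.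
  by rewrite c0 mulr0 mul0r !mulr_ge0// addr_ge0 ?sqr_ge0.
have ux : 1 + `|x| <= 8 * `|u|.
  move: c0; rewrite /clamp0; have [x0|x0] := leP 0 x.
    rewrite (ger0_norm x0) in x2 Hx *.
    case: (clampP x 0 H0) => [[? ->]|[? ->]|[/andP[? ?] ->]]; try lra.
    case: (clampP x u H0) => [[? ->]|[? ->]|[/andP[? ?] ->]].
    - by rewrite subrr eqxx.
    - by move=> _; rewrite ger0_norm; lra.
    - by move=> _; rewrite ger0_norm; lra.
  rewrite (ltr0_norm x0) in x2 Hx *.
  case: (clampP x 0 H0) => [[? ->]|[? ->]|[/andP[? ?] ->]]; try lra.
  case: (clampP x u H0) => [[? ->]|[? ->]|[/andP[? ?] ->]].
  - by move=> _; rewrite ler0_norm; lra.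
  - by rewrite subrr eqxx.
  - by move=> _; rewrite ler0_norm; lra.
have : u * clamp0 x H u * (1 + `|x|) <= `|u| * (2 * H) * (1 + `|x|).
  by rewrite ler_pM2r.
have : `|u| * (2 * H) * (1 + `|x|) <= `|u| * (2 * H) * (8 * `|u|).
  by rewrite ler_wpM2l ?mulr_ge0.
rewrite -u2; have : 0 <= H * `|u| ^+ 2 by rewrite mulr_ge0 ?sqr_ge0.
by lra.
Qed.

Lemma measurable_clamp0 x H : measurable_fun setT (clamp0 x H).
Proof.
apply: measurable_funB => //; apply: measurable_maxr => //.
exact: measurable_minr.
Qed.

End clamp.

(** * Berry-Esseen bound for self-normalized sums *)

Lemma measurable_sum_cond {R : realType} {d : measure_display}
  {T : measurableType d} (I : Type) (s : seq I) (p : pred I) (F : I -> T -> R) :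
  (forall i, p i -> measurable_fun setT (F i)) ->
  measurable_fun setT (fun w => \sum_(i <- s | p i) F i w).
Proof.
move=> mF.
have -> : (fun w => \sum_(i <- s | p i) F i w) =
    (fun w => \sum_(i <- s) (if p i then F i else cst 0) w).
  by apply/funext => w; rewrite big_mkcond; apply: eq_bigr => i _; case: (p i).
by apply: measurable_sum => i; case: ifPn => // /mF.
Qed.

Section self_normalized_sums.
Context {R : realType} {d : measure_display} {T : measurableType d} {N : nat}.
Variables (P : probability T R) (xi : 'I_N -> T -> R).
Hypothesis mxi : forall i, measurable_fun setT (xi i).
Hypothesis xi_le1 : forall i w, `|xi i w| <= 1.
Hypothesis indxi : mutually_independent P xi.
Implicit Types (J : {set 'I_N}) (i : 'I_N).

Local Notation bm := bounded_measurable.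
Local Notation Ex := (Ex P).

Definition lsum J w : R := \sum_(i in J) xi i w.
Definition qsum J w : R := \sum_(i in J) xi i w ^+ 2.
Definition tstat J w : R := lsum J w * nrm (qsum J w).

Lemma bm_xi i : bm (xi i).
Proof. by split => //; exists 1. Qed.

Lemma bm_lsum J : bm (lsum J).
Proof. by apply: bm_sum => i _; exact: bm_xi. Qed.

Lemma bm_qsum J : bm (qsum J).
Proof. by apply: bm_sum => i _; apply: bmX; exact: bm_xi. Qed.

Lemma bm_nrm (X : T -> R) : bm X -> bm (fun w => nrm (X w)).
Proof.
move=> [mX _]; apply: (@bm_le _ _ _ _ (fun=> 3 / 2)); last 2 first.
- exact: bm_cst.
- by move=> w; rewrite ger0_norm ?nrm_ge0// ger0_norm// nrm_le.
- by apply: measurableT_comp mX; exact: measurable_nrm.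
Qed.

Lemma bm_tstat J : bm (tstat J).
Proof. by apply: bmM; [exact: bm_lsum|apply: bm_nrm; exact: bm_qsum]. Qed.

Lemma bm_growth (f : R -> R) (X : T -> R) : measurable_fun setT f ->
  (forall u, `|f u| <= 3 + `|u|) -> bm X -> bm (fun w => f (X w)).
Proof.
move=> mf fu bX; apply: (@bm_le _ _ _ _ (fun w => 3 + `|X w|)).
- by apply: measurableT_comp mf _; exact: bm_measurable.
- by apply: bmD; [exact: bm_cst|exact: bm_norm].
- by move=> w; rewrite [leRHS]ger0_norm.
Qed.

Lemma independent_lsum_qsum i J : i \notin J ->
  independent_pair P (xi i) (fun w => (lsum J w, qsum J w)).
Proof.
move=> iJ.
pose F1 (t : N.-tuple R) := tnth t i.
pose F2 (t : N.-tuple R) :=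
  (\sum_(j in J) tnth t j, \sum_(j in J) tnth t j ^+ 2).
have mt (j : 'I_N) : measurable_fun setT (fun t : N.-tuple R => tnth t j).
  exact: measurable_tnth.
have := @independent_pair_masked _ _ _ _ _ _ P xi 0 mxi indxi _ _ _ _
  [set i]%SET J F1 F2.
have -> : F1 \o masked xi 0 [set i]%SET = xi i.
  by apply/funext => w; rewrite /F1 /= tnth_mktuple !inE eqxx.
have -> : F2 \o masked xi 0 J = (fun w => (lsum J w, qsum J w)).
  apply/funext => w; rewrite /F2 /=.
  by congr pair; apply: eq_bigr => j jJ; rewrite tnth_mktuple jJ.
apply.
- by move=> j; rewrite !inE => /eqP ->.
- exact: mt.
- apply: measurable_fun_pair.
    by apply: measurable_sum_cond => j _; exact: mt.
  by apply: measurable_sum_cond => j _; apply: measurable_funX; exact: mt.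
Qed.

Lemma Ex_prod i J (phi : R -> R) (psi : R * R -> R) : i \notin J ->
  measurable_fun setT phi -> measurable_fun setT psi ->
  bm (fun w => phi (xi i w)) -> bm (fun w => psi (lsum J w, qsum J w)) ->
  Ex (fun w => phi (xi i w) * psi (lsum J w, qsum J w)) =
  Ex (fun w => phi (xi i w)) * Ex (fun w => psi (lsum J w, qsum J w)).
Proof.
move=> iJ mphi mpsi bphi bpsi; apply: Ex_independentM => // A B mA mB.
apply: (independent_lsum_qsum iJ (A := phi @^-1` A) (B := psi @^-1` B)).
  by rewrite -[X in measurable X]setTI; exact: mphi.
by rewrite -[X in measurable X]setTI; exact: mpsi.
Qed.

Lemma Ex_pairwise i j (q : R -> R) : i != j -> measurable_fun setT q ->
  (forall k, bm (fun w => q (xi k w))) ->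
  Ex (fun w => q (xi i w) * q (xi j w)) =
  Ex (fun w => q (xi i w)) * Ex (fun w => q (xi j w)).
Proof.
move=> ij mq bq.
have W1 w : xi j w = lsum [set j]%SET w by rewrite /lsum big_set1.
have E : (fun w => q (xi j w)) =
    (fun w => (fun z : R * R => q z.1) (lsum [set j]%SET w, qsum [set j]%SET w)).
  by apply/funext => w; rewrite W1.
have := @Ex_prod i [set j]%SET q (fun z => q z.1).
rewrite -E; under eq_Ex do rewrite -W1.
apply => //; first by rewrite !inE.
exact: measurableT_comp.
Qed.

(** Independence kills the off-diagonal covariances, and a variance is at most the second moment. It
    is applied to the identity, to the square and to the capped weight of [weight_small]. *)
Lemma Ex_variance_le J (q : R -> R) : measurable_fun setT q ->
  (forall k, bm (fun w => q (xi k w))) ->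
  Ex (fun w => (\sum_(i in J) q (xi i w) - \sum_(i in J) Ex (fun w => q (xi i w))) ^+ 2)
  <= \sum_(i in J) Ex (fun w => q (xi i w) ^+ 2).
Proof.
move=> mq bq.
pose m i := Ex (fun w => q (xi i w)).
pose a i w := q (xi i w) - m i.
have ba i : bm (a i) by apply: bmB; [exact: bq|exact: bm_cst].
have Ea i : Ex (a i) = 0.
  rewrite /a ExB; [|exact: bq|exact: bm_cst].
  by rewrite (Ex_cst P (m i)) subrr.
have Eaa i j : i != j -> Ex (fun w => a i w * a j w) = 0.
  move=> ij; transitivity (Ex (fun w => q (xi i w) * q (xi j w)
      - (m i * q (xi j w) + (m j * q (xi i w) - m i * m j)))).
    by apply: eq_Ex => w; rewrite /a; ring.
  have b1 k l : bm (fun w => m k * q (xi l w)) by apply: bmM; [exact: bm_cst|exact: bq].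
  have b2 : bm (fun w => m j * q (xi i w) - m i * m j) by apply: bmB => //; exact: bm_cst.
  rewrite ExB; [|exact: bmM|exact: bmD].
  rewrite (ExD P (b1 i j) b2) (ExB P (b1 j i) (bm_cst _)).
  rewrite Ex_pairwise// (Ex_cst P (m i * m j)) !ExZ// -/(m i) -/(m j); ring.
have Eaq i : Ex (fun w => a i w ^+ 2) <= Ex (fun w => q (xi i w) ^+ 2).
  have -> : Ex (fun w => a i w ^+ 2) = Ex (fun w => q (xi i w) ^+ 2) - m i ^+ 2.
    transitivity (Ex (fun w => q (xi i w) ^+ 2 - (2 * m i * q (xi i w) - m i ^+ 2))).
      by apply: eq_Ex => w; rewrite /a; ring.
    have b1 : bm (fun w => 2 * m i * q (xi i w)) by apply: bmM; [exact: bm_cst|exact: bq].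
    rewrite ExB; [|exact: bmX|by apply: bmB => //; exact: bm_cst].
    rewrite ExB//; last exact: bm_cst.
    by rewrite (Ex_cst P (m i ^+ 2)) ExZ// -/(m i); ring.
  by rewrite gerDl oppr_le0 sqr_ge0.
apply: (@le_trans _ _ (\sum_(i in J) Ex (fun w => a i w ^+ 2))); last exact: ler_sum.
rewrite le_eqVlt; apply/orP; left; apply/eqP.
transitivity (Ex (fun w => \sum_(i in J) \sum_(j in J) a i w * a j w)).
  apply: eq_Ex => w; rewrite -sumrB expr2 mulr_suml.
  by apply: eq_bigr => i _; rewrite mulr_sumr.
rewrite Ex_sum; last by move=> i _; apply: bm_sum => j _; exact: bmM.
apply: eq_bigr => i iJ; rewrite Ex_sum; last by move=> j _; exact: bmM.
rewrite (bigD1 i)//= big1 ?addr0; first by apply: eq_Ex => w; rewrite expr2.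
by move=> j /andP[_ ji]; rewrite Eaa// eq_sym.
Qed.

(** Truncation spoils centring and normalization, hence a bound on the means and an inequality for
    the variance. Only upper bounds occur, so the property passes to subsets of [J]; lower bounds on
    the variance are stated separately. *)
Definition moment_bounds J (B : R) : Prop :=
  [/\ 0 <= B <= 1,
      \sum_(i in J) Ex (fun w => `|xi i w| ^+ 3) <= B,
      \sum_(i in J) `|Ex (xi i)| <= B &
      \sum_(i in J) Ex (fun w => xi i w ^+ 2) <= 1].

Lemma moment_boundsS J J' B : J' \subset J -> moment_bounds J B -> moment_bounds J' B.
Proof.
move=> JJ [B01 h3 h1 h2].
have sub (F : 'I_N -> R) : (forall i, 0 <= F i) ->
    \sum_(i in J') F i <= \sum_(i in J) F i.
  move=> F0; rewrite [leRHS](big_setID J')/= (finset.setIidPr JJ) lerDl.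
  by apply: sumr_ge0.
split => //.
- by apply: le_trans h3; apply: sub => i; apply: Ex_ge0.
- by apply: le_trans h1; apply: sub.
- by apply: le_trans h2; apply: sub => i; apply: Ex_ge0 => w; exact: sqr_ge0.
Qed.

Let bm1 c : bm (fun _ : T => c : R). Proof. exact: bm_cst. Qed.

Lemma Ex_lsum_sqr J B : moment_bounds J B -> Ex (fun w => lsum J w ^+ 2) <= 4.
Proof.
move=> [/andP[B0 B1] _ h1 h2].
pose m := \sum_(i in J) Ex (xi i).
have m1 : `|m| <= 1 by apply: le_trans B1; apply: le_trans h1; exact: ler_norm_sum.
have V := @Ex_variance_le J id (@measurable_id _ _ _) bm_xi.
have bW := bm_lsum J.
have bm2 : bm (fun w => (lsum J w - m) ^+ 2) by apply: bmX; exact: bmB.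
apply: (@le_trans _ _ (Ex (fun w => 2 * (lsum J w - m) ^+ 2 + 2 * m ^+ 2))).
  apply: le_Ex; [exact: bmX|by apply: bmD => //; exact: bmM|move=> w].
  have : 0 <= (lsum J w - 2 * m) ^+ 2 by exact: sqr_ge0.
  by lra.
rewrite ExD//; last exact: bmM.
rewrite ExZ// Ex_cst.
have m2 : m ^+ 2 <= 1 by rewrite -real_normK ?num_real// expr_le1.
have : Ex (fun w => (lsum J w - m) ^+ 2) <= 1 by exact: le_trans h2.
by lra.
Qed.

Lemma Ex_norm_lsum J B : moment_bounds J B -> Ex (fun w => `|lsum J w|) <= 3.
Proof.
move=> mb; have W2 := Ex_lsum_sqr mb; have bW := bm_lsum J.
have b2 : bm (fun w => lsum J w ^+ 2) by exact: bmX.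
apply: (@le_trans _ _ (Ex (fun w => 2^-1 * (1 + lsum J w ^+ 2)))).
  apply: le_Ex; [exact: bm_norm|by apply: bmM => //; exact: bmD|move=> w].
  have : 0 <= (`|lsum J w| - 1) ^+ 2 by exact: sqr_ge0.
  by rewrite -[in X in _ -> X](real_normK (num_real (lsum J w))); lra.
rewrite ExZ; last exact: bmD.
by rewrite ExD// Ex_cst; lra.
Qed.

Lemma xi_pow_le i w (k l : nat) : (k <= l)%N -> `|xi i w| ^+ l <= `|xi i w| ^+ k.
Proof. by move=> kl; rewrite ler_wiXn2l. Qed.

Lemma xi_sqr i w : xi i w ^+ 2 = `|xi i w| ^+ 2.
Proof. by rewrite real_normK ?num_real. Qed.

Lemma qsum_variance J B : moment_bounds J B ->
  Ex (fun w => (qsum J w - \sum_(i in J) Ex (fun w => xi i w ^+ 2)) ^+ 2) <= B.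
Proof.
move=> [_ h3 _ _].
have V := @Ex_variance_le J (fun x => x ^+ 2) (exprn_measurable _)
  (fun k => bmX 2 (bm_xi k)).
apply: le_trans h3; apply: (le_trans V).
apply: ler_sum => i _; apply: le_Ex.
- by do 2 apply: bmX; exact: bm_xi.
- by apply: bmX; apply: bm_norm; exact: bm_xi.
- by move=> w; rewrite xi_sqr -exprM; exact: xi_pow_le.
Qed.

Lemma bm_ltb (X Y : T -> R) : bm X -> bm Y -> bm (fun w => (X w < Y w)%R%:R : R).
Proof.
by move=> [mX _] [mY _]; apply: bm_bool; exact: measurable_fun_ltr.
Qed.

Lemma bm_leb (X Y : T -> R) : bm X -> bm Y -> bm (fun w => (X w <= Y w)%R%:R : R).
Proof.
by move=> [mX _] [mY _]; apply: bm_bool; exact: measurable_fun_ler.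
Qed.

Lemma qsum_large J B : moment_bounds J B -> Ex (fun w => (2 < qsum J w)%R%:R) <= B.
Proof.
move=> mb; have [_ _ _ h2] := mb; apply: le_trans (qsum_variance mb).
set m := \sum_(i in J) _ in h2 *; have bV := bm_qsum J.
apply: le_Ex; [exact: bm_ltb|by apply: bmX; exact: bmB|move=> w].
case: ltP => /= h; last exact: sqr_ge0.
have -> : 1 = 1 ^+ 2 :> R by rewrite expr1n.
by rewrite ler_pXn2r ?nnegrE//; lra.
Qed.

(** Chebyshev's inequality. The variance of [qsum] is at most [B], as fourth moments are below third
    ones when |xi i| <= 1, and the gap 3/4 - 1/2 costs the factor 16. *)
Lemma qsum_small J B : moment_bounds J B ->
  3 / 4 <= \sum_(i in J) Ex (fun w => xi i w ^+ 2) ->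
  Ex (fun w => (qsum J w < 2^-1)%R%:R) <= 16 * B.
Proof.
move=> mb h34; have := qsum_variance mb.
set m := \sum_(i in J) _ in h34 *; move=> V; have bV := bm_qsum J.
have b2 : bm (fun w => (qsum J w - m) ^+ 2) by apply: bmX; exact: bmB.
apply: (@le_trans _ _ (Ex (fun w => 16 * (qsum J w - m) ^+ 2))); last first.
  by rewrite ExZ// ler_wpM2l.
apply: le_Ex; [exact: bm_ltb|exact: bmM|move=> w].
case: ltP => /= h; last by rewrite mulr_ge0 ?sqr_ge0.
have : (4^-1) ^+ 2 <= (m - qsum J w) ^+ 2 by rewrite ler_pXn2r ?nnegrE//; lra.
by lra.
Qed.

(** * Stein's expansion, one summand at a time *)

Implicit Types (f : R -> R) (B x : R).

Lemma lsumD1 J i w : i \in J -> lsum J w = xi i w + lsum (J :\ i)%SET w.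
Proof. by move=> iJ; rewrite /lsum (big_setD1 i). Qed.

Lemma qsumD1 J i w : i \in J -> qsum J w = xi i w ^+ 2 + qsum (J :\ i)%SET w.
Proof. by move=> iJ; rewrite /qsum (big_setD1 i). Qed.

Lemma qsum_ge0 J w : 0 <= qsum J w.
Proof. by apply: sumr_ge0 => i _; exact: sqr_ge0. Qed.

Lemma moment_boundsD1 J i B : moment_bounds J B -> moment_bounds (J :\ i)%SET B.
Proof. by apply: moment_boundsS; exact: finset.subsetDl. Qed.

Lemma Ex_cube_lsum J i B (a b : R) : moment_bounds J B -> 0 <= b -> i \notin J ->
  Ex (fun w => `|xi i w| ^+ 3 * (a + b * `|lsum J w|)) <=
  (a + 3 * b) * Ex (fun w => `|xi i w| ^+ 3).
Proof.
move=> mb b0 iJ; have bW := bm_norm (bm_lsum J); have bx := bm_norm (bm_xi i).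
have bbW : bm (fun w => b * `|lsum J w|) by exact: bmM.
rewrite (@Ex_prod i J (fun y => `|y| ^+ 3) (fun z => a + b * `|z.1|))//; last 4 first.
- by apply: measurable_funX; exact: normr_measurable.
- apply: measurable_funD => //; apply: measurable_funM => //.
  by apply: measurableT_comp => //; exact: normr_measurable.
- exact: bmX.
- exact: bmD.
rewrite mulrC ler_wpM2r//; first by apply: Ex_ge0.
rewrite ExD// Ex_cst ExZ// lerD2l mulrC ler_wpM2r//.
exact: Ex_norm_lsum mb.
Qed.

(** Only the numerator loses the summand [i]; the normalizer remains that of all of [J]. To first
    order this gives [xi i ^+ 2 * nrm (qsum J w) ^+ 2], whose sum over [J] is 1 as soon as [qsum]
    reaches 1/2. *)
Let step f J i w : R :=
  xi i w * nrm (qsum J w) * (f (tstat J w) - f (tstat J w - xi i w * nrm (qsum J w))).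

Let bm_step f J i : measurable_fun setT f -> (forall u, `|f u| <= 3 + `|u|) ->
  bm (step f J i).
Proof.
move=> mf fu; have bx := bm_xi i; have bT := bm_tstat J.
have bg := bm_nrm (bm_qsum J).
apply: bmM; first exact: bmM.
by apply: bmB; apply: bm_growth => //; apply: bmB => //; exact: bmM.
Qed.

Lemma tstatB J i w : i \in J ->
  tstat J w - xi i w * nrm (qsum J w) = lsum (J :\ i)%SET w * nrm (qsum J w).
Proof. by move=> iJ; rewrite /tstat (lsumD1 _ iJ) mulrDl addrC addKr. Qed.

(** Once the steps are subtracted, each summand multiplies a function that is almost independent of
    it. Exact independence would leave a multiple of the mean of [xi i]; the defect is of third
    order. *)
Lemma stein_identity J B f : moment_bounds J B -> measurable_fun setT f ->
  (forall u, `|f u| <= 3 + `|u|) -> (forall u v, `|f u - f v| <= 2 * `|u - v|) ->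
  `|Ex (fun w => tstat J w * f (tstat J w)) - \sum_(i in J) Ex (step f J i)| <= 45 * B.
Proof.
move=> mb mf fu fl; have [/andP[B0 B1] h3 h1 h2] := mb.
have bg := bm_nrm (bm_qsum J); have bT := bm_tstat J.
(* Apart from the leading factor, the remainder sees [xi i] only through its square inside the
   normalizer. *)
pose r i w := xi i w * (nrm (qsum J w) * f (lsum (J :\ i)%SET w * nrm (qsum J w))).
have br i : bm (r i).
  apply: bmM; first exact: bm_xi.
  by apply: bmM => //; apply: bm_growth => //; apply: bmM => //; exact: bm_lsum.
have -> : Ex (fun w => tstat J w * f (tstat J w)) - \sum_(i in J) Ex (step f J i) =
    \sum_(i in J) Ex (r i).
  rewrite -Ex_sum; last by move=> i _; exact: bm_step.
  rewrite -Ex_sum; last by move=> i _; exact: br.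
  rewrite -ExB; last 2 first.
  - by apply: bmM => //; exact: bm_growth.
  - by apply: bm_sum => i _; exact: bm_step.
  apply: eq_Ex => w; rewrite {1}/tstat /lsum !mulr_suml -sumrB.
  apply: eq_bigr => i iJ; rewrite /step /r -(tstatB w iJ); ring.
have bound i : i \in J ->
    `|Ex (r i)| <= 12 * `|Ex (xi i)| + 33 * Ex (fun w => `|xi i w| ^+ 3).
  move=> iJ; pose J' := (J :\ i)%SET.
  have iJ' : i \notin J' by rewrite !inE eqxx.
  have mb' : moment_bounds J' B by exact: moment_boundsD1.
  have bW' := bm_lsum J'; have bg' := bm_nrm (bm_qsum J'); have bT' := bm_tstat J'.
  have bx := bm_xi i.
  pose psi (z : R * R) := nrm z.2 * f (z.1 * nrm z.2).
  have mpsi : measurable_fun setT psi.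
    have mn : measurable_fun setT (fun z : R * R => nrm z.2).
      by apply: measurableT_comp => //; exact: measurable_nrm.
    apply: measurable_funM => //; apply: measurableT_comp => //.
    exact: measurable_funM.
  (* The same remainder with the normalizer of the other summands: here the expectation factorizes.
     Exchanging the normalizers costs O(xi i ^+ 2) by [nrm_lipschitz], hence a third moment in
     all. *)
  pose r' w := xi i w * psi (lsum J' w, qsum J' w).
  have bpsi : bm (fun w => psi (lsum J' w, qsum J' w)).
    by apply: bmM => //; exact: bm_growth.
  have br' : bm r' by exact: bmM.
  have E1 : `|Ex r'| <= 12 * `|Ex (xi i)|.
    rewrite /r' (@Ex_prod i J' id psi)// normrM mulrC ler_wpM2r//.
    apply: (le_trans (le_norm_Ex P bpsi)).
    apply: (@le_trans _ _ (Ex (fun w => 9 / 2 + 9 / 4 * `|lsum J' w|))).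
      apply: le_Ex; first exact: bm_norm.
        by apply: bmD; [exact: bm_cst|apply: bmM; [exact: bm_cst|exact: bm_norm]].
      move=> w; rewrite /psi normrM (ger0_norm (nrm_ge0 _)).
      have g0 := nrm_ge0 (qsum J' w); have g1 := nrm_le (qsum J' w).
      have := fu (lsum J' w * nrm (qsum J' w)); rewrite normrM (ger0_norm g0) => h.
      have := normr_ge0 (lsum J' w).
      move: h; set F := `|f _|; set g := nrm _ in g0 g1 *; set a := `|lsum _ _| => h a0.
      have : g * F <= g * (3 + a * g) by rewrite ler_wpM2l.
      have : g * g <= 9 / 4 by nra.
      by nra.
    rewrite ExD; [|exact: bm_cst|by apply: bmM; [exact: bm_cst|exact: bm_norm]].
    rewrite Ex_cst ExZ; last exact: bm_norm.
    by have := Ex_norm_lsum mb'; lra.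
  have E2 : `|Ex (r i) - Ex r'| <= 33 * Ex (fun w => `|xi i w| ^+ 3).
    rewrite -ExB//; apply: (le_trans (le_norm_Ex P (bmB (br i) br'))).
    apply: (@le_trans _ _ (Ex (fun w => `|xi i w| ^+ 3 * (6 + 9 * `|lsum J' w|)))); last first.
      by apply: (le_trans (Ex_cube_lsum _ mb' _ iJ')) => //; lra.
    apply: le_Ex.
    - by apply: bm_norm; exact: bmB.
    - apply: bmM; first by apply: bmX; exact: bm_norm.
      by apply: bmD; [exact: bm_cst|apply: bmM; [exact: bm_cst|exact: bm_norm]].
    move=> w; rewrite /r /r' /psi /= -mulrBr normrM exprS -mulrA ler_wpM2l//.
    have := nrm_lipschitz (qsum J w) (qsum J' w).
    rewrite (qsumD1 w iJ) -/J' addrK normrX.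
    have g0 := nrm_ge0 (qsum J' w); have g1 := nrm_le (qsum J' w).
    have G0 := nrm_ge0 (xi i w ^+ 2 + qsum J' w); have G1 := nrm_le (xi i w ^+ 2 + qsum J' w).
    set g := nrm (qsum J' w) in g0 g1 *; set G := nrm (_ + _) in G0 G1 *.
    set a := lsum J' w; set s := `|xi i w| ^+ 2 => gG.
    have -> : G * f (a * G) - g * f (a * g) =
        (G - g) * f (a * G) + g * (f (a * G) - f (a * g)) by ring.
    apply: (le_trans (ler_normD _ _)); rewrite !normrM (ger0_norm g0).
    have a0 := normr_ge0 a; have s0 : 0 <= s by exact: exprn_ge0.
    have hF : `|f (a * G)| <= 3 + 3 / 2 * `|a|.
      apply: (le_trans (fu _)); rewrite normrM (ger0_norm G0); nra.
    have hL : `|f (a * G) - f (a * g)| <= 2 * (`|a| * (2 * s)).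
      apply: (le_trans (fl _ _)); rewrite -mulrBr normrM ler_wpM2l// ler_wpM2l//.
    have : `|G - g| * `|f (a * G)| <= (2 * s) * (3 + 3 / 2 * `|a|) by rewrite ler_pM.
    have : g * `|f (a * G) - f (a * g)| <= 3 / 2 * (2 * (`|a| * (2 * s))) by rewrite ler_pM.
    by lra.
  rewrite -(subrK (Ex r') (Ex (r i))) addrC.
  by apply: (le_trans (ler_normD _ _)); exact: lerD.
apply: (le_trans (ler_norm_sum _ _ _)); apply: (le_trans (ler_sum _ bound)).
rewrite big_split/= -!mulr_sumr; lra.
Qed.

(** * Concentration of the self-normalized sum *)

Let bm_weight i B : bm (fun w => `|xi i w| * Num.min `|xi i w| B).
Proof.
have bx := bm_norm (bm_xi i); apply: bmM => //.
have [mx _] := bx; apply: (bm_le (Y := fun w => `|xi i w| + `|B|)).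
- exact: measurable_minr.
- exact: bmD.
- move=> w; rewrite [leRHS]ger0_norm ?addr_ge0//.
  by case: (leP `|xi i w| B) => _; rewrite ?normr_id ?lerDl ?lerDr.
Qed.

(** From min(y, B) >= y - y^2 / (4 B) the expected total weight is at least 3/4 - 1/4 = 1/2. Squared
    weights are below third powers, so the variance is at most [B], and Chebyshev with gap 1/4 gives
    16. *)
Lemma weight_small J B : moment_bounds J B -> 0 < B ->
  3 / 4 <= \sum_(i in J) Ex (fun w => xi i w ^+ 2) ->
  Ex (fun w => (\sum_(i in J) `|xi i w| * Num.min `|xi i w| B < 4^-1)%R%:R) <= 16 * B.
Proof.
move=> mb B0 h34; have [_ h3 _ _] := mb.
pose q (y : R) : R := `|y| * Num.min `|y| B.
have mq : measurable_fun setT q.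
  apply: measurable_funM; first exact: normr_measurable.
  by apply: measurable_minr => //; exact: normr_measurable.
have V := @Ex_variance_le J q mq (fun k => bm_weight k B).
have q_ge i w : xi i w ^+ 2 - (4 * B)^-1 * `|xi i w| ^+ 3 <= q (xi i w).
  rewrite xi_sqr /q; have := normr_ge0 (xi i w); move: `|xi i w| => y y0.
  have e : (4 * B)^-1 * y ^+ 3 = y * (y ^+ 2 / (4 * B)) by rewrite exprS; ring.
  rewrite e expr2 -mulrBr ler_wpM2l// le_min; apply/andP; split.
    by rewrite gerDl oppr_le0 divr_ge0 ?sqr_ge0// mulr_ge0// ltW.
  rewrite lerBlDr -lerBlDl ler_pdivlMr ?mulr_gt0//.
  by have := sqr_ge0 (y - 2 * B); lra.
have q_sqr i w : q (xi i w) ^+ 2 <= `|xi i w| ^+ 3.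
  rewrite /q; have := xi_le1 i w; have := normr_ge0 (xi i w).
  move: `|xi i w| => y y0 y1.
  have m0 : 0 <= Num.min y B by rewrite le_min y0 ltW.
  have m1 : Num.min y B <= y by rewrite ge_min lexx.
  have : Num.min y B ^+ 2 <= y ^+ 2 by rewrite ler_pXn2r.
  rewrite exprMn => h; apply: (@le_trans _ _ (y ^+ 2 * y ^+ 2)).
    by rewrite ler_wpM2l ?sqr_ge0.
  by rewrite -exprD ler_wiXn2l.
set m := \sum_(i in J) _ in V.
have m2 : 2^-1 <= m.
  apply: (@le_trans _ _ (\sum_(i in J) (Ex (fun w => xi i w ^+ 2) -
      (4 * B)^-1 * Ex (fun w => `|xi i w| ^+ 3)))).
    rewrite sumrB -mulr_sumr.
    have : (4 * B)^-1 * (\sum_(i in J) Ex (fun w => `|xi i w| ^+ 3)) <= (4 * B)^-1 * B.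
      by rewrite ler_wpM2l// invr_ge0 mulr_ge0// ltW.
    have -> : (4 * B)^-1 * B = 4^-1 by field; rewrite gt_eqF.
    by lra.
  apply: ler_sum => i _.
  have b3 : bm (fun w => `|xi i w| ^+ 3) by apply/bmX/bm_norm/bm_xi.
  have b2 : bm (fun w => xi i w ^+ 2) by apply: bmX; exact: bm_xi.
  rewrite -ExZ// -ExB//; last exact: bmM.
  apply: le_Ex; [by apply: bmB => //; exact: bmM|exact: bm_weight|exact: q_ge].
have bQ : bm (fun w => \sum_(i in J) q (xi i w)) by apply: bm_sum => i _; exact: bm_weight.
have b2 : bm (fun w => (\sum_(i in J) q (xi i w) - m) ^+ 2) by apply: bmX; exact: bmB.
apply: (@le_trans _ _ (Ex (fun w => 16 * (\sum_(i in J) q (xi i w) - m) ^+ 2))).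
  apply: le_Ex; [exact: bm_ltb|exact: bmM|move=> w].
  case: ltP => /= h; last by rewrite mulr_ge0 ?sqr_ge0.
  have : (4^-1) ^+ 2 <= (m - \sum_(i in J) q (xi i w)) ^+ 2.
    by rewrite ler_pXn2r ?nnegrE//; rewrite /q; lra.
  by lra.
rewrite ExZ// ler_wpM2l//; apply: (le_trans V); apply: le_trans h3.
apply: ler_sum => i _; apply: le_Ex => //.
  by apply: bmX; exact: bm_weight.
by apply/bmX/bm_norm/bm_xi.
Qed.

Lemma tstat_sqr_le J w : tstat J w ^+ 2 <= 2 * lsum J w ^+ 2.
Proof.
by rewrite /tstat exprMn mulrC ler_wpM2r ?sqr_ge0// nrm_sqr_le2.
Qed.

(** [qsum <= 2] makes the normalizer at least 1/2, so each step is at least a quarter of its weight;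
    a total weight of 1/4 then gives 1/16. *)
Lemma step_clamp0_ge J B x h w : 0 <= h -> 0 <= B -> `|tstat J w - x| <= h ->
  qsum J w <= 2 -> 4^-1 <= \sum_(i in J) `|xi i w| * Num.min `|xi i w| B ->
  1 <= 16 * \sum_(i in J) step (clamp0 x (h + B)) J i w.
Proof.
move=> h0 B0 Tx V2 Q4; have g2 := nrm_ge_half V2.
have H : \sum_(i in J) 4^-1 * (`|xi i w| * Num.min `|xi i w| B) <=
    \sum_(i in J) step (clamp0 x (h + B)) J i w.
  apply: ler_sum => i _.
  apply: le_trans (clamp0_mul_ge (xi i w * nrm (qsum J w)) h0 B0 Tx).
  rewrite normrM (ger0_norm (nrm_ge0 _)).
  have := normr_ge0 (xi i w); move: `|xi i w| (nrm _) g2 => y g g2 y0.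
  have m0 : 0 <= Num.min y B by rewrite le_min y0.
  have : Num.min y B <= 2 * Num.min (y * g) B.
    rewrite -ler_pdivrMl// le_min !ler_pdivrMl//; apply/andP; split.
      by rewrite ge_min; apply/orP; left; nra.
    by rewrite ge_min; apply/orP; right; lra.
  move=> mm; have : y * 2^-1 * Num.min y B <= y * g * (2 * Num.min (y * g) B).
    by apply: ler_pM => //; rewrite ?mulr_ge0 ?ler_wpM2l.
  by lra.
by rewrite -mulr_sumr in H; lra.
Qed.

(** Stein's expansion tested on the centred clamp of half-width h + B. The steps are nonnegative and
    add up to at least 1/16 near [x], outside two events of total probability at most 17 B. Their
    expectation is at most 144 (h + B) / (1 + |x|) + 45 B by [mul_clamp0_le], and 16 (144 + 45) + 17
    is below 4000. *)
Lemma concentration J B x h : moment_bounds J B -> 0 < B ->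
  3 / 4 <= \sum_(i in J) Ex (fun w => xi i w ^+ 2) -> 0 <= h ->
  Ex (fun w => (`|tstat J w - x| <= h)%R%:R) <= 40 * 100 * (h / (1 + `|x|) + B).
Proof.
move=> mb B0 h34 h0; have [/andP[_ B1] h3 h1 h2] := mb.
have x1 : 1 <= 1 + `|x| by rewrite lerDl.
have xx : 0 < 1 + `|x| by rewrite ltr_pwDl.
have bT := bm_tstat J; have bV := bm_qsum J.
have bTx : bm (fun w => `|tstat J w - x|) by apply: bm_norm; exact: bmB.
have bI : bm (fun w => (`|tstat J w - x| <= h)%R%:R : R) by exact: bm_leb.
(* In this range the right-hand side already exceeds 1; beyond it [mul_clamp0_le] applies. *)
have [Hx|Hx] := leP (1 + `|x|) (4 * (h + B)).
  apply: (@le_trans _ _ 1).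
    rewrite -[leRHS](Ex_cst P 1); apply: le_Ex => // w.
    by case: (`|tstat J w - x| <= h).
  have : B / (1 + `|x|) <= B by rewrite ler_pdivrMr// ler_peMr// ltW.
  have : 4^-1 <= (h + B) / (1 + `|x|) by rewrite ler_pdivlMr//; lra.
  by rewrite mulrDl; lra.
pose f := clamp0 x (h + B).
have H0 : 0 <= h + B by lra.
have mf : measurable_fun setT f by exact: measurable_clamp0.
have f_le u : `|f u| <= `|u| by exact: norm_clamp0_le.
have fu u : `|f u| <= 3 + `|u| by have := f_le u; lra.
have fl u v : `|f u - f v| <= 2 * `|u - v|.
  by have := clamp0_lipschitz x u v H0; have := normr_ge0 (u - v); rewrite -/f; lra.
have id := stein_identity mb mf fu fl.
have bf : bm (fun w => tstat J w * f (tstat J w)).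
  by apply: bmM => //; exact: bm_growth.
have bW := bm_lsum J; have bW2 : bm (fun w => lsum J w ^+ 2) by exact: bmX.
have ETf : Ex (fun w => tstat J w * f (tstat J w)) <= 144 * ((h + B) / (1 + `|x|)).
  apply: (@le_trans _ _ (Ex (fun w => 16 * (h + B) / (1 + `|x|) * (1 + 2 * lsum J w ^+ 2)))).
    apply: le_Ex => //.
      by apply: bmM => //; apply: bmD => //; exact: bmM.
    move=> w; apply: (le_trans (mul_clamp0_le _ H0 (ltW Hx))).
    rewrite [leLHS]mulrAC ler_wpM2l//.
      by rewrite divr_ge0 ?mulr_ge0// ltW.
    by rewrite lerD2l tstat_sqr_le.
  have b2W : bm (fun w => 2 * lsum J w ^+ 2) by exact: bmM.
  rewrite ExZ; last exact: bmD.
  rewrite ExD// Ex_cst ExZ//.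
  have W4 := Ex_lsum_sqr mb.
  have c0 : 0 <= (h + B) / (1 + `|x|) by rewrite divr_ge0// ltW.
  rewrite -mulrA; nra.
have bs i : bm (step f J i) by exact: bm_step.
have bS : bm (fun w => \sum_(i in J) step f J i w) by exact: bm_sum.
have S0 w : 0 <= \sum_(i in J) step f J i w.
  by apply: sumr_ge0 => i _; exact: clamp0_mul_ge0.
have bQ : bm (fun w => \sum_(i in J) `|xi i w| * Num.min `|xi i w| B).
  by apply: bm_sum => i _; exact: bm_weight.
pose bad1 w : R := (2 < qsum J w)%R%:R.
pose bad2 w : R := (\sum_(i in J) `|xi i w| * Num.min `|xi i w| B < 4^-1)%R%:R.
have bb1 : bm bad1 by exact: bm_ltb.
have bb2 : bm bad2 by exact: bm_ltb.
have b16 : bm (fun w => 16 * \sum_(i in J) step f J i w) by exact: bmM.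
have main : Ex (fun w => (`|tstat J w - x| <= h)%R%:R) <=
    Ex (fun w => 16 * (\sum_(i in J) step f J i w) + (bad1 w + bad2 w)).
  apply: le_Ex => //; first by apply: bmD => //; exact: bmD.
  move=> w; have := S0 w; have [Tx|_] := boolP (`|tstat J w - x| <= h); last first.
    by move=> s0; rewrite addr_ge0 ?mulr_ge0// addr_ge0// /bad1 /bad2 ler0n.
  rewrite /bad1 /bad2; case: ltP => V2; case: ltP => Q4 /=; rewrite ?mulr1n ?mulr0n; try lra.
  by have := step_clamp0_ge h0 (ltW B0) Tx V2 Q4; rewrite -/f /=; lra.
apply: (le_trans main); rewrite ExD//; last exact: bmD.
rewrite (ExD P bb1 bb2) ExZ// Ex_sum//.
have p1 := qsum_large mb; have p2 := weight_small mb B0 h34.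
have B2 : B / (1 + `|x|) <= B by rewrite ler_pdivrMr// ler_peMr// ltW.
have hx0 : 0 <= h / (1 + `|x|) by rewrite divr_ge0// ltW.
move: id; rewrite ler_norml => /andP[id _].
rewrite mulrDl in ETf.
by rewrite -/(Ex bad1) -/(Ex bad2) in p1 p2; lra.
Qed.

(** * Crossing the jump, and the bound for the truncated sum *)

Let bm_jump J i x :
  bm (fun w => (`|tstat J w - x| <= `|xi i w * nrm (qsum J w)|)%R%:R : R).
Proof.
apply: bm_leb; first by apply: bm_norm; apply: bmB => //; exact: bm_tstat.
by apply: bm_norm; apply: bmM; [exact: bm_xi|apply: bm_nrm; exact: bm_qsum].
Qed.

(* Conditionally on [xi i], the event confines the statistic of the other
   summands to an interval of radius [O(|xi i|)], relative to [1 + |x|]. *)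
Lemma jump_bound J i B x : moment_bounds J B -> 0 < B -> i \in J ->
  3 / 4 <= \sum_(j in (J :\ i)%SET) Ex (fun w => xi j w ^+ 2) ->
  Ex (fun w => xi i w ^+ 2 * (`|tstat J w - x| <= `|xi i w * nrm (qsum J w)|)%R%:R)
  <= 40 * 100 * (7 * Ex (fun w => `|xi i w| ^+ 3) + B * Ex (fun w => xi i w ^+ 2)).
Proof.
move=> mb B0 iJ h34.
pose c : R := 40 * 100; have c0 : 0 <= c by exact: mulr_ge0.
rewrite -/c; pose J' := (J :\ i)%SET.
have iJ' : i \notin J' by rewrite !inE eqxx.
have mb' : moment_bounds J' B by exact: moment_boundsD1.
have x0 : 0 < 1 + `|x| by rewrite ltr_pwDl.
pose k (y : R) := 6 * `|y| + y ^+ 2 * `|x|.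
have k0 y : 0 <= k y by apply: addr_ge0; apply: mulr_ge0 => //; exact: sqr_ge0.
pose H (z : R * (R * R)) : R :=
  z.1 ^+ 2 * (`|z.2.1 * nrm z.2.2 - x| <= k z.1)%R%:R.
pose K (y : R) := y ^+ 2 * (c * (k y / (1 + `|x|) + B)).
have bx := bm_xi i; have bx2 : bm (fun w => xi i w ^+ 2) by exact: bmX.
have bx3 : bm (fun w => `|xi i w| ^+ 3) by apply: bmX; exact: bm_norm.
have bkx : bm (fun w => k (xi i w)).
  by apply: bmD; apply: bmM => //; exact: bm_norm.
have bT' : bm (fun w => `|tstat J' w - x|).
  by apply: bm_norm; apply: bmB => //; exact: bm_tstat.
have bI' : bm (fun w => (`|tstat J' w - x| <= k (xi i w))%R%:R : R) by exact: bm_leb.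
have bK : bm (fun w => K (xi i w)).
  exact: (bmM bx2 (bmM (bm1 c) (bmD (bmM bkx (bm1 _)) (bm1 B)))).
have mk : measurable_fun setT k.
  by rewrite /k; apply: measurable_funD; apply: measurable_funM.
have mH : measurable_fun setT H.
  apply: measurable_funM; first by apply: measurable_funX.
  have mb1 : measurable_fun setT
      (fun z : R * (R * R) => `|z.2.1 * nrm z.2.2 - x| <= k z.1).
    have m21 : measurable_fun setT (fun z : R * (R * R) => z.2.1).
      by apply: (measurableT_comp (f := fst)).
    have m22 : measurable_fun setT (fun z : R * (R * R) => z.2.2).
      by apply: (measurableT_comp (f := snd)).
    apply: measurable_fun_ler; last exact: measurableT_comp.
    apply: measurableT_comp; first exact: normr_measurable.
    apply: measurable_funB => //; apply: measurable_funM => //.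
    by apply: measurableT_comp => //; exact: measurable_nrm.
  have -> : (fun z : R * (R * R) => (`|z.2.1 * nrm z.2.2 - x| <= k z.1)%R%:R : R) =
      (fun z => if `|z.2.1 * nrm z.2.2 - x| <= k z.1 then 1 else 0).
    by apply/funext => z; case: (_ <= k _).
  exact: measurable_fun_ifT.
apply: (@le_trans _ _ (Ex (fun w => H (xi i w, (lsum J' w, qsum J' w))))).
  apply: le_Ex; [by apply: bmM => //; exact: bm_jump|exact: bmM|move=> w].
  rewrite ler_wpM2l ?sqr_ge0//.
  case: (boolP (`|tstat J w - x| <= _)) => // h.
  rewrite (_ : (_ <= k _) = true)//.
  apply: self_normalized_increment; first exact: xi_le1.
  by move: h; rewrite /tstat (lsumD1 w iJ) (qsumD1 w iJ).
apply: (@le_trans _ _ (Ex (fun w => K (xi i w)))).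
  (* The value of [xi i] is frozen at [y], and [concentration] is applied to the remaining summands
     with radius [k y]. *)
  apply: (Ex_independent_le (Z := fun w => (lsum J' w, qsum J' w)) (H := H) (k := K)).
  - exact: mxi.
  - by apply: measurable_fun_pair; apply: bm_measurable; [exact: bm_lsum|exact: bm_qsum].
  - exact: independent_lsum_qsum.
  - exact: mH.
  - by move=> z; rewrite mulr_ge0 ?sqr_ge0.
  - exact: bmM.
  - by move=> y; apply: bmM; [exact: (bm1 (y ^+ 2))|exact: (bm_leb bT' (bm1 (k y)))].
  - exact: bK.
  - move=> y; rewrite /H /= ExZ; last exact: (bm_leb bT' (bm1 (k y))).
    by rewrite ler_wpM2l ?sqr_ge0//; exact: concentration.
apply: (@le_trans _ _ (Ex (fun w => c * (7 * `|xi i w| ^+ 3 + B * xi i w ^+ 2)))).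
  apply: le_Ex.
  - exact: bK.
  - by apply: bmM => //; apply: bmD; exact: bmM.
  move=> w; have -> : K (xi i w) =
      c * (xi i w ^+ 2 * (k (xi i w) / (1 + `|x|)) + B * xi i w ^+ 2).
    by rewrite /K; ring.
  apply: ler_wpM2l; first by [].
  apply: lerD; last by [].
  (* The decay of the concentration bound cancels the growth of the radius in |x|. *)
  have kx : k (xi i w) / (1 + `|x|) <= 7 * `|xi i w|.
    rewrite ler_pdivrMr// /k xi_sqr.
    have := xi_le1 i w; have := normr_ge0 (xi i w); have := normr_ge0 x.
    move: `|xi i w| `|x| => y z z0 y0 y1.
    have : y ^+ 2 <= y by rewrite expr2 ler_piMl.
    nra.
  apply: (@le_trans _ _ (xi i w ^+ 2 * (7 * `|xi i w|))).
    by rewrite ler_wpM2l ?sqr_ge0.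
  by rewrite xi_sqr mulrCA -exprSr.
rewrite ExZ; last by apply: bmD; exact: bmM.
by rewrite ExD ?ExZ//; exact: bmM.
Qed.

Lemma berry_esseen_tstat J B x : moment_bounds J B -> 0 < B -> B <= 64^-1 ->
  1 - B <= \sum_(i in J) Ex (fun w => xi i w ^+ 2) ->
  `|Ex (fun w => (tstat J w <= x)%R%:R) - ncdf x| <= 73 * (40 * 100) * B.
Proof.
move=> mb B0 B64 hB; have [_ h3 h1 h2] := mb.
pose c : R := 40 * 100; have c137 : 137 <= c by rewrite /c; lra.
have bT := bm_tstat J; have bV := bm_qsum J; have bg := bm_nrm bV.
have bx i := bm_xi i.
have bx2 i : bm (fun w => xi i w ^+ 2) by exact: bmX.
have bx3 i : bm (fun w => `|xi i w| ^+ 3) by apply: bmX; exact: bm_norm.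
(* No summand carries much variance: y^2 <= 1/16 + 4 y^3 for y >= 0, so deleting one leaves at least
   1 - B - 1/16 - 4 B >= 3/4. *)
have h34 i : i \in J -> 3 / 4 <= \sum_(j in (J :\ i)%SET) Ex (fun w => xi j w ^+ 2).
  move=> iJ; rewrite (big_setD1 i iJ) /= in hB.
  have : Ex (fun w => xi i w ^+ 2) <= 16^-1 + 4 * B.
    apply: (@le_trans _ _ (Ex (fun w => 16^-1 + 4 * `|xi i w| ^+ 3))).
      apply: le_Ex => //; first by apply: bmD => //; exact: bmM.
      move=> w; rewrite xi_sqr; have := normr_ge0 (xi i w).
      move: `|xi i w| => y y0; have [y4|y4] := leP y 4^-1.
        have : y ^+ 2 <= (4^-1) ^+ 2 by rewrite ler_pXn2r ?nnegrE.
        have : 0 <= y ^+ 3 by exact: exprn_ge0.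
        by lra.
      have : y ^+ 2 * 1 <= y ^+ 2 * (4 * y) by rewrite ler_wpM2l ?sqr_ge0//; lra.
      by rewrite (exprSr _ 2); lra.
    rewrite ExD ?Ex_cst ?ExZ//; last exact: bmM.
    rewrite lerD2l ler_wpM2l//; apply: le_trans h3.
    rewrite (big_setD1 i iJ)/= lerDl; apply: sumr_ge0 => j _.
    by apply: Ex_ge0.
  by lra.
have h34J : 3 / 4 <= \sum_(i in J) Ex (fun w => xi i w ^+ 2) by lra.
pose f := stein x.
have mf : measurable_fun setT f by exact: measurable_stein.
have f0 u : 0 <= f u by exact: stein_ge0.
have fu u : `|f u| <= 3 + `|u|.
  by rewrite ger0_norm//; have := stein_le3 x u; rewrite -/f; have := normr_ge0 u; lra.
have id := stein_identity mb mf fu (fun u v => stein_lipschitz x v u).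
pose ind w : R := (tstat J w <= x)%R%:R.
have bi : bm ind by exact: bm_leb.
(* By Stein's equation [D] is f' at T, with the left-hand value at [x]. The deviation to be bounded
   is therefore E[f'(T)] - E[T f(T)]. *)
pose D w := tstat J w * f (tstat J w) + (ind w - ncdf x).
have bfT : bm (fun w => f (tstat J w)) by exact: bm_growth.
have bTf : bm (fun w => tstat J w * f (tstat J w)) by exact: bmM.
have bD : bm D by apply: bmD => //; exact: bmB.
have D2 w : `|D w| <= 2.
  apply: (le_trans (ler_normD _ _)).
  have := norm_mul_stein x (tstat J w); rewrite (normrM (tstat J w)) (ger0_norm (f0 _)) -/f => h.
  have : `|ind w - ncdf x| <= 1.
    have := ncdf_ge0 x; have := ncdf_le1 x; rewrite ler_norml /ind.
    by case: (_ <= x) => /=; lra.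
  by lra.
have EE : Ex ind - ncdf x = Ex D - Ex (fun w => tstat J w * f (tstat J w)).
  rewrite /D ExD//; last exact: bmB.
  by rewrite ExB// Ex_cst; ring.
pose small w : R := (qsum J w < 2^-1)%R%:R.
have bsm : bm small by exact: bm_ltb.
have psm : Ex small <= 16 * B by exact: qsum_small.
pose jmp i w : R := (`|tstat J w - x| <= `|xi i w * nrm (qsum J w)|)%R%:R.
have bj i : bm (jmp i) by exact: bm_jump.
have bs i : bm (step f J i) by exact: bm_step.
have bq i : bm (fun w => xi i w ^+ 2 * nrm (qsum J w) ^+ 2 * D w).
  by apply: bmM => //; apply: bmM => //; exact: bmX.
(* Taylor expansion of f at T over the increment [- (xi i * nrm)]. With the outer factor the
   quadratic error becomes cubic in [xi i]; the jump error stays quadratic but lives on [jmp i]. *)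
have stepE i w : i \in J ->
    `|step f J i w - xi i w ^+ 2 * nrm (qsum J w) ^+ 2 * D w| <=
    `|xi i w| ^+ 3 * (24 + 12 * `|lsum (J :\ i)%SET w|) + 9 * (xi i w ^+ 2 * jmp i w).
  move=> iJ; rewrite /step.
  set s := xi i w; set g := nrm (qsum J w); set t := tstat J w.
  have := stein_taylor x t (t - s * g).
  have -> : t - s * g - t = - (s * g) by ring.
  rewrite normrN -/f -/(ind w) -/(jmp i w) => h.
  have -> : s * g * (f t - f (t - s * g)) - s ^+ 2 * g ^+ 2 * D w =
    - (s * g) * (f (t - s * g) - f t - - (s * g) * (t * f t + (ind w - ncdf x))).
    by rewrite /D -/t; ring.
  rewrite normrM normrN.
  apply: (le_trans (ler_wpM2l (normr_ge0 _) h)).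
  have g0 : 0 <= g by exact: nrm_ge0.
  have g1 : g <= 3 / 2 by exact: nrm_le.
  have g2 : g ^+ 2 <= 2 by exact: nrm_sqr_le2.
  have tl : `|t| <= 3 / 2 * (1 + `|lsum (J :\ i)%SET w|).
    rewrite /t /tstat (lsumD1 _ iJ) normrM mulrC (ger0_norm g0).
    apply: ler_pM => //; apply: (le_trans (ler_normD _ _)).
    by rewrite lerD2r.
  rewrite normrM (ger0_norm g0) xi_sqr -/s mulrDr.
  have y0 := normr_ge0 s; have a0 := normr_ge0 (lsum (J :\ i)%SET w).
  have t0 := normr_ge0 t.
  move: `|s| `|t| `|lsum _ _| y0 t0 a0 tl => y u a y0 u0 a0 ua.
  have j0 : 0 <= jmp i w by exact: ler0n.
  have g3 : 0 <= g ^+ 3 <= 3.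
    by rewrite exprn_ge0//= (exprSr _ 2); nra.
  apply: lerD.
    have -> : y * g * ((3 + 2 * u) * (y * g) ^+ 2) = y ^+ 3 * (g ^+ 3 * (3 + 2 * u)) by ring.
    rewrite ler_wpM2l ?exprn_ge0//; nra.
  have -> : y * g * (4 * (y * g) * jmp i w) = 4 * g ^+ 2 * (y ^+ 2 * jmp i w) by ring.
  by rewrite ler_wpM2r ?mulr_ge0 ?sqr_ge0//; lra.
have Estep i : i \in J ->
    `|Ex (step f J i) - Ex (fun w => xi i w ^+ 2 * nrm (qsum J w) ^+ 2 * D w)| <=
    (60 + 63 * c) * Ex (fun w => `|xi i w| ^+ 3) + 9 * c * B * Ex (fun w => xi i w ^+ 2).
  move=> iJ; rewrite -ExB//; apply: (le_trans (le_norm_Ex P (bmB (bs i) (bq i)))).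
  have bW := bm_norm (bm_lsum (J :\ i)%SET).
  have bb1 : bm (fun w => `|xi i w| ^+ 3 * (24 + 12 * `|lsum (J :\ i)%SET w|)).
    by apply: bmM => //; apply: bmD => //; exact: bmM.
  have bb2 : bm (fun w => xi i w ^+ 2 * jmp i w) by exact: bmM.
  apply: (@le_trans _ _ (Ex (fun w =>
    `|xi i w| ^+ 3 * (24 + 12 * `|lsum (J :\ i)%SET w|) + 9 * (xi i w ^+ 2 * jmp i w)))).
    apply: le_Ex; first by apply: bm_norm; exact: bmB.
      by apply: bmD => //; exact: bmM.
    by move=> w; exact: stepE.
  rewrite ExD//; last exact: bmM.
  rewrite (ExZ P 9 bb2).
  have := jump_bound x mb B0 iJ (h34 i iJ); rewrite -/(jmp i) -/c.
  have iJ' : i \notin (J :\ i)%SET by rewrite !inE eqxx.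
  have := @Ex_cube_lsum _ i B 24 12 (moment_boundsD1 i mb) ltac:(done) iJ'.
  by lra.
(* The leading terms add up to E[qsum nrm^2 D], where qsum nrm^2 is 1 unless qsum < 1/2; there |D|
   <= 2 costs 2 * 16 * B. With the 45 B of [stein_identity] the total is (137 + 72 c) B, and 137 <=
   c. *)
have Esum : `|\sum_(i in J) Ex (step f J i) - Ex D| <= (92 + 72 * c) * B.
  have -> : \sum_(i in J) Ex (step f J i) - Ex D =
      \sum_(i in J) (Ex (step f J i) - Ex (fun w => xi i w ^+ 2 * nrm (qsum J w) ^+ 2 * D w))
      + (Ex (fun w => qsum J w * nrm (qsum J w) ^+ 2 * D w) - Ex D).
    have -> : Ex (fun w => qsum J w * nrm (qsum J w) ^+ 2 * D w) =
        \sum_(i in J) Ex (fun w => xi i w ^+ 2 * nrm (qsum J w) ^+ 2 * D w).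
      rewrite -Ex_sum; last by move=> i _; exact: bq.
      by apply: eq_Ex => w; rewrite -!mulr_suml.
    by rewrite sumrB; ring.
  have bVD : bm (fun w => qsum J w * nrm (qsum J w) ^+ 2 * D w).
    by apply: bmM => //; apply: bmM => //; exact: bmX.
  have h1' : `|Ex (fun w => qsum J w * nrm (qsum J w) ^+ 2 * D w) - Ex D| <= 32 * B.
    rewrite -ExB//; apply: (le_trans (le_norm_Ex P (bmB bVD bD))).
    apply: (@le_trans _ _ (Ex (fun w => 2 * small w))).
      apply: le_Ex; [by apply: bm_norm; exact: bmB|exact: bmM|move=> w].
      rewrite /small; case: ltP => V2 /=; last first.
        by rewrite mul_nrm_sqr// mul1r subrr normr0 mulr0.
      rewrite mulr1 -[X in _ - X]mul1r -mulrBl normrM.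
      have /andP[v0 v1] := mul_nrm_sqr_le1 (qsum_ge0 J w).
      apply: (@le_trans _ _ (1 * `|D w|)); last by rewrite mul1r.
      by rewrite ler_wpM2r// ler_norml; lra.
    by rewrite ExZ//; lra.
  apply: (le_trans (ler_normD _ _)).
  have : `|\sum_(i in J) (Ex (step f J i) -
      Ex (fun w => xi i w ^+ 2 * nrm (qsum J w) ^+ 2 * D w))| <= (60 + 63 * c) * B + 9 * c * B.
    apply: (le_trans (ler_norm_sum _ _ _)); apply: (le_trans (ler_sum _ Estep)).
    rewrite big_split/= -!mulr_sumr; apply: lerD; first by apply: ler_wpM2l => //; lra.
    by rewrite -[leRHS]mulr1; apply: ler_wpM2l => //; nra.
  by lra.
rewrite -/(Ex ind) EE.
move: id Esum; rewrite !ler_norml => /andP[a1 a2] /andP[a3 a4].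
rewrite -/f in a1 a2; have : 137 * B <= c * B by rewrite ler_pM2r.
by move=> cB; rewrite -/c; apply/andP; split; lra.
Qed.

End self_normalized_sums.

(** * Student's statistic *)

Section student_change_of_scale.
Context {R : realType}.
Implicit Types t u v w A x : R.

Let le_mul_sqrt A t w : 0 < A -> (w <= t * Num.sqrt A) =
  if 0 <= t then (w <= 0) || (w ^+ 2 <= t ^+ 2 * A)
  else (w <= 0) && (t ^+ 2 * A <= w ^+ 2).
Proof.
move=> A0; have s0 : 0 < Num.sqrt A by rewrite sqrtr_gt0.
have E : t ^+ 2 * A = (t * Num.sqrt A) ^+ 2 by rewrite exprMn sqr_sqrtr// ltW.
have [t0|t0] := leP 0 t.
  have p0 : 0 <= t * Num.sqrt A by rewrite mulr_ge0// ltW.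
  have [w0|w0] := leP w 0; first by rewrite (le_trans w0).
  by rewrite E ler_pXn2r// nnegrE ltW.
have p0 : t * Num.sqrt A < 0 by rewrite nmulr_rlt0.
have [w0|w0] := leP w 0; last by apply/negbTE; rewrite -ltNge (lt_trans p0).
by rewrite E -[in RHS]sqrrN -(sqrrN w) ler_pXn2r ?nnegrE ?oppr_ge0 ?(ltW p0)// lerN2.
Qed.

(* Student's statistic is an increasing function of the self-normalized sum. *)
Lemma student_le_iff (m : R) w v t : 1 < m -> 0 < v -> 0 < m * v - w ^+ 2 ->
  (w / Num.sqrt ((m * v - w ^+ 2) / (m - 1)) <= t) =
  (w / Num.sqrt v <= t * Num.sqrt (m / (m - 1 + t ^+ 2))).
Proof.
move=> m1 v0 D0; have m0 : 0 < m - 1 by rewrite subr_gt0.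
have mt : 0 < m - 1 + t ^+ 2 by rewrite ltr_pwDl// sqr_ge0.
have A0 : 0 < (m * v - w ^+ 2) / (m - 1) by rewrite divr_gt0.
have C0 : 0 < m / (m - 1 + t ^+ 2) by rewrite divr_gt0//; lra.
rewrite !ler_pdivrMr ?sqrtr_gt0// -mulrA -sqrtrM ?(ltW C0)//.
rewrite !le_mul_sqrt//; last exact: mulr_gt0.
have eD : t ^+ 2 * ((m * v - w ^+ 2) / (m - 1)) = t ^+ 2 * (m * v - w ^+ 2) / (m - 1) by ring.
have eC : t ^+ 2 * (m / (m - 1 + t ^+ 2) * v) = t ^+ 2 * m * v / (m - 1 + t ^+ 2) by ring.
have e1 : (w ^+ 2 <= t ^+ 2 * ((m * v - w ^+ 2) / (m - 1))) =
          (w ^+ 2 <= t ^+ 2 * (m / (m - 1 + t ^+ 2) * v)).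
  rewrite eC eD !ler_pdivlMr//.
  by apply/idP/idP; lra.
have e2 : (t ^+ 2 * ((m * v - w ^+ 2) / (m - 1)) <= w ^+ 2) =
          (t ^+ 2 * (m / (m - 1 + t ^+ 2) * v) <= w ^+ 2).
  rewrite eC eD !ler_pdivrMr//.
  by apply/idP/idP; lra.
by rewrite e1 e2.
Qed.

Lemma npdf_mul_le1 u : npdf u * `|u| <= 1.
Proof.
apply: le_trans (npdf_le_inv_sqr u); rewrite ler_wpM2l ?npdf_ge0//.
have : 0 <= (`|u| - 1) ^+ 2 by exact: sqr_ge0.
by rewrite -(real_normK (num_real u)); lra.
Qed.

Lemma ncdf_tail u : 0 < u -> 1 - ncdf u <= (u ^+ 2)^-1.
Proof.
move=> u0; rewrite -[leRHS]mul1r ler_pdivlMr ?exprn_gt0//.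
have := mills (ltW u0); have := npdf_mul_le1 u; rewrite (ger0_norm (ltW u0)) => h1 h2.
have : u * (u * (1 - ncdf u)) <= u * npdf u by rewrite ler_pM2l.
by lra.
Qed.

Let sqrt_bounds (m : R) : 2 <= m -> 1 <= Num.sqrt m /\ Num.sqrt m ^+ 2 = m.
Proof.
move=> m2; split; last by rewrite sqr_sqrtr//; lra.
by rewrite -[leLHS]sqrtr1 ler_sqrt; lra.
Qed.

(** Split at t^2 = sqrt m. Below, the squared scale differs from 1 by at most 4 / sqrt m, and the
    density at the intermediate point absorbs the factor [t]. Above, both arguments are so far out
    that each tail is at most 2 / sqrt m. *)
Lemma ncdf_student_scale (m : R) t : 2 <= m ->
  `|ncdf (t * Num.sqrt (m / (m - 1 + t ^+ 2))) - ncdf t| <= 8 / Num.sqrt m.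
Proof.
move=> m2; wlog t0 : t / 0 <= t.
  move=> H; have [/H//|/ltW t0] := leP 0 t.
  have := H (- t); rewrite oppr_ge0 sqrrN mulNr => /(_ t0).
  by rewrite !ncdfN opprB addrC addrA subrK distrC.
have [s1 s2] := sqrt_bounds m2; set s := Num.sqrt m in s1 s2 *.
have mt : 0 < m - 1 + t ^+ 2 by have := sqr_ge0 t; lra.
set c2 := m / (m - 1 + t ^+ 2); set c := Num.sqrt c2.
have c20 : 0 < c2 by rewrite divr_gt0//; lra.
have c0 : 0 < c by rewrite sqrtr_gt0.
have cc : c ^+ 2 = c2 by rewrite sqr_sqrtr// ltW.
have s0 : 0 < s by lra.
have [ts|st] := leP (t ^+ 2) s.
  have [z [_ zl _ ->]] := mvt_is_derive_between t (t * c) (@is_derive_ncdf R).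
  have c4 : 4^-1 <= c2 by rewrite ler_pdivlMr//; nra.
  have c12 : 2^-1 <= c.
    by rewrite -(@ler_pXn2r _ 2) ?nnegrE ?(ltW c0)// cc; lra.
  have tz : t <= 2 * `|z|.
    apply: (@le_trans _ _ (2 * z)); last by rewrite ler_pM2l// ler_norm.
    by move: zl; rewrite ge_min => /orP[|]; nra.
  have pz : npdf z * t <= 2.
    have := npdf_mul_le1 z; have : npdf z * t <= npdf z * (2 * `|z|).
      by rewrite ler_wpM2l// npdf_ge0.
    by lra.
  have cb : `|c - 1| <= `|c2 - 1|.
    have -> : c2 - 1 = (c - 1) * (c + 1) by rewrite -cc; ring.
    rewrite normrM ler_peMr// ger0_norm; lra.
  have c2b : `|c2 - 1| <= 4 / s.
    have -> : c2 - 1 = (1 - t ^+ 2) / (m - 1 + t ^+ 2).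
      by rewrite /c2; field; rewrite gt_eqF.
    rewrite normrM normfV (gtr0_norm mt) ler_pdivrMr// mulrAC ler_pdivlMr//.
    have : `|1 - t ^+ 2| <= 1 + s.
      by have := sqr_ge0 t; rewrite ler_norml; lra.
    move=> h; apply: (@le_trans _ _ ((1 + s) * s)); first by rewrite ler_pM2r.
    by have := sqr_ge0 t; nra.
  have -> : t * c - t = t * (c - 1) by ring.
  rewrite normrM (ger0_norm (npdf_ge0 z)) normrM (ger0_norm t0) mulrA.
  have : npdf z * t * `|c - 1| <= 2 * (4 / s).
    by apply: ler_pM => //; [rewrite mulr_ge0 ?npdf_ge0|exact: le_trans cb c2b].
  by lra.
have tail u : 0 <= u -> s <= 2 * u ^+ 2 -> 1 - 2 / s <= ncdf u.
  move=> u0 su; have u0' : 0 < u.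
    by rewrite lt_neqAle u0 andbT; apply/eqP => u00; move: su; rewrite -u00 expr0n /=; lra.
  have := ncdf_tail u0'; have : (u ^+ 2)^-1 <= 2 / s.
    by rewrite ler_pdivlMr// ler_pdivrMl ?exprn_gt0//; lra.
  by lra.
have h1 : 1 - 2 / s <= ncdf t by apply: tail => //; lra.
have h2 : 1 - 2 / s <= ncdf (t * c).
  apply: tail; first by rewrite mulr_ge0// ltW.
  rewrite exprMn cc /c2.
  have -> : 2 * (t ^+ 2 * (m / (m - 1 + t ^+ 2))) = 2 * t ^+ 2 * m / (m - 1 + t ^+ 2) by ring.
  rewrite ler_pdivlMr//.
  have m0 : 0 <= m by lra.
  have sm : s <= m by rewrite -s2 expr2 ler_peMl// ltW.
  have [tm|tm] := leP (t ^+ 2) m.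
    apply: (@le_trans _ _ (s * (2 * m))); first by rewrite ler_pM2l//; lra.
    by rewrite mulrCA -mulrA ler_pM2l// ler_wpM2r// ltW.
  apply: (@le_trans _ _ (s * (2 * t ^+ 2))); first by rewrite ler_pM2l//; lra.
  by rewrite mulrC ler_wpM2l// mulr_ge0// sqr_ge0.
have := ncdf_le1 t; have := ncdf_le1 (t * c).
have : 0 <= s^-1 by rewrite invr_ge0 ltW.
by rewrite ler_norml => *; apply/andP; split; lra.
Qed.

End student_change_of_scale.

(** Inversion is discontinuous at 0, so continuity is no argument; a real power covers positive [y],
    and for [y <= 0] the conventions for root and inverse give 0. *)
Lemma measurable_inv_sqrt {R : realType} :
  measurable_fun setT (fun y : R => (Num.sqrt y)^-1).
Proof.
have -> : (fun y : R => (Num.sqrt y)^-1) = (fun y => if y <= 0 then 0 else y `^ (- 2^-1)).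
  apply/funext => y; case: leP => [y0|y0]; first by rewrite ler0_sqrtr// invr0.
  by rewrite powRN powR12_sqrt// ltW.
apply: measurable_fun_ifT => //.
exact: measurable_fun_ler.
Qed.

Definition trunc {R : realType} (y : R) : R := if `|y| <= 1 then y else 0.

Section studentized_sums.
Context {R : realType} {d : measure_display} {T : measurableType d} {N : nat}.
Variables (P : probability T R) (zeta : 'I_N -> T -> R).
Hypothesis mzeta : forall i, measurable_fun setT (zeta i).
Hypothesis indzeta : mutually_independent P zeta.

Local Notation bm := bounded_measurable.
Local Notation Ex := (Ex P).

Lemma norm_trunc_le1 (y : R) : `|trunc y| <= 1.
Proof. by rewrite /trunc; case: ifP => // _; rewrite normr0. Qed.

Lemma measurable_trunc : measurable_fun setT (@trunc R).
Proof.
apply: measurable_fun_ifT => //.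
by apply: measurable_fun_ler => //; exact: normr_measurable.
Qed.

Let xi i w := trunc (zeta i w).

Let mxi i : measurable_fun setT (xi i).
Proof. by apply: measurableT_comp (mzeta i); exact: measurable_trunc. Qed.

Let xi_le1 i w : `|xi i w| <= 1. Proof. exact: norm_trunc_le1. Qed.

Let indxi : mutually_independent P xi.
Proof.
move=> J A mA; apply: (indzeta (A := fun i => trunc @^-1` A i)) => i iJ.
by have := measurable_trunc measurableT (mA i iJ); rewrite setTI.
Qed.

Variables (J : {set 'I_N}) (B : R).
Hypothesis mb : moment_bounds P xi J B.
Hypothesis B0 : 0 < B.
Hypothesis B64 : B <= 64^-1.
Hypothesis second_moment : 1 - B <= \sum_(i in J) Ex (fun w => xi i w ^+ 2).
Hypothesis large_values : \sum_(i in J) Ex (fun w => (1 < `|zeta i w|)%R%:R) <= B.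
Variable n : R.
Hypothesis n2 : 2 <= n.
Hypothesis n_bound : (Num.sqrt n)^-1 <= 3 * B.

Definition student_gap w : R :=
  n * (\sum_(i in J) zeta i w ^+ 2) - (\sum_(i in J) zeta i w) ^+ 2.

Definition student w : R :=
  (\sum_(i in J) zeta i w) / Num.sqrt (student_gap w / (n - 1)).

Let n_gt0 : 0 < n. Proof. exact: lt_le_trans n2. Qed.

(** A sum of indicators, at least 1 as soon as one event occurs, so that its expectation plays the
    role of a union bound. Off these events truncation is invisible, the normalizer is exact and
    Student's denominator is positive, since n V - W^2 > 0 amounts to T^2 < n. *)
Let bad w : R := \sum_(i in J) (1 < `|zeta i w|)%R%:R +
  (qsum xi J w < 2^-1)%R%:R + (n <= tstat xi J w ^+ 2)%R%:R.

Let mzn i : measurable_fun setT (fun w => `|zeta i w|).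
Proof. by apply: measurableT_comp (mzeta i); exact: normr_measurable. Qed.

Let bm_large i : bm (fun w => (1 < `|zeta i w|)%R%:R : R).
Proof. by apply: bm_bool; exact: measurable_fun_ltr. Qed.

Let bm_T : bm (tstat xi J). Proof. exact: bm_tstat. Qed.
Let bm_V : bm (qsum xi J). Proof. exact: bm_qsum. Qed.
Let bm1 c : bm (fun _ : T => c : R). Proof. exact: bm_cst. Qed.

Let bm_Vs : bm (fun w => (qsum xi J w < 2^-1)%R%:R : R).
Proof. exact: bm_ltb. Qed.

Let bm_nT : bm (fun w => (n <= tstat xi J w ^+ 2)%R%:R : R).
Proof. by apply: bm_leb => //; exact: bmX. Qed.

Let bm_bad : bm bad.
Proof. by apply: bmD => //; apply: bmD => //; exact: bm_sum. Qed.

(** 89 = 1 + 16 + 72: large values, small [qsum], and Markov's inequality with E[T^2] <= 8, where 1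
    / n <= (3 B)^2 <= 9 B. *)
Let Ex_bad : Ex bad <= 89 * B.
Proof.
rewrite /bad ExD//; last by apply: bmD => //; exact: bm_sum.
rewrite ExD//; last exact: bm_sum.
rewrite Ex_sum//.
have h34 : 3 / 4 <= \sum_(i in J) Ex (fun w => xi i w ^+ 2).
  by apply: le_trans second_moment; have := B64; lra.
have p2 := qsum_small mxi xi_le1 indxi mb h34.
have W4 := Ex_lsum_sqr mxi xi_le1 indxi mb.
have bW : bm (fun w => lsum xi J w ^+ 2) by apply: bmX; exact: bm_lsum.
have p3 : Ex (fun w => (n <= tstat xi J w ^+ 2)%R%:R) <= 8 / n.
  apply: (@le_trans _ _ (Ex (fun w => 2 / n * lsum xi J w ^+ 2))).
    apply: le_Ex => //; first exact: bmM.
    move=> w; case: (leP n (tstat xi J w ^+ 2)) => /= h; last first.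
      by rewrite mulr_ge0 ?sqr_ge0// divr_ge0// ltW.
    rewrite mulrAC ler_pdivlMr ?mul1r//.
    exact: le_trans h (tstat_sqr_le xi J w).
  by rewrite ExZ// mulrAC ler_pM2r ?invr_gt0//; lra.
have nB : n^-1 <= 9 * B.
  have s0 : 0 <= n by exact: ltW.
  have b0 := B0; have b64 := B64.
  have -> : n^-1 = (Num.sqrt n)^-1 ^+ 2 by rewrite exprVn sqr_sqrtr.
  have : (Num.sqrt n)^-1 ^+ 2 <= (3 * B) ^+ 2.
    by rewrite ler_pXn2r ?nnegrE ?invr_ge0// mulr_ge0// ltW.

  by nra.
by have := large_values; lra.
Qed.

Let bad_ge0 w : 0 <= bad w.
Proof. by rewrite !addr_ge0// sumr_ge0. Qed.

Let good_or_bad w : 1 <= bad w \/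
  [/\ 0 < student_gap w, 2^-1 <= qsum xi J w &
   forall t, (student w <= t) = (tstat xi J w <= t * Num.sqrt (n / (n - 1 + t ^+ 2)))].
Proof.
have sum0 : 0 <= \sum_(i in J) (1 < `|zeta i w|)%R%:R :> R by rewrite sumr_ge0.
have [/existsP[i /andP[iJ zi]]|/existsPn nob] :=
    boolP [exists i, (i \in J) && (1 < `|zeta i w|)].
  left; rewrite /bad (bigD1 i iJ)/= zi.
  by rewrite -!addrA lerDl !addr_ge0// sumr_ge0.
have [Vs|V2] := ltP (qsum xi J w) 2^-1.
  left; rewrite /bad Vs.
  by rewrite addrAC lerDr addr_ge0.
have [nT|Tn] := leP n (tstat xi J w ^+ 2).
  by left; rewrite /bad nT lerDr addr_ge0.
right.
have xz i : i \in J -> xi i w = zeta i w.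
  move=> iJ; rewrite /xi /trunc; have := nob i; rewrite iJ /= -leNgt.
  by move=> ->.
have WE : \sum_(i in J) zeta i w = lsum xi J w.
  by apply: eq_bigr => i /xz ->.
have VE : \sum_(i in J) zeta i w ^+ 2 = qsum xi J w.
  by apply: eq_bigr => i /xz ->.
have V0 : 0 < qsum xi J w by apply: lt_le_trans V2; rewrite invr_gt0.
have TE : tstat xi J w = lsum xi J w / Num.sqrt (qsum xi J w).
  by rewrite /tstat /nrm max_l.
have gap0 : 0 < student_gap w.
  rewrite /student_gap WE VE subr_gt0; move: Tn.
  by rewrite TE exprMn exprVn sqr_sqrtr ?(ltW V0)// ltr_pdivrMr.
split => // t; rewrite /student TE WE.
rewrite -student_le_iff//.
- by rewrite /student_gap VE WE.
- by have := n2; lra.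
- by move: gap0; rewrite /student_gap VE WE.
Qed.

Let mgap : measurable_fun setT student_gap.
Proof.
apply: measurable_funB.
  apply: measurable_funM => //; apply: measurable_sum_cond => i _.
  exact: measurable_funX.
by apply: measurable_funX; exact: measurable_sum_cond.
Qed.

Lemma measurable_student : measurable_fun setT student.
Proof.
apply: measurable_funM; first exact: measurable_sum_cond.
apply: (measurableT_comp (@measurable_inv_sqrt R)).
exact: measurable_funM.
Qed.

Lemma student_gap_degenerate : Ex (fun w => (student_gap w <= 0)%R%:R) <= 89 * B.
Proof.
apply: le_trans Ex_bad; apply: Ex_le1_bool => //.
  exact: measurable_fun_ler.
by move=> w gw; have [//|[g0 _ _]] := good_or_bad w; lra.
Qed.

(** Off the bad events the two half-line events coincide, at thresholds [t] and [x]. The cost is 89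
    B for the exchange, 73 * 4000 B for T, and 8 / sqrt n <= 24 B for the change of scale. *)
Lemma berry_esseen_student t :
  `|Ex (fun w => (student w <= t)%R%:R) - ncdf t| <= 74 * (40 * 100) * B.
Proof.
pose x := t * Num.sqrt (n / (n - 1 + t ^+ 2)).
have BE := berry_esseen_tstat mxi xi_le1 indxi x mb B0 B64 second_moment.
have sc := ncdf_student_scale t n2.
have bS : bm (fun w => (student w <= t)%R%:R : R).
  by apply: bm_bool; apply: measurable_fun_ler => //; exact: measurable_student.
have bTx : bm (fun w => (tstat xi J w <= x)%R%:R : R) by exact: bm_leb.
have h : `|Ex (fun w => (student w <= t)%R%:R) - Ex (fun w => (tstat xi J w <= x)%R%:R)|
    <= 89 * B.
  rewrite -ExB//; apply: (le_trans (le_norm_Ex P (bmB bS bTx))).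
  apply: le_trans Ex_bad; apply: le_Ex => //; first by apply: bm_norm; exact: bmB.
  move=> w; have [b1|[_ _ ->]] := good_or_bad w.
    apply: le_trans b1; rewrite ler_norml.
    by case: (student w <= t); case: (tstat xi J w <= x) => /=; lra.
  by rewrite -/x subrr normr0.
have c8 : 8 / Num.sqrt n <= 24 * B.
  by move: n_bound => cb; lra.
move: h BE sc; rewrite -/x; set a := Ex _; set b := Ex _ => h BE sc.
have -> : a - ncdf t = (a - b) + (b - ncdf x) + (ncdf x - ncdf t) by ring.
apply: (le_trans (ler_normD _ _)).
have := ler_normD (a - b) (b - ncdf x).
have : 113 * B <= 40 * 100 * B by apply: ler_wpM2r; [exact: ltW|lra].
by lra.
Qed.

End studentized_sums.

(** * Reduction to the common law *)

Section standardized_law.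
Context {R : realType} {d : measure_display} {E : measurableType d}.
Variables (P : probability E R) (zeta : E -> R) (n : R).
Hypothesis mzeta : measurable_fun setT zeta.
Hypothesis izeta : P.-integrable setT (EFin \o zeta).
Hypothesis izeta2 : P.-integrable setT (EFin \o (fun x => zeta x ^+ 2)).
Hypothesis mean0 : Ex P zeta = 0.
Hypothesis var1 : n * Ex P (fun x => zeta x ^+ 2) = 1.
Hypothesis n1 : 1 <= n.

Definition tsqr x : R := zeta x ^+ 2 * Num.min 1 `|zeta x|.
(** For [zeta] equal to W_k divided by sqrt(n E[W_k^2]), this is the expectation whose supremum over
    the class is M_k. *)
Definition lyapunov : R := n * Ex P tsqr.

Local Notation xi := (fun x => trunc (zeta x)).
Local Notation integrable f := (P.-integrable setT (EFin \o (f : E -> R))).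

Let mabs : measurable_fun setT (fun x => `|zeta x|).
Proof. by apply: measurableT_comp mzeta; exact: normr_measurable. Qed.

Let mtsqr : measurable_fun setT tsqr.
Proof.
by apply: measurable_funM; [exact: measurable_funX|exact: measurable_minr].
Qed.

Lemma tsqr_ge0 x : 0 <= tsqr x.
Proof. by rewrite mulr_ge0 ?sqr_ge0// le_min ler01 normr_ge0. Qed.

Let tsqr_le x : tsqr x <= zeta x ^+ 2.
Proof. by rewrite ler_piMr ?sqr_ge0// ge_min lexx. Qed.

Lemma integrable_tsqr : integrable tsqr.
Proof.
apply: (@le_integrable _ _ _ _ _ measurableT _ (EFin \o (fun x => zeta x ^+ 2))) => //.
  exact/measurable_EFinP.
by move=> x _; rewrite /= lee_fin !ger0_norm ?sqr_ge0 ?tsqr_ge0.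
Qed.

Let itsqr := integrable_tsqr.

Let n0 : 0 <= n. Proof. by rewrite (le_trans ler01). Qed.

Let le_int (f g : E -> R) : integrable f -> integrable g -> (forall x, f x <= g x) ->
  Ex P f <= Ex P g.
Proof. by move=> ig ih gh; apply: le_Rintegral. Qed.

Let bm_xi : bounded_measurable xi.
Proof.
split; first by apply: measurableT_comp mzeta; exact: measurable_trunc.
by exists 1 => x; exact: norm_trunc_le1.
Qed.

Let xi_cases x : (`|zeta x| <= 1 /\ trunc (zeta x) = zeta x /\ tsqr x = `|zeta x| ^+ 3) \/
  (1 < `|zeta x| /\ trunc (zeta x) = 0 /\ tsqr x = `|zeta x| ^+ 2).
Proof.
rewrite /tsqr /trunc -(real_normK (num_real (zeta x))).
case: (leP `|zeta x| 1) => [z1|z1]; [left|right]; split => //; split => //.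
  by rewrite (exprSr _ 2).
by rewrite mulr1.
Qed.

Lemma lyapunov_ge0 : 0 <= lyapunov.
Proof. by rewrite mulr_ge0//; apply: Ex_ge0 => x; exact: tsqr_ge0. Qed.

Lemma lyapunov_le1 : lyapunov <= 1.
Proof. by rewrite -var1 ler_wpM2l//; apply: le_int. Qed.

Lemma trunc_third_moment : n * Ex P (fun x => `|trunc (zeta x)| ^+ 3) <= lyapunov.
Proof.
rewrite ler_wpM2l//; apply: le_int => //.
  by apply: bm_integrable; apply: bmX; exact: bm_norm.
move=> x; have [[_ [-> ->]]//|[_ [-> ->]]] := xi_cases x.
by rewrite normr0 expr0n /= exprn_ge0.
Qed.

(** As [zeta] is centred, the truncated mean is minus the mean of the discarded part, where |zeta| >
    1 and hence |zeta| <= zeta^2. *)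
Lemma trunc_mean : n * `|Ex P xi| <= lyapunov.
Proof.
rewrite ler_wpM2l//.
have ix := bm_integrable P bm_xi.
have idf : integrable (fun x => zeta x - trunc (zeta x)).
  have -> : EFin \o (fun x => zeta x - trunc (zeta x)) =
      ((EFin \o zeta) \- (EFin \o xi))%E by apply/funext.
  exact: integrableB.
have -> : `|Ex P xi| = `|Ex P (fun x => zeta x - trunc (zeta x))|.
  by rewrite /Ex RintegralB// -/(Ex P zeta) mean0 sub0r normrN.
apply: (le_trans (le_normr_Rintegral _ idf)) => //.
apply: le_int => //.
  exact: integrable_norm idf.
move=> x; have [[_ [-> ->]]|[z1 [-> ->]]] := xi_cases x.
  by rewrite subrr normr0 exprn_ge0.
by rewrite subr0 expr2 ler_peMl// ltW.
Qed.

Let ixi2 : integrable (fun x => trunc (zeta x) ^+ 2).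
Proof. by apply: bm_integrable; exact: bmX. Qed.

Lemma trunc_second_moment_le : n * Ex P (fun x => trunc (zeta x) ^+ 2) <= 1.
Proof.
rewrite -var1 ler_wpM2l//; apply: le_int => // x.
have [[_ [-> _]]//|[_ [-> _]]] := xi_cases x.
by rewrite expr0n /= sqr_ge0.
Qed.

Lemma trunc_second_moment_ge : 1 - lyapunov <= n * Ex P (fun x => trunc (zeta x) ^+ 2).
Proof.
rewrite -var1 /lyapunov -mulrBr ler_wpM2l// /Ex -RintegralB//.
apply: le_int => //.
  have -> : EFin \o (fun x => zeta x ^+ 2 - tsqr x) =
      ((EFin \o (fun x => zeta x ^+ 2)%R) \- (EFin \o tsqr))%E by apply/funext.
  exact: integrableB.
move=> x; have [[_ [-> ->]]|[z1 [-> ->]]] := xi_cases x.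
  by rewrite lerBlDr lerDl exprn_ge0.
by rewrite real_normK ?num_real// subrr expr0n.
Qed.

Lemma trunc_tail : n * Ex P (fun x => (1 < `|zeta x|)%R%:R) <= lyapunov.
Proof.
rewrite ler_wpM2l//; apply: le_int => //.
  by apply: bm_integrable; apply: bm_bool; exact: measurable_fun_ltr.
move=> x; have [[z1 [_ ->]]|[z1 [_ ->]]] := xi_cases x.
  by rewrite ltNge z1 /= exprn_ge0.
by rewrite z1 /= exprn_ege1// ltW.
Qed.

(* Optimizing [min(1, y) y^2 >= a y^2 - a^3] over [a]. *)
Lemma inv_sqrt_le_lyapunov : (Num.sqrt n)^-1 <= 3 * lyapunov.
Proof.
have s1 : 1 <= Num.sqrt n by rewrite -[leLHS]sqrtr1 ler_sqrt// (lt_le_trans ltr01).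
have s0 : 0 < Num.sqrt n by exact: lt_le_trans s1.
have sn : Num.sqrt n ^+ 2 = n by rewrite sqr_sqrtr.
set s := Num.sqrt n in s0 s1 sn *.
(* This choice gives a - n a^3 = 3 / (8 sqrt n), which exceeds 1 / (3 sqrt n). *)
pose a := s^-1 / 2.
have a0 : 0 < a by rewrite divr_gt0// invr_gt0.
have a1 : a <= 1 by rewrite /a; have := invf_le1 s0; rewrite s1 => h; lra.
have ptw x : a * zeta x ^+ 2 - a ^+ 3 <= tsqr x.
  rewrite /tsqr -(real_normK (num_real (zeta x))).
  have := normr_ge0 (zeta x); move: `|zeta x| => y y0.
  have [ya|ay] := leP y a.
    have h0 : 0 <= y ^+ 2 * Num.min 1 y by rewrite mulr_ge0 ?sqr_ge0// le_min ler01.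
    apply: le_trans h0; rewrite subr_le0 (exprS a 2) ler_pM2l//.
    by rewrite ler_pXn2r ?nnegrE// ltW.
  have h : a * y ^+ 2 <= y ^+ 2 * Num.min 1 y.
    by rewrite mulrC ler_wpM2l ?sqr_ge0// le_min a1 ltW.
  by apply: le_trans h; rewrite gerDl oppr_le0 exprn_ge0// ltW.
have iz : integrable (fun x => a * zeta x ^+ 2).
  have -> : EFin \o (fun x => a * zeta x ^+ 2) =
    (fun x => a%:E * (EFin \o (fun x => zeta x ^+ 2)%R) x)%E by apply/funext.
  exact: integrableZl.
have ic : integrable (fun=> a ^+ 3) by apply: bm_integrable; exact: bm_cst.
have : n * Ex P (fun x => a * zeta x ^+ 2 - a ^+ 3) <= lyapunov.
  rewrite ler_wpM2l//; apply: le_int => //.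
  have -> : EFin \o (fun x => a * zeta x ^+ 2 - a ^+ 3) =
      ((EFin \o (fun x => a * zeta x ^+ 2)%R) \- (EFin \o (fun=> a ^+ 3)%R))%E by apply/funext.
  exact: integrableB.
rewrite /Ex RintegralB// RintegralZl// -/(Ex P _) -/(Ex P (fun=> a ^+ 3)) Ex_cst.
rewrite mulrBr mulrCA var1 mulr1 -sn.
have -> : a - s ^+ 2 * a ^+ 3 = 3 / 8 * s^-1 by rewrite /a; field; rewrite gt_eqF.
have : 0 <= s^-1 by rewrite invr_ge0 ltW.
by lra.
Qed.

End standardized_law.

Section identically_distributed.
Context {R : realType} {d d' : measure_display} {T : measurableType d}
  {E : measurableType d'}.

Lemma Ex_law (Pr : probability T R) (P : probability E R) (X : T -> E) (g : E -> R) :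
  measurable_fun setT X -> (forall A, measurable A -> Pr (X @^-1` A) = P A) ->
  bounded_measurable g -> Ex Pr (fun w => g (X w)) = Ex P g.
Proof.
move=> mX lawX bg.
have [mg [M gM]] := bg.
pose X' : {mfun T >-> E} := HB.pack X (isMeasurableFun.Build _ _ _ _ X mX).
have bgX : bounded_measurable (fun w => g (X w)).
  by split; [exact: measurableT_comp mg mX|exists M].
apply: EFin_inj; rewrite -!EFin_Ex//.
rewrite -(@integral_distribution _ _ _ _ _ Pr X' (EFin \o g)).
- by apply: eq_measure_integral => A mA _; exact: lawX.
- exact/measurable_EFinP.
- exact: bm_integrable bgX.
Qed.

Lemma mutually_independent_comp {d2 : measure_display} {E2 : measurableType d2}
  (Pr : probability T R) (N : nat) (X : 'I_N -> T -> E) (phi : E -> E2) :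
  measurable_fun setT phi -> mutually_independent Pr X ->
  mutually_independent Pr (fun i w => phi (X i w)).
Proof.
move=> mphi ind J A mA; apply: (ind J (fun i => phi @^-1` A i)) => i iJ.
by have := mphi measurableT _ (mA i iJ); rewrite setTI.
Qed.

Variables (Pr : probability T R) (P : probability E R) (N : nat).
Variables (X : 'I_N -> T -> E) (zeta : E -> R) (n : R).
Hypothesis mX : forall i, measurable_fun setT (X i).
Hypothesis lawX : forall i A, measurable A -> Pr (X i @^-1` A) = P A.
Hypothesis indX : mutually_independent Pr X.
Hypothesis mzeta : measurable_fun setT zeta.
Hypothesis izeta : P.-integrable setT (EFin \o zeta).
Hypothesis izeta2 : P.-integrable setT (EFin \o (fun x => zeta x ^+ 2)).
Hypothesis mean0 : Ex P zeta = 0.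
Hypothesis var1 : n * Ex P (fun x => zeta x ^+ 2) = 1.
Hypothesis n2 : 2 <= n.
Variable J : {set 'I_N}.
Hypothesis cardJ : #|J|%:R = n.

Let z i w := zeta (X i w).
Let B := lyapunov P zeta n.

Let n1 : 1 <= n. Proof. by apply: le_trans n2; rewrite ler1n. Qed.

Let mz i : measurable_fun setT (z i).
Proof. exact: measurableT_comp mzeta (mX i). Qed.

Let sum_Ex (g : R -> R) : bounded_measurable (fun x => g (zeta x)) ->
  \sum_(i in J) Ex Pr (fun w => g (z i w)) = n * Ex P (fun x => g (zeta x)).
Proof.
move=> bg; rewrite (eq_bigr (fun=> Ex P (fun x => g (zeta x)))).
  by rewrite sumr_const -cardJ mulr_natl.
by move=> i _; exact: (Ex_law (mX i) (@lawX i) bg).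
Qed.

Let bm_xi : bounded_measurable (fun x => trunc (zeta x)).
Proof.
split; first by apply: measurableT_comp mzeta; exact: measurable_trunc.
by exists 1 => x; exact: norm_trunc_le1.
Qed.

Let mb : moment_bounds Pr (fun i w => trunc (z i w)) J B.
Proof.
split.
- by rewrite lyapunov_ge0//= lyapunov_le1.
- rewrite (sum_Ex (g := fun y => `|trunc y| ^+ 3)); first exact: trunc_third_moment.
  by apply: bmX; exact: bm_norm.
- rewrite (eq_bigr (fun=> `|Ex P (fun x => trunc (zeta x))|)); last first.
    by move=> i _; congr `|_|; exact: (Ex_law (mX i) (@lawX i) bm_xi).
  by rewrite sumr_const -mulr_natl cardJ; exact: trunc_mean.
- rewrite (sum_Ex (g := fun y => trunc y ^+ 2)); first exact: trunc_second_moment_le.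
  exact: bmX.
Qed.

(** The lower bound of order 1 / sqrt n ensures positivity, which matters because [B] serves as
    clamp margin and as divisor. *)
Let B0 : 0 < B.
Proof.
have h := inv_sqrt_le_lyapunov mzeta izeta2 var1 n1; rewrite -/B in h.
have : 0 < (Num.sqrt n)^-1 by rewrite invr_gt0 sqrtr_gt0 (lt_le_trans _ n1).
by lra.
Qed.

Let second : 1 - B <= \sum_(i in J) Ex Pr (fun w => trunc (z i w) ^+ 2).
Proof.
rewrite (sum_Ex (g := fun y => trunc y ^+ 2)); first exact: trunc_second_moment_ge.
exact: bmX.
Qed.

Let large : \sum_(i in J) Ex Pr (fun w => (1 < `|z i w|)%R%:R) <= B.
Proof.
rewrite (sum_Ex (g := fun y => (1 < `|y|)%R%:R)); first exact: trunc_tail.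
apply: bm_bool; apply: measurable_fun_ltr => //.
by apply: measurableT_comp mzeta; exact: normr_measurable.
Qed.

Let indz : mutually_independent Pr z.
Proof. exact: mutually_independent_comp. Qed.

Lemma measurable_student_iid : measurable_fun setT (student z J n).
Proof. exact: measurable_student. Qed.

Lemma measurable_gap_iid : measurable_fun setT (student_gap z J n).
Proof.
apply: measurable_funB.
  apply: measurable_funM => //; apply: measurable_sum_cond => i _.
  exact: measurable_funX.
by apply: measurable_funX; exact: measurable_sum_cond.
Qed.

Lemma berry_esseen_iid t :
  `|Ex Pr (fun w => (student z J n w <= t)%R%:R) - ncdf t| <= 74 * (40 * 100) * B.
Proof.
(* Beyond 1/64 the right-hand side exceeds 1, and two probabilities never differ by more. *)
have [B64|B64] := leP B 64^-1.
  apply: (berry_esseen_student mz indz mb) => //.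
  exact: inv_sqrt_le_lyapunov.
have bS : bounded_measurable (fun w => (student z J n w <= t)%R%:R : R).
  by apply: bm_bool; apply: measurable_fun_ler => //; exact: measurable_student_iid.
have e0 : 0 <= Ex Pr (fun w => (student z J n w <= t)%R%:R) by apply: Ex_ge0.
have e1 : Ex Pr (fun w => (student z J n w <= t)%R%:R) <= 1.
  rewrite -[leRHS](Ex_cst Pr 1); apply: le_Ex => //; first exact: bm_cst.
  by move=> w; case: (student z J n w <= t).
have := ncdf_ge0 t; have := ncdf_le1 t => *.
by rewrite ler_norml; apply/andP; split; lra.
Qed.

Lemma degenerate_iid :
  Ex Pr (fun w => (student_gap z J n w <= 0)%R%:R) <= 89 * B.
Proof.
have [B64|B64] := leP B 64^-1.
  apply: (student_gap_degenerate mz indz mb) => //.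
  exact: inv_sqrt_le_lyapunov.
apply: (@le_trans _ _ 1); last by lra.
rewrite -[leRHS](Ex_cst Pr 1); apply: le_Ex => //; last 2 first.
- exact: bm_cst.
- by move=> w; case: (student_gap z J n w <= 0).
- by apply: bm_bool; apply: measurable_fun_ler => //; exact: measurable_gap_iid.
Qed.

End identically_distributed.

(** * Contrasts of sample moments *)

Section contrast_algebra.
Context {R : realType} {d n : nat}.
Implicit Types (Y : 'I_n -> 'cV[R]_d) (r k : 'I_d) (m v : 'cV[R]_d).

Lemma dotv_gammav r k v : dotv (gammav r k) v = v r 0 - v k 0.
Proof.
by rewrite /dotv /gammav linearB /= !trmx_delta mulmxBl -!rowE !mxE.
Qed.

Lemma dotv_gammavE r k m v :
  dotv (gammav r k) (v - m) = v r 0 - m r 0 - (v k 0 - m k 0).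
Proof. by rewrite dotv_gammav !mxE. Qed.

Lemma sample_meanE Y k : sample_mean Y k 0 = n%:R^-1 * \sum_i Y i k 0.
Proof. by rewrite /sample_mean mxE summxE. Qed.

Lemma dotv_sample_mean Y m r k : (0 < n)%N ->
  dotv (gammav r k) (sample_mean Y - m) =
  n%:R^-1 * \sum_i dotv (gammav r k) (Y i - m).
Proof.
move=> n0; have nn0 : n%:R != 0 :> R by rewrite pnatr_eq0 -lt0n.
rewrite dotv_gammavE !sample_meanE.
rewrite [in RHS](eq_bigr (fun i => (Y i r 0 - Y i k 0) - (m r 0 - m k 0))); last first.
  by move=> i _; rewrite dotv_gammavE; ring.
rewrite sumrB sumrB sumr_const card_ord -[_ *+ n]mulr_natr.
by field.
Qed.

Lemma sample_varE Y r k : dotv (gammav r k) (sample_cov Y *m gammav r k) =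
  (n.-1)%:R^-1 * \sum_i (dotv (gammav r k) (Y i - sample_mean Y)) ^+ 2.
Proof.
rewrite /sample_cov /dotv -scalemxAl mulmx_suml -scalemxAr mulmx_sumr mxE summxE.
congr (_ * _); apply: eq_bigr => i _.
set u := Y i - _; set g := gammav r k.
have -> : g^T *m (u *m u^T *m g) = (g^T *m u) *m (g^T *m u)^T.
  by rewrite trmx_mul trmxK !mulmxA.
by rewrite mxE big_ord1 [X in _ * X]mxE expr2.
Qed.

Lemma sum_sqr_centered (y : 'I_n -> R) : (0 < n)%N ->
  \sum_i (y i - n%:R^-1 * \sum_j y j) ^+ 2 =
  \sum_i y i ^+ 2 - (\sum_i y i) ^+ 2 / n%:R.
Proof.
move=> n0; have nn0 : n%:R != 0 :> R by rewrite pnatr_eq0 -lt0n.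
set a := n%:R^-1 * _.
rewrite (eq_bigr (fun i => y i ^+ 2 - (2 * a * y i - a ^+ 2))); last by move=> i _; ring.
rewrite sumrB sumrB -mulr_sumr sumr_const card_ord -[_ *+ n]mulr_natr /a.
by field.
Qed.

(** A sample variance is invariant under shifts, so the centre [m] is free: the population mean
    produces Student's gap, and 0 serves for measurability. *)
Lemma sample_sdE Y m r k : (1 < n)%N ->
  sample_sd Y r k = Num.sqrt ((n%:R * \sum_i dotv (gammav r k) (Y i - m) ^+ 2 -
    (\sum_i dotv (gammav r k) (Y i - m)) ^+ 2) / (n%:R * (n%:R - 1))).
Proof.
move=> n1; have n0 : (0 < n)%N by apply: leq_trans n1.
have nn0 : n%:R != 0 :> R by rewrite pnatr_eq0 -lt0n.
have nn1 : n%:R - 1 != 0 :> R by rewrite subr_eq0 pnatr_eq1 gtn_eqF.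
rewrite /sample_sd sample_varE; congr Num.sqrt.
set y := fun i => dotv (gammav r k) (Y i - m).
have yE i : dotv (gammav r k) (Y i - sample_mean Y) = y i - n%:R^-1 * \sum_j y j.
  rewrite /y -dotv_sample_mean// !dotv_gammavE; ring.
rewrite (eq_bigr (fun i => (y i - n%:R^-1 * \sum_j y j) ^+ 2)); last by move=> i _; rewrite yE.
rewrite sum_sqr_centered//.
have -> : n.-1%:R = n%:R - 1 :> R by rewrite -subn1 natrB.
by field; rewrite nn0 nn1.
Qed.

End contrast_algebra.

Section contrast_measurability.
Context {R : realType} {d n : nat} {dT : measure_display} {T : measurableType dT}.
Variable Y : T -> 'I_n -> 'cV[R]_d.
Hypothesis mY : forall i j, measurable_fun setT (fun w => Y w i j 0).
Hypothesis n1 : (1 < n)%N.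
Implicit Types (r k : 'I_d) (m : 'cV[R]_d).

Let mdot r k m i : measurable_fun setT (fun w => dotv (gammav r k) (Y w i - m)).
Proof.
have -> : (fun w => dotv (gammav r k) (Y w i - m)) =
    (fun w => Y w i r 0 - m r 0 - (Y w i k 0 - m k 0)).
  by apply/funext => w; rewrite dotv_gammavE.
by apply: measurable_funB; apply: measurable_funB.
Qed.

Let mgap r k m : measurable_fun setT (fun w =>
  (n%:R * \sum_i dotv (gammav r k) (Y w i - m) ^+ 2 -
    (\sum_i dotv (gammav r k) (Y w i - m)) ^+ 2) / (n%:R * (n%:R - 1)) : R).
Proof.
apply: measurable_funM => //; apply: measurable_funB.
  apply: measurable_funM => //; apply: measurable_sum => i.
  exact: measurable_funX.
by apply: measurable_funX; exact: measurable_sum.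
Qed.

Lemma measurable_sample_mean k : measurable_fun setT (fun w => sample_mean (Y w) k 0).
Proof.
have -> : (fun w => sample_mean (Y w) k 0) = (fun w => n%:R^-1 * \sum_i Y w i k 0).
  by apply/funext => w; rewrite sample_meanE.
by apply: measurable_funM => //; exact: measurable_sum.
Qed.

Lemma measurable_sample_sd r k : measurable_fun setT (fun w => sample_sd (Y w) r k).
Proof.
have -> : (fun w => sample_sd (Y w) r k) = @Num.sqrt R \o (fun w =>
  (n%:R * \sum_i dotv (gammav r k) (Y w i - 0) ^+ 2 -
    (\sum_i dotv (gammav r k) (Y w i - 0)) ^+ 2) / (n%:R * (n%:R - 1)) : R).
  by apply/funext => w /=; rewrite (sample_sdE _ 0).
apply: measurableT_comp (mgap _ _ _).
by apply: continuous_measurable_fun; exact: sqrt_continuous.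
Qed.

Lemma measurable_studentized m r k :
  measurable_fun setT (fun w => studentized m (Y w) r k).
Proof.
have -> : (fun w => studentized m (Y w) r k) = (fun w =>
  Num.sqrt n%:R * (sample_mean (Y w) r 0 - m r 0 - (sample_mean (Y w) k 0 - m k 0)) *
  ((fun y : R => (Num.sqrt y)^-1) \o (fun w =>
  (n%:R * \sum_i dotv (gammav r k) (Y w i - m) ^+ 2 -
    (\sum_i dotv (gammav r k) (Y w i - m)) ^+ 2) / (n%:R * (n%:R - 1)) : R)) w).
  by apply/funext => w /=; rewrite /studentized dotv_gammavE (sample_sdE _ m).
apply: measurable_funM; last first.
  by apply: measurableT_comp (mgap _ _ _); exact: measurable_inv_sqrt.
apply: measurable_funM => //.
by apply: measurable_funB; apply: measurable_funB => //; exact: measurable_sample_mean.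
Qed.

Lemma measurable_forall (b : 'I_d -> T -> bool) :
  (forall j, measurable_fun setT (b j)) ->
  measurable_fun setT (fun w => [forall j, b j w]).
Proof.
move=> mb.
have -> : (fun w => [forall j, b j w]) = (fun w => \big[andb/true]_(j < d) b j w).
  by apply/funext => w; rewrite big_andE.
rewrite /index_enum; elim: (locked_with _ _) => [|j s IH].
  by have -> : (fun w => \big[andb/true]_(j <- [::]) b j w) = cst true;
    [apply/funext => w; rewrite big_nil|exact: measurable_cst].
have -> : (fun w => \big[andb/true]_(i <- j :: s) b i w) =
    (fun w => b j w && \big[andb/true]_(i <- s) b i w).
  by apply/funext => w; rewrite big_cons.
exact: measurable_and.
Qed.

Lemma measurable_is_sargmin (f : T -> 'I_d -> R) r k :
  (forall j, measurable_fun setT (fun w => f w j)) ->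
  measurable_fun setT (fun w => is_sargmin r (f w) k).
Proof.
move=> mf; rewrite /is_sargmin.
have mcase (c : bool) (b : T -> bool) : measurable_fun setT b ->
    measurable_fun setT (fun w => c ==> b w).
  by case: c => //= _; exact: measurable_cst.
apply: measurable_and; first exact: measurable_cst.
apply: measurable_and; apply: measurable_forall => j.
  by apply: mcase; exact: measurable_fun_ler.
case: (j != r) => /=; last exact: measurable_cst.
case: (k <= j)%N.
  have -> : (fun w => (f w j == f w k) ==> true) = cst true.
    by apply/funext => w; rewrite implybT.
  exact: measurable_cst.
have -> : (fun w => (f w j == f w k) ==> false) = (fun w => ~~ (f w j == f w k)).
  by apply/funext => w; rewrite implybF.
by apply: measurable_neg; exact: measurable_fun_eqr.
Qed.

(** Breaking ties by the smallest index leaves at most one candidate. This replaces a choice by a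
    finite set of comparisons, which is measurable. *)
Lemma sargmin_eq (r : 'I_d) (f : 'I_d -> R) k : (1 < d)%N ->
  (sargmin r f == k) = is_sargmin r f k.
Proof.
move=> d1; apply/eqP/idP => [<-|]; first exact: sargminP.
have := sargminP r f d1; set k' := sargmin r f.
move=> /and3P[kr /forallP kmin /forallP kfst] /and3P[kr' /forallP kmin' /forallP kfst'].
have fE : f k = f k'.
  apply/eqP; rewrite eq_le; have := kmin k; have := kmin' k'.
  by rewrite kr kr' => /= -> ->.
apply/val_inj/eqP; rewrite eqn_leq.
have := kfst k; have := kfst' k'.
by rewrite kr kr' fE eqxx => /= -> ->.
Qed.

Lemma measurable_select (kappa : R) (s : selection_rule) r k : (1 < d)%N -> 0 < kappa ->
  measurable_fun setT (fun w => select kappa s r (Y w) == k).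
Proof.
move=> d1 kappa0; rewrite /select; case: s.
  have -> : (fun w => sargmin r (fun j => sample_mean (Y w) j 0) == k) =
      (fun w => is_sargmin r (fun j => sample_mean (Y w) j 0) k).
    by apply/funext => w; rewrite sargmin_eq.
  apply: (@measurable_is_sargmin (fun w j => sample_mean (Y w) j 0)) => j.
  exact: measurable_sample_mean.
(* The divisor is positive because of [kappa], hence equal to the root of its square, and
   [measurable_inv_sqrt] covers the division. *)
pose f w j := (sample_mean (Y w) j 0 - sample_mean (Y w) r 0) *
  ((fun y : R => (Num.sqrt y)^-1) \o
    (fun w => Num.max (sample_sd (Y w) r j) kappa ^+ 2)) w.
have -> : (fun w => sargmin r (fun j => (sample_mean (Y w) j 0 - sample_mean (Y w) r 0) /
    Num.max (sample_sd (Y w) r j) kappa) == k) = (fun w => is_sargmin r (f w) k).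
  apply/funext => w; rewrite sargmin_eq//; congr (is_sargmin r _ k).
  apply/funext => j; rewrite /f /= sqrtr_sqr ger0_norm//.
  by rewrite le_max (ltW kappa0) orbT.
apply: measurable_is_sargmin => j; apply: measurable_funM.
  by apply: measurable_funB; exact: measurable_sample_mean.
apply: measurableT_comp; first exact: measurable_inv_sqrt.
apply: measurable_funX; apply: measurable_maxr => //.
exact: measurable_sample_sd.
Qed.

Lemma select_neq (kappa : R) (s : selection_rule) r w : (1 < d)%N ->
  select kappa s r (Y w) != r.
Proof.
by move=> d1; case: s => /=; set f := (X in sargmin r X);
  have /and3P[] := sargminP r f d1.
Qed.

End contrast_measurability.

(** * The two halves of the sample *)

Section contrast_law.
Context {R : realType} {d : nat}.
Variables (P : probability (d.-tuple R) R) (r k : 'I_d) (n : nat).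
Hypothesis P0 : null_law r P.
Hypothesis kr : k != r.
Hypothesis n2 : (2 <= n)%N.

Lemma WE x : W P r k x = tnth x r - mu P r 0 - (tnth x k - mu P k 0).
Proof. by rewrite /W dotv_gammavE !mxE. Qed.

Definition scaled_contrast (x : d.-tuple R) : R :=
  W P r k x / (Num.sqrt n%:R * Num.sqrt (fine (EW2 P r k))).

Local Notation zeta := scaled_contrast.

Let mtn (j : 'I_d) : measurable_fun setT (fun x : d.-tuple R => tnth x j).
Proof. exact: measurable_tnth. Qed.

Let mW : measurable_fun setT (W P r k).
Proof.
have -> : W P r k = (fun x => tnth x r - mu P r 0 - (tnth x k - mu P k 0)).
  by apply/funext => x; rewrite WE.
by apply: measurable_funB; apply: measurable_funB.
Qed.

Let centered (j : 'I_d) : P.-integrable setT (EFin \o (fun x => tnth x j - mu P j 0)) /\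
  Ex P (fun x => tnth x j - mu P j 0) = 0.
Proof.
have [itn _ _] := P0.
have ic : P.-integrable setT (EFin \o (fun _ : d.-tuple R => mu P j 0)).
  by apply: bm_integrable; exact: bm_cst.
have ij : P.-integrable setT (EFin \o (fun x : d.-tuple R => tnth x j)) by exact: itn.
split.
  have -> : EFin \o (fun x => tnth x j - mu P j 0) =
    ((EFin \o (fun x : d.-tuple R => tnth x j)) \- (EFin \o (fun=> mu P j 0)%R))%E.
    by apply/funext.
  exact: integrableB.
rewrite /Ex RintegralB// -/(Ex P (fun=> mu P j 0)) Ex_cst /Rintegral.
by rewrite /mu mxE unlock subrr.
Qed.

Let WcE : EFin \o W P r k =
  ((EFin \o (fun x => tnth x r - mu P r 0)%R) \- (EFin \o (fun x => tnth x k - mu P k 0)%R))%E.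
Proof. by apply/funext => x; rewrite /= WE. Qed.

Let iW : P.-integrable setT (EFin \o W P r k).
Proof. by rewrite WcE; apply: integrableB => //; have [] := centered r; have [] := centered k. Qed.

Let EW : Ex P (W P r k) = 0.
Proof.
have [ir er] := centered r; have [ik ek] := centered k.
rewrite (@eq_Ex _ _ _ P _ (fun x => (tnth x r - mu P r 0) - (tnth x k - mu P k 0))); last exact: WE.
by rewrite /Ex RintegralB// -/(Ex P _) er -/(Ex P _) ek subrr.
Qed.

Let EW2_fin : EW2 P r k = (fine (EW2 P r k))%:E /\ 0 < fine (EW2 P r k).
Proof.
have [_ _ /(_ k kr) /andP[e0 ey]] := P0.
have f : EW2 P r k \is a fin_num by rewrite ge0_fin_numE// ltW.
by split; [rewrite fineK|rewrite fine_gt0// e0].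
Qed.

Let iW2 : P.-integrable setT (EFin \o (fun x => W P r k x ^+ 2)).
Proof.
apply/integrableP; split; first by apply/measurable_EFinP; exact: measurable_funX.
have [_ _ /(_ k kr) /andP[_ ey]] := P0.
move: ey; rewrite /EW2 unlock; apply: le_lt_trans; rewrite le_eqVlt; apply/orP; left; apply/eqP.
by apply: eq_integral => x _; rewrite /= ger0_norm// sqr_ge0.
Qed.

Let nR2 : 2 <= n%:R :> R. Proof. by rewrite ler_nat. Qed.
Let nR0 : 0 < n%:R :> R. Proof. exact: lt_le_trans nR2. Qed.

Definition contrast_scale : R := Num.sqrt n%:R * Num.sqrt (fine (EW2 P r k)).

Lemma contrast_scale_gt0 : 0 < contrast_scale.
Proof. by have [_ s0] := EW2_fin; rewrite mulr_gt0// sqrtr_gt0. Qed.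

Let scale_sqr : contrast_scale ^+ 2 = n%:R * fine (EW2 P r k).
Proof. by have [_ s0] := EW2_fin; rewrite exprMn !sqr_sqrtr// ltW. Qed.

Lemma WscaleE x : W P r k x = contrast_scale * zeta x.
Proof. by rewrite /scaled_contrast mulrC divfK// gt_eqF// contrast_scale_gt0. Qed.

Lemma measurable_scaled_contrast : measurable_fun setT zeta.
Proof. exact: measurable_funM. Qed.

Lemma integrable_scaled_contrast : P.-integrable setT (EFin \o zeta).
Proof.
have -> : EFin \o zeta = (fun x => (contrast_scale^-1)%:E * (EFin \o W P r k) x)%E.
  by apply/funext => x; rewrite /= -EFinM mulrC.
exact: integrableZl.
Qed.

Let zeta2E x : zeta x ^+ 2 = (contrast_scale ^+ 2)^-1 * W P r k x ^+ 2.
Proof. by rewrite exprMn exprVn mulrC. Qed.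

Lemma integrable_scaled_contrast_sqr :
  P.-integrable setT (EFin \o (fun x => zeta x ^+ 2)).
Proof.
have -> : EFin \o (fun x => zeta x ^+ 2) =
    (fun x => ((contrast_scale ^+ 2)^-1)%:E * (EFin \o (fun x => W P r k x ^+ 2)%R) x)%E.
  by apply/funext => x; rewrite /= -EFinM zeta2E.
exact: integrableZl.
Qed.

Lemma mean_scaled_contrast : Ex P zeta = 0.
Proof.
rewrite (@eq_Ex _ _ _ P _ (fun x => contrast_scale^-1 * W P r k x)); last first.
  by move=> x; rewrite mulrC.
by rewrite /Ex RintegralZl// -/(Ex P _) EW mulr0.
Qed.

Lemma var_scaled_contrast : n%:R * Ex P (fun x => zeta x ^+ 2) = 1.
Proof.
rewrite (eq_Ex P zeta2E) /Ex RintegralZl//.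
have -> : (\int[P]_x (W P r k x ^+ 2))%R = fine (EW2 P r k).
  by rewrite /EW2 unlock.
have [_ s0] := EW2_fin; rewrite scale_sqr.
by field; rewrite !gt_eqF.
Qed.

Lemma lyapunovE : (lyapunov P zeta n%:R)%:E =
  ('E_P[fun x => (W P r k x ^+ 2 / fine (EW2 P r k) *
        Num.min 1 (`|W P r k x| / (Num.sqrt n%:R * Num.sqrt (fine (EW2 P r k)))))%R])%E.
Proof.
have [_ s0] := EW2_fin.
have it := integrable_tsqr measurable_scaled_contrast integrable_scaled_contrast_sqr.
rewrite /lyapunov -RintegralZl// unlock.
have -> : (\int[P]_x (n%:R * tsqr zeta x))%:E%R = (\int[P]_x (n%:R * tsqr zeta x)%:E)%E.
  rewrite /Rintegral fineK//; apply: integrable_fin_num => //.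
  have -> : (fun x => (n%:R * tsqr zeta x)%:E) =
    (fun x => (n%:R)%:E * (EFin \o tsqr zeta) x)%E by apply/funext.
  exact: integrableZl.
apply: eq_integral => x _; congr EFin.
rewrite /tsqr mulrA zeta2E scale_sqr; congr (_ * Num.min 1 _).
  by field; rewrite !gt_eqF.
by rewrite normrM normfV (gtr0_norm contrast_scale_gt0).
Qed.

End contrast_law.

Section two_halves.
Context {R : realType} {d n : nat} {P : probability (d.-tuple R) R}.
Variables (kappa : R) (s : selection_rule) (r : 'I_d) (S : iid_sample (n + n) P).
Hypothesis n2 : (2 <= n)%N.
Hypothesis d2 : (2 <= d)%N.
Hypothesis kappa0 : 0 < kappa.
Hypothesis P0 : null_law r P.
Implicit Types (k : 'I_d) (t : R).

Local Notation Pr := (iid_prob S).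
Local Notation X := (@iid_obs _ _ _ _ _ S).
Local Notation bm := bounded_measurable.

Definition first_half : {set 'I_(n + n)} := [set lshift n i | i : 'I_n]%SET.
Definition second_half : {set 'I_(n + n)} := [set rshift n i | i : 'I_n]%SET.

Let halves_disjoint i : i \in second_half -> i \notin first_half.
Proof.
move=> /imsetP[a _ ->]; apply/negP => /imsetP[b _ /esym/eqP].
by rewrite eq_lrshift.
Qed.

Let card_first : #|first_half|%:R = n%:R :> R.
Proof. by rewrite card_imset ?card_ord//; exact: lshift_inj. Qed.

Let sum_first (F : 'I_(n + n) -> R) :
  \sum_(i in first_half) F i = \sum_(i < n) F (lshift n i).
Proof. by rewrite big_imset//= => i j _ _; exact: lshift_inj. Qed.

Let x0 : d.-tuple R := [tuple 0 | _ < d].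

Let masked1 w (i : 'I_n) : tnth (masked X x0 first_half w) (lshift n i) = X (lshift n i) w.
Proof. by rewrite tnth_mktuple imset_f. Qed.

Let masked2 w (i : 'I_n) : tnth (masked X x0 second_half w) (rshift n i) = X (rshift n i) w.
Proof. by rewrite tnth_mktuple imset_f. Qed.

Let mtt (i : 'I_(n + n)) (j : 'I_d) :
  measurable_fun setT (fun u : (n + n).-tuple (d.-tuple R) => tnth (tnth u i) j).
Proof.
apply: (measurableT_comp (f := fun x : d.-tuple R => tnth x j)).
  exact: measurable_tnth.
exact: measurable_tnth.
Qed.

(* [s_hat] depends on the second half only. *)
Lemma select_independent k (F : ('I_n -> 'cV[R]_d) -> R) :
  measurable_fun setT (fun u : (n + n).-tuple (d.-tuple R) =>
    F (fun i => vec (tnth u (lshift n i)))) ->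
  bm (fun w => F (half1 (S := S) w)) ->
  Ex Pr (fun w => (s_hat kappa s r (S := S) w == k)%:R * F (half1 w)) =
  Ex Pr (fun w => (s_hat kappa s r (S := S) w == k)%:R) * Ex Pr (fun w => F (half1 w)).
Proof.
move=> mF bF.
pose F1 (u : (n + n).-tuple (d.-tuple R)) := F (fun i => vec (tnth u (lshift n i))).
pose b2 (u : (n + n).-tuple (d.-tuple R)) :=
  select kappa s r (fun i : 'I_n => vec (tnth u (rshift n i))) == k.
pose F2 u : R := (b2 u)%:R.
have mb2 : measurable_fun setT b2.
  apply: (measurable_select (Y := fun u (i : 'I_n) => vec (tnth u (rshift n i)))) => //.
  move=> i j; have -> : (fun u : (n + n).-tuple (d.-tuple R) =>
      vec (tnth u (rshift n i)) j 0) = (fun u => tnth (tnth u (rshift n i)) j).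
    by apply/funext => u; rewrite mxE.
  exact: mtt.
have [mF2 _] : bm F2 by exact: bm_bool.
have E1 : F1 \o masked X x0 first_half = (fun w => F (half1 w)).
  apply/funext => w; rewrite /F1.
  have -> : half1 w = (fun i : 'I_n => vec (tnth (masked X x0 first_half w) (lshift n i))).
    by apply/funext => i; rewrite masked1.
  by [].
have E2 : F2 \o masked X x0 second_half = (fun w => (s_hat kappa s r w == k)%:R).
  apply/funext => w; rewrite /F2 /b2 /s_hat.
  have -> : half2 w = (fun i : 'I_n => vec (tnth (masked X x0 second_half w) (rshift n i))).
    by apply/funext => i; rewrite masked2.
  by [].
have mU J := measurable_masked x0 (@iid_measurable _ _ _ _ _ S) J.
have := @Ex_independentM _ _ _ Pr (F2 \o masked X x0 second_half)
  (F1 \o masked X x0 first_half).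
rewrite E1 E2; apply; rewrite -?E1 -?E2.
- split; first exact: measurableT_comp mF2 (mU _).
  by exists 1 => w; rewrite /F2 /=; case: (b2 _); rewrite ?normr1 ?normr0.
- by rewrite E1.
- apply: independent_pair_masked.
  + exact: iid_measurable.
  + exact: iid_indep.
  + exact: halves_disjoint.
  + exact: mF2.
  + exact: mF.
Qed.

Let mvec (sh : 'I_n -> 'I_(n + n)) i j :
  measurable_fun setT (fun u : (n + n).-tuple (d.-tuple R) => vec (tnth u (sh i)) j 0).
Proof.
have -> : (fun u : (n + n).-tuple (d.-tuple R) => vec (tnth u (sh i)) j 0) =
    (fun u => tnth (tnth u (sh i)) j) by apply/funext => u; rewrite mxE.
exact: mtt.
Qed.

Let mhalf (sh : 'I_n -> 'I_(n + n)) i j :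
  measurable_fun setT (fun w => vec (X (sh i) w) j 0).
Proof.
have -> : (fun w => vec (X (sh i) w) j 0) = (fun x : d.-tuple R => tnth x j) \o X (sh i).
  by apply/funext => w; rewrite /= mxE.
apply: measurableT_comp; first exact: measurable_tnth.
exact: iid_measurable.
Qed.

Let bm_sel k : bm (fun w => (s_hat kappa s r (S := S) w == k)%:R : R).
Proof.
by apply: bm_bool; apply: measurable_select => // i j; exact: mhalf.
Qed.

(** The selected index is never [r], so exactly one indicator in the sum is 1. *)
Lemma sum_select (F : 'I_d -> R) w :
  \sum_(k | k != r) (s_hat kappa s r (S := S) w == k)%:R * F k = F (s_hat kappa s r w).
Proof.
have sr : s_hat kappa s r w != r.
  exact: (select_neq (@half2 _ _ _ _ S)).
rewrite (bigD1 (s_hat kappa s r w))//= eqxx mul1r big1 ?addr0// => j /andP[_ js].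
by rewrite eq_sym (negbTE js) mul0r.
Qed.

(** * Laws with a fixed index *)

Section contrast.
Variable k : 'I_d.
Hypothesis kr : k != r.

Local Notation zeta := (scaled_contrast P r k n).
Local Notation B := (lyapunov P zeta n%:R).
Let z i w := zeta (X i w).
Let c := contrast_scale P r k n.

Let c0 : 0 < c. Proof. exact: contrast_scale_gt0. Qed.

Let yE w (i : 'I_n) : dotv (gammav r k) (half1 w i - mu P) = c * z (lshift n i) w.
Proof. by rewrite -[LHS]/(W P r k (X (lshift n i) w)) (WscaleE P0 kr n2). Qed.

Let n0 : (0 < n)%N. Proof. by apply: leq_trans n2. Qed.
Let nR2 : 2 <= n%:R :> R. Proof. by rewrite ler_nat. Qed.
Let nR0 : 0 < n%:R :> R. Proof. exact: lt_le_trans nR2. Qed.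

Let sdE w : sample_sd (half1 w) r k =
  Num.sqrt (c ^+ 2 * (student_gap z first_half n%:R w / (n%:R * (n%:R - 1)))).
Proof.
rewrite (sample_sdE _ (mu P))//; congr Num.sqrt.
rewrite /student_gap !sum_first.
rewrite (eq_bigr (fun i => c ^+ 2 * z (lshift n i) w ^+ 2)); last first.
  by move=> i _; rewrite yE exprMn.
rewrite [in X in _ - X](eq_bigr (fun i => c * z (lshift n i) w)); last first.
  by move=> i _; rewrite yE.
rewrite -!mulr_sumr; ring.
Qed.

(** Numerator and sample deviation both carry the factor c / sqrt n. The identity survives a
    vanishing denominator, where both ratios are 0. *)
Let studE w : studentized (mu P) (half1 w) r k = student z first_half n%:R w.
Proof.
rewrite /studentized sdE dotv_sample_mean// (eq_bigr (fun i => c * z (lshift n i) w)); last first.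
  by move=> i _; rewrite yE.
rewrite -mulr_sumr /student sum_first; set a := \sum_(i < n) _.
have n1 : 0 < n%:R - 1 :> R by have := nR2; lra.
have s0 : 0 < Num.sqrt n%:R :> R by rewrite sqrtr_gt0.
have -> : c ^+ 2 * (student_gap z first_half n%:R w / (n%:R * (n%:R - 1))) =
   (c / Num.sqrt n%:R) ^+ 2 * (student_gap z first_half n%:R w / (n%:R - 1)).
  rewrite expr_div_n sqr_sqrtr ?(ltW nR0)//.
  by field; rewrite !gt_eqF.
rewrite sqrtrM ?sqr_ge0// sqrtr_sqr ger0_norm; last by rewrite divr_ge0// ltW.
have sn : n%:R = Num.sqrt n%:R ^+ 2 :> R by rewrite sqr_sqrtr// ltW.
rewrite invfM mulrA; congr (_ * _).
rewrite [X in X^-1 * (c * a)]sn.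
by field; rewrite !gt_eqF.
Qed.

Lemma berry_esseen_contrast t :
  `|Ex Pr (fun w => (studentized (mu P) (half1 (S := S) w) r k <= t)%R%:R) - ncdf t|
  <= 74 * (40 * 100) * B.
Proof.
rewrite (@eq_Ex _ _ _ Pr _ (fun w => (student z first_half n%:R w <= t)%R%:R)); last first.
  by move=> w; rewrite studE.
apply: berry_esseen_iid => //.
- exact: iid_measurable.
- exact: iid_law.
- exact: iid_indep.
- exact: measurable_scaled_contrast.
- exact: integrable_scaled_contrast.
- exact: integrable_scaled_contrast_sqr.
- exact: mean_scaled_contrast.
- exact: var_scaled_contrast.
Qed.

Lemma degenerate_contrast :
  Ex Pr (fun w => (sample_sd (half1 (S := S) w) r k <= 0)%R%:R) <= 89 * B.
Proof.
rewrite (@eq_Ex _ _ _ Pr _ (fun w => (student_gap z first_half n%:R w <= 0)%R%:R)); last first.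
  move=> w; rewrite sdE; congr (nat_of_bool _)%:R.
  rewrite !leNgt sqrtr_gt0 pmulr_rgt0 ?exprn_gt0// pmulr_lgt0//.
  by rewrite invr_gt0 mulr_gt0//; have := nR2; lra.
apply: degenerate_iid => //.
- exact: iid_measurable.
- exact: iid_law.
- exact: iid_indep.
- exact: measurable_scaled_contrast.
- exact: integrable_scaled_contrast.
- exact: integrable_scaled_contrast_sqr.
- exact: mean_scaled_contrast.
- exact: var_scaled_contrast.
Qed.

End contrast.

(** Measurability is expressed on tuples of observations, where the product sigma-algebra lives,
    through their first-half coordinates. *)
Let first_half_statistic (F : ('I_n -> 'cV[R]_d) -> R) : Prop :=
  measurable_fun setT (fun u : (n + n).-tuple (d.-tuple R) =>
    F (fun i => vec (tnth u (lshift n i)))) /\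
  exists M, forall Y, `|F Y| <= M.

Let bm_half1 F : first_half_statistic F -> bm (fun w => F (half1 (S := S) w)).
Proof.
move=> [mF [M FM]]; split; last by exists M.
have -> : (fun w => F (half1 (S := S) w)) =
    (fun u : (n + n).-tuple (d.-tuple R) => F (fun i => vec (tnth u (lshift n i)))) \o
    masked X x0 first_half.
  apply/funext => w /=.
  have -> : half1 w = (fun i : 'I_n => vec (tnth (masked X x0 first_half w) (lshift n i))).
    by apply/funext => i; rewrite masked1.
  by [].
by apply: measurableT_comp mF _; apply: measurable_masked; exact: iid_measurable.
Qed.

Let bm_selF k F : first_half_statistic F ->
  bm (fun w => (s_hat kappa s r (S := S) w == k)%:R * F (half1 (S := S) w)).
Proof. by move=> FF; apply: bmM; [exact: bm_sel|exact: bm_half1]. Qed.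

(** The halves being independent, the expectation is an average of the fixed-index ones weighted by
    the selection probabilities. A bound uniform in the index carries over at no cost in [d]. *)
Lemma select_average_le (F : 'I_d -> ('I_n -> 'cV[R]_d) -> R) (K : R) :
  (forall k, k != r -> first_half_statistic (F k)) ->
  (forall k, k != r -> Ex Pr (fun w => F k (half1 (S := S) w)) <= K) ->
  Ex Pr (fun w => F (s_hat kappa s r (S := S) w) (half1 w)) <= K.
Proof.
move=> FF FK.
have -> : Ex Pr (fun w => F (s_hat kappa s r (S := S) w) (half1 w)) =
    \sum_(k | k != r) Ex Pr (fun w => (s_hat kappa s r (S := S) w == k)%:R) *
      Ex Pr (fun w => F k (half1 (S := S) w)).
  rewrite (@eq_Ex _ _ _ Pr _ (fun w =>
      \sum_(k | k != r) (s_hat kappa s r (S := S) w == k)%:R * F k (half1 w))); last first.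
    by move=> w; rewrite (sum_select (fun k => F k (half1 w))).
  rewrite Ex_sum; last by move=> k kr; apply: bm_selF; exact: FF.
  apply: eq_bigr => k kr; apply: select_independent; last exact: bm_half1 (FF k kr).
  by have [] := FF k kr.
have sum1 : \sum_(k | k != r) Ex Pr (fun w => (s_hat kappa s r (S := S) w == k)%:R) = 1.
  rewrite -Ex_sum; last by move=> k _; exact: bm_sel.
  rewrite -[RHS](Ex_cst Pr 1); apply: eq_Ex => w.
  by rewrite -[RHS](sum_select (fun=> 1) w); apply: eq_bigr => k _; rewrite mulr1.
have -> : K = \sum_(k | k != r) Ex Pr (fun w => (s_hat kappa s r (S := S) w == k)%:R) * K.
  by rewrite -mulr_suml sum1 mul1r.
by apply: ler_sum => k kr; apply: ler_wpM2l; [exact: Ex_ge0|exact: FK].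
Qed.

(** * The selected statistic and the test *)

Variable M : R.
Hypothesis lyapunov_le : forall k, k != r ->
  lyapunov P (scaled_contrast P r k n) n%:R <= M.

Let stud_le t k (Y : 'I_n -> 'cV[R]_d) : R := (studentized (mu P) Y r k <= t)%R%:R.

Let stud_le_statistic t k : first_half_statistic (stud_le t k).
Proof.
split; last by exists 1 => Y; rewrite /stud_le; case: (_ <= t); rewrite ?normr1 ?normr0.
apply: bm_measurable; apply: bm_bool; apply: measurable_fun_ler => //.
exact: (measurable_studentized (Y := fun u (i : 'I_n) => vec (tnth u (lshift n i)))).
Qed.

Lemma bm_select_statistic (F : 'I_d -> ('I_n -> 'cV[R]_d) -> R) :
  (forall k, k != r -> first_half_statistic (F k)) ->
  bm (fun w => F (s_hat kappa s r (S := S) w) (half1 w)).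
Proof.
move=> FF.
have -> : (fun w => F (s_hat kappa s r (S := S) w) (half1 w)) =
    (fun w => \sum_(k | k != r) (s_hat kappa s r (S := S) w == k)%:R * F k (half1 w)).
  by apply/funext => w; rewrite (sum_select (fun k => F k (half1 w))).
by apply: bm_sum => k kr; apply: bm_selF; exact: FF.
Qed.

Lemma bm_studentized_select t :
  bm (fun w => (studentized (mu P) (half1 (S := S) w) r (s_hat kappa s r w) <= t)%R%:R : R).
Proof.
by apply: (bm_select_statistic (F := stud_le t)) => k _; exact: stud_le_statistic.
Qed.

Let const_ge0 : 0 <= 74 * (40 * 100) :> R.
Proof. by rewrite !mulr_ge0. Qed.

Lemma studentized_berry_esseen t :
  `|Ex Pr (fun w => (studentized (mu P) (half1 (S := S) w) r (s_hat kappa s r w) <= t)%R%:R)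
    - ncdf t| <= 74 * (40 * 100) * M.
Proof.
set K := _ * M.
have bound k : k != r ->
    `|Ex Pr (fun w => stud_le t k (half1 (S := S) w)) - ncdf t| <= K.
  move=> kr; apply: (le_trans (berry_esseen_contrast kr t)).
  by apply: ler_wpM2l; [exact: const_ge0|exact: lyapunov_le].
have up : Ex Pr (fun w => stud_le t (s_hat kappa s r (S := S) w) (half1 w)) <= ncdf t + K.
  apply: select_average_le => [k kr|k kr]; first exact: stud_le_statistic.
  by have := bound k kr; rewrite ler_norml; lra.
(* The averaging lemma is one-sided; the lower bound comes from the negated indicator. *)
have lo : Ex Pr (fun w => - stud_le t (s_hat kappa s r (S := S) w) (half1 w)) <= K - ncdf t.
  apply: (select_average_le (F := fun k Y => - stud_le t k Y)) => k kr.
    have [mS [C SC]] := stud_le_statistic t k; split.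
      by apply: measurableT_comp => //; exact: oppr_measurable.
    by exists C => Y; rewrite normrN.
  rewrite (@eq_Ex _ _ _ Pr _ (fun w => -1 * stud_le t k (half1 w))); last first.
    by move=> w; rewrite mulN1r.
  rewrite ExZ; last exact: bm_half1 (stud_le_statistic t k).
  have := bound k kr; rewrite ler_norml => /andP[b _].
  by rewrite mulN1r lerNl opprB -lerBrDl.
have bs := bm_studentized_select t.
rewrite (@eq_Ex _ _ _ Pr _ (fun w => -1 * stud_le t (s_hat kappa s r w) (half1 w))) in lo; last first.
  by move=> w; rewrite mulN1r.
rewrite ExZ// in lo.
rewrite -/(stud_le t _ _) ler_norml; apply/andP; split; lra.
Qed.

Let mfirst i j : measurable_fun setT
  (fun u : (n + n).-tuple (d.-tuple R) => vec (tnth u (lshift n i)) j 0).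
Proof. exact: (mvec (@lshift n n)). Qed.

Let sd_le0_statistic k :
  first_half_statistic (fun Y => (sample_sd Y r k <= 0)%R%:R).
Proof.
split; last by exists 1 => Y; case: (sample_sd Y r k <= 0); rewrite ?normr1 ?normr0.
apply: bm_measurable; apply: bm_bool; apply: measurable_fun_ler => //.
exact: (measurable_sample_sd (Y := fun u (i : 'I_n) => vec (tnth u (lshift n i)))).
Qed.

Let rejects (z : R) k (Y : 'I_n -> 'cV[R]_d) : R :=
  (z * sample_sd Y r k < Num.sqrt n%:R * dotv (gammav r k) (sample_mean Y))%R%:R.

Let rejects_statistic z k : first_half_statistic (rejects z k).
Proof.
split; last by exists 1 => Y; rewrite /rejects; case: (_ < _); rewrite ?normr1 ?normr0.
pose Y (u : (n + n).-tuple (d.-tuple R)) (i : 'I_n) := vec (tnth u (lshift n i)).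
apply: bm_measurable; apply: bm_bool; apply: measurable_fun_ltr.
  by apply: measurable_funM => //; exact: (measurable_sample_sd (Y := Y)).
apply: measurable_funM => //.
have -> : (fun u => dotv (gammav r k) (sample_mean (Y u))) =
    (fun u => sample_mean (Y u) r 0 - sample_mean (Y u) k 0).
  by apply/funext => u; rewrite dotv_gammav.
by apply: measurable_funB; exact: (measurable_sample_mean (Y := Y)).
Qed.

Lemma bm_psi alpha : bm (fun w => (psi kappa s r (S := S) alpha w)%:R : R).
Proof.
apply: (bm_select_statistic (F := rejects (z_quantile (1 - alpha)))) => k _.
exact: rejects_statistic.
Qed.

(* Under the null, rejection forces the studentized statistic above the
   quantile unless the sample standard deviation vanishes. *)
Let rejects_le z k Y : rejects z k Y <= 1 - stud_le z k Y + (sample_sd Y r k <= 0)%R%:R.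
Proof.
rewrite /rejects /stud_le; have [_ rT _] := P0.
have mu_le : mu P r 0 <= mu P k 0 by move: rT; rewrite inE => /forallP.
case: ltP => [h|_]; last first.
  by case: (studentized _ _ _ _ <= z) => /=; case: (sample_sd Y r k <= 0) => /=; lra.
have [sd0|sd0] := leP (sample_sd Y r k) 0.
  by case: (studentized _ _ _ _ <= z) => /=; lra.
have : z < studentized (mu P) Y r k.
  rewrite /studentized ltr_pdivlMr//; apply: (lt_le_trans h).
  rewrite ler_wpM2l// dotv_gammavE dotv_gammav; lra.
by rewrite ltNge => /negbTE -> /=; lra.
Qed.

(** The majorant of [rejects_le] is averaged over the index. For a fixed index its expectation is 1
    - [ncdf q] <= alpha, plus the Berry-Esseen error and the probability of a vanishing
    deviation. *)
Lemma reject_bound alpha q : q = z_quantile (1 - alpha) -> 1 - alpha <= ncdf q ->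
  Ex Pr (fun w => (psi kappa s r (S := S) alpha w)%:R) <=
  alpha + (74 * (40 * 100) + 89) * M.
Proof.
move=> qE hq.
pose F k Y : R := 1 - stud_le q k Y + (sample_sd Y r k <= 0)%R%:R.
have FS k : first_half_statistic (F k).
  have [m1 [M1 b1]] := stud_le_statistic q k; have [m2 [M2 b2]] := sd_le0_statistic k.
  split; first by apply: measurable_funD => //; exact: measurable_funB.
  exists (1 + M1 + M2) => Y; apply: (le_trans (ler_normD _ _)); apply: lerD => //.
  by apply: (le_trans (ler_normB _ _)); rewrite normr1 lerD2l.
apply: (@le_trans _ _ (Ex Pr (fun w => F (s_hat kappa s r (S := S) w) (half1 w)))).
  apply: le_Ex; first exact: bm_psi.
    by apply: bm_select_statistic.
  by move=> w; rewrite /psi -qE; exact: (rejects_le q (s_hat kappa s r w) (half1 w)).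
apply: select_average_le => // k kr.
have bs := bm_half1 (stud_le_statistic q k); have bd := bm_half1 (sd_le0_statistic k).
have b1 : bm (fun _ : iid_space S => 1 : R) by exact: bm_cst.
rewrite ExD//; last exact: bmB.
rewrite ExB// Ex_cst.
have := berry_esseen_contrast kr q; rewrite -/(stud_le q k _).
set e := Ex Pr _; rewrite ler_norml => /andP[he _].
have := degenerate_contrast kr; set g := Ex Pr _ => hg.
have BM := lyapunov_le kr; set B := lyapunov _ _ _ in BM he hg.
have h1 : 74 * (40 * 100) * B <= 74 * (40 * 100) * M by apply: ler_wpM2l; [exact: const_ge0|].
have h2 : 89 * B <= 89 * M by apply: ler_wpM2l.
rewrite mulrDl; move: (74 * (40 * 100) * M) (74 * (40 * 100) * B) h1 he => c1 c2 h1 he.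
lra.
Qed.

End two_halves.

(** * Uniform bounds *)

Section normal_quantile.
Context {R : realType}.

(** The tail bounds make the set nonempty and bounded below, so its infimum is genuine; the
    Lipschitz property of [ncdf] carries the inequality to the infimum. *)
Lemma ncdf_z_quantile (q : R) : 0 < q < 1 -> q <= ncdf (z_quantile q).
Proof.
move=> /andP[q0 q1].
pose A := [set t : R | (q%:E <= Phi t)%E].
have AE t : A t <-> q <= ncdf t by rewrite /A /= PhiE lee_fin.
have tail (u e : R) : 0 < u -> 0 < e -> e^-1 <= u ^+ 2 -> 1 - ncdf u <= e.
  move=> u0 e0 eu; apply: (le_trans (ncdf_tail u0)).
  by rewrite -[leRHS]invrK lef_pV2 ?posrE ?exprn_gt0 ?invr_gt0.
have A0 : A !=set0.
  (* The tail beyond u is at most 1 / u^2, and this u satisfies u^2 >= 1 / (1 - q). The lower bound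
     below is chosen likewise, for a tail of q / 2. *)
  exists (1 + (1 - q)^-1); apply/AE.
  have p0 : 0 < (1 - q)^-1 by rewrite invr_gt0 subr_gt0.
  have := @tail (1 + (1 - q)^-1) (1 - q); rewrite subr_gt0 => H.
  suff : 1 - ncdf (1 + (1 - q)^-1) <= 1 - q by lra.
  by apply: H => //; nra.
have hA : has_lbound A.
  pose b := 1 + 2 * q^-1.
  have p0 : 0 < q^-1 by rewrite invr_gt0.
  have b0 : 0 < b by rewrite /b; lra.
  exists (- b) => t /AE qt; rewrite leNgt; apply/negP => tb.
  have : ncdf t <= ncdf (- b) by apply: ncdf_nondecreasing; exact: ltW.
  rewrite ncdfN => h.
  have : 1 - ncdf b <= q / 2.
    apply: tail => //; first by rewrite divr_gt0.
    by rewrite invfM invrK /b; nra.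
  by lra.
apply/ler_addgt0Pr => e e0.
have [t At te] : exists2 t, A t & t < inf A + e.
  by apply: inf_adherent.
have it : inf A <= t by apply: ge_inf.
move/AE: At => qt; rewrite /z_quantile -/A.
have := ncdf_lipschitz t (inf A); rewrite [leRHS]ger0_norm ?subr_ge0//.
by rewrite ler_norml => /andP[_ h]; lra.
Qed.

End normal_quantile.

(** The limsup is an infimum, over neighbourhoods of infinity, of suprema; the set where the bound
    holds is one of these neighbourhoods. *)
Lemma limn_esup_le_near {R : realType} (u : (\bar R)^nat) (l : \bar R) :
  (\forall n \near \oo, (u n <= l)%E) -> (limn_esup u <= l)%E.
Proof.
move=> ul; apply: ge_ereal_inf; exists (ereal_sup (u @` [set n | (u n <= l)%E])).
  by exists [set n | (u n <= l)%E].
by apply: ge_ereal_sup => _ [n nl <-].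
Qed.

Section uniform_bounds.
Context {R : realType} {d n : nat}.
Variables (r : 'I_d) (Pc : set (probability (d.-tuple R) R)).
Variable S : forall P : probability (d.-tuple R) R, iid_sample (n + n) P.
Variables (kappa : R) (s : selection_rule).
Hypothesis n2 : (2 <= n)%N.
Hypothesis d2 : (2 <= d)%N.
Hypothesis kappa0 : 0 < kappa.
Hypothesis null : forall P, Pc P -> null_law r P.

Lemma lyapunov_le_max_Mk P k : Pc P -> k != r ->
  ((lyapunov P (scaled_contrast P r k n) n%:R)%:E <= max_Mk n r Pc)%E.
Proof.
move=> PcP kr; apply: (@le_trans _ _ (Mk n r Pc k)); last first.
  by rewrite /max_Mk (bigD1 k)//= le_max lexx.
rewrite lyapunovE//; last exact: null.
by apply: ereal_sup_ubound; exists P.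
Qed.

Let exists_other : exists k, k != r.
Proof. by exists (sargmin r (fun=> 0 : R)); have /and3P[] := sargminP r (fun=> 0 : R) d2. Qed.


(** A real Lyapunov quantity lies below [max_Mk], which rules out -oo; an index other than [r]
    exists because d >= 2. When the maximum is +oo, the bounds below hold trivially. *)
Lemma max_Mk_cases P : Pc P -> max_Mk n r Pc = +oo%E \/
  exists2 M : R, max_Mk n r Pc = M%:E & forall k, k != r ->
    lyapunov P (scaled_contrast P r k n) n%:R <= M.
Proof.
move=> PcP; have [k kr] := exists_other.
have h := lyapunov_le_max_Mk PcP.
case: (max_Mk n r Pc) h => [M||] h; [right|by left|].
  by exists M => // j jr; rewrite -lee_fin; exact: h.
by move: (h k kr); rewrite leNgt ltNyr.
Qed.

Local Notation C := (74 * (40 * 100)).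

Lemma studentized_deviation P t : Pc P ->
  (`|prob_studentized_le kappa s r (S P) t - Phi t| <=
   mine 1 (C%:E * max_Mk n r Pc))%E.
Proof.
move=> PcP; have P0 := null PcP.
have bs : bounded_measurable (fun w => (studentized (mu P) (half1 (S := S P) w) r
    (s_hat kappa s r w) <= t)%R%:R : R) by exact: bm_studentized_select.
rewrite /prob_studentized_le prob_boolE// PhiE -EFinB abse_EFin.
rewrite le_min; apply/andP; split.
  rewrite lee_fin; set e := Ex _ _.
  have e0 : 0 <= e by apply: Ex_ge0.
  have e1 : e <= 1.
    rewrite -(Ex_cst (iid_prob (S P)) 1); apply: le_Ex => //; first exact: bm_cst.
    by move=> w; case: (_ <= t).
  by have := ncdf_ge0 t; have := ncdf_le1 t; rewrite ler_norml; lra.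
have [->|[M -> MP]] := max_Mk_cases PcP.
  by rewrite gt0_muley ?leey// lte_fin !mulr_gt0.
by rewrite -EFinM lee_fin; exact: studentized_berry_esseen.
Qed.

Lemma reject_deviation P alpha : 0 < alpha < 1 -> Pc P ->
  (prob_reject kappa s r (S P) alpha <=
   alpha%:E + (C + 89)%:E * max_Mk n r Pc)%E.
Proof.
move=> a01 PcP; have P0 := null PcP.
have hq : 1 - alpha <= ncdf (z_quantile (1 - alpha)) by apply: ncdf_z_quantile; lra.
rewrite /prob_reject prob_boolE; last exact: bm_psi.
have [->|[M -> MP]] := max_Mk_cases PcP.
  rewrite gt0_muley ?addey ?leey// lte_fin addr_gt0// !mulr_gt0//.
by rewrite -EFinM -EFinD lee_fin; exact: reject_bound (erefl _) hq.
Qed.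

End uniform_bounds.

Theorem theorem2p1 (R : realType) :
  (exists C : R, 0 < C /\
    forall (n d : nat) (r : 'I_d) (Pc : set (probability (d.-tuple R) R))
      (S : forall P : probability (d.-tuple R) R, iid_sample (n + n) P)
      (kappa : R) (s : selection_rule),
      (2 <= n)%N -> (2 <= d)%N -> 0 < kappa ->
      (forall P, Pc P -> null_law r P) ->
      (ereal_sup
         [set ereal_sup
            [set `|prob_studentized_le kappa s r (S P) t - Phi t|
            | t in [set: R]]
         | P in Pc]
       <= mine 1 (C%:E * max_Mk n r Pc))%E) /\
  (forall (alpha : R) (d : nat -> nat) (r : forall n, 'I_(d n))
      (Pc : forall n, set (probability ((d n).-tuple R) R))
      (S : forall n (P : probability ((d n).-tuple R) R),
         iid_sample (n + n) P)
      (kappa : R) (s : selection_rule),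
      0 < alpha < 1 -> 0 < kappa ->
      (forall n, (2 <= n)%N -> (2 <= d n)%N) ->
      (forall n, (2 <= n)%N -> forall P, Pc n P -> null_law (r n) P) ->
      max_Mk n (r n) (Pc n) @[n --> \oo] --> 0%E ->
      (limn_esup (fun n =>
         ereal_sup [set prob_reject kappa s (r n) (S n P) alpha | P in Pc n])
       <= alpha%:E)%E).
Proof.
split.
  exists (74 * (40 * 100)); split; first by rewrite !mulr_gt0.
  move=> n d r Pc S kappa s n2 d2 kappa0 null.
  apply: ge_ereal_sup => _ [P PcP <-]; apply: ge_ereal_sup => _ [t _ <-].
  exact: studentized_deviation.
move=> alpha d r Pc S kappa s a01 kappa0 d2 null cvg0.
apply/lee_addgt0Pr => e e0.
pose K : R := 74 * (40 * 100) + 89.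
have K0 : 0 < K by rewrite addr_gt0// !mulr_gt0.
apply: limn_esup_le_near.
(* The threshold e / K makes the excess over [alpha] in [reject_deviation] at most [e], uniformly
   over the class. *)
have small : \forall n \near \oo, (max_Mk n (r n) (Pc n) < (e / K)%:E)%E.
  apply: (cvg0 [set y | (y < (e / K)%:E)%E]); apply: open_nbhs_nbhs.
  by split; [exact: open_ereal_lt_ereal|rewrite /= lte_fin divr_gt0].
near=> n.
have n2 : (2 <= n)%N by near: n; exists 2%N.
apply: ge_ereal_sup => _ [P PcP <-].
apply: (le_trans (reject_deviation (S n) s n2 (d2 n n2) kappa0 (null n n2) a01 PcP)).
rewrite leeD2l//.
have : (max_Mk n (r n) (Pc n) <= (e / K)%:E)%E by apply: ltW; near: n.
have K0' : (0 <= K%:E)%E by rewrite lee_fin ltW.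
move=> /(lee_wpmul2l K0'); rewrite -/K -EFinM mulrC divfK ?gt_eqF//.
Unshelve. all: by end_near. Qed.
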